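(* Let $b>0$. Then there is a constant $C>0$, independent of $\omega$, $\ell$ and $m$, such that the reduced resolvent $R_{\ell,m}$ satisfies $$\|R_{\ell,m}(d+b+i\omega)\|_{L^2_{\mathrm{rad}}(\mathbb{R}^d)}\le C$$ for all $\omega\gg1$ (that is, for all sufficiently large real $\omega$, with the threshold independent of $\ell$ and $m$) and all $(\ell,m)\in\Omega_d$.
   Context: Let $d\ge2$ and let $V:[0,\infty)\to\mathbb{C}$ satisfy $|V(r)|\le C_V\langle r\rangle^{-2}$ and $|V'(r)|\le C_V\langle r\rangle^{-3}$ for all $r\ge0$ and some constant $C_V>0$, where $\langle r\rangle:=\sqrt{1+r^2}$. Put $\mathcal{L}_V u(x):=\Delta u(x)-2x\cdot\nabla u(x)+V(|x|)u(x)$ and let $L$ be the closure in $L^2(\mathbb{R}^d)$ of the operator $u\mapsto\mathcal{L}_V u$ with domain $\{u\in H^2(\mathbb{R}^d)\cap C^\infty(\mathbb{R}^d):\mathcal{L}_V u\in L^2(\mathbb{R}^d)\}$. Let $\rho(L)$ be the resolvent set of $L$ and $R(\lambda):=(\lambda-L)^{-1}$ for $\lambda\in\rho(L)$. $L^2_{\mathrm{rad}}(\mathbb{R}^d)$ is the space of $f:[0,\infty)\to\mathbb{C}$ with $\|f\|^2_{L^2_{\mathrm{rad}}(\mathbb{R}^d)}:=\int_0^\infty|f(r)|^2r^{d-1}\,dr<\infty$. Let $\{Y_{\ell,m}\}_{(\ell,m)\in\Omega_d}$ be the standard orthonormal basis of $L^2(\mathbb{S}^{d-1})$ consisting of spherical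 harmonics, where $Y_{\ell,m}$ is an eigenfunction of the (nonnegative) Laplace-Beltrami operator on $\mathbb{S}^{d-1}$ with eigenvalue $\ell(\ell+d-2)$, and $\Omega_d\subset\mathbb{N}_0\times\mathbb{Z}$ is the set of admissible indices (all $\ell\in\mathbb{N}_0$ occur). Define $P_{\ell,m}:L^2(\mathbb{R}^d)\to L^2_{\mathrm{rad}}(\mathbb{R}^d)$ by $[P_{\ell,m}f](r):=\int_{\mathbb{S}^{d-1}}f(r\theta)\overline{Y_{\ell,m}(\theta)}\,d\sigma(\theta)$, and $Q_{\ell,m}:L^2_{\mathrm{rad}}(\mathbb{R}^d)\to L^2(\mathbb{R}^d)$ by $[Q_{\ell,m}g](x):=g(|x|)Y_{\ell,m}(x/|x|)$. For $\lambda\in\rho(L)$ and $(\ell,m)\in\Omega_d$, the reduced resolvent is $R_{\ell,m}(\lambda):=P_{\ell,m}R(\lambda)Q_{\ell,m}$, a bounded operator on $L^2_{\mathrm{rad}}(\mathbb{R}^d)$; the norm in the claim is its operator norm on $L^2_{\mathrm{rad}}(\mathbb{R}^d)$. *)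

(* Defs.v *)
From HB Require Import structures.
From mathcomp Require Import all_boot all_order all_algebra.
From mathcomp Require Import all_classical all_reals all_analysis.
From mathcomp Require Import measurable_realfun complex.

Set Implicit Arguments.
Unset Strict Implicit.
Unset Printing Implicit Defensive.
Import Order.TTheory GRing.Theory Num.Def Num.Theory.
Import numFieldNormedType.Exports.

Local Open Scope classical_set_scope.
Local Open Scope complex_scope.
Local Open Scope ring_scope.

Definition measure_rV_display : measure_display -> measure_display.
Proof. exact. Qed.

Section measurable_rV.
Context {d} {T : measurableType d} (n : nat).

Definition rV_coord (i : 'I_n) (x : 'rV[T]_n) : T := x ord0 i.

Let rV_set0 : g_sigma_preimage rV_coord set0.
Proof. exact: sigma_algebra0. Qed.

Let rV_setC A : g_sigma_preimage rV_coord A -> g_sigma_preimage rV_coord (~` A).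
Proof. exact: sigma_algebraC. Qed.

Let rV_bigcup (F : _^nat) : (forall i, g_sigma_preimage rV_coord (F i)) ->
  g_sigma_preimage rV_coord (\bigcup_i (F i)).
Proof. exact: sigma_algebra_bigcup. Qed.

HB.instance Definition _ := @isMeasurable.Build (measure_rV_display d)
  'rV[T]_n (g_sigma_preimage rV_coord) rV_set0 rV_setC rV_bigcup.

End measurable_rV.

Section rV_cons.
Context {R : realType} (n : nat).

Definition rV_cons (p : measurableTypeR R * 'rV[R]_n) : 'rV[R]_n.+1 :=
  \row_i oapp (p.2 ord0) p.1 (unlift ord0 i).

Definition rV_uncons (x : 'rV[R]_n.+1) : measurableTypeR R * 'rV[R]_n :=
  (x ord0 ord0, \row_j x ord0 (lift ord0 j)).

Lemma rV_consK : cancel rV_cons rV_uncons.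
Proof.
move=> [t x]; rewrite /rV_cons /rV_uncons; congr pair.
  by rewrite mxE unlift_none.
by apply/rowP => j; rewrite !mxE liftK.
Qed.

Lemma rV_unconsK : cancel rV_uncons rV_cons.
Proof.
move=> x; apply/rowP => i; rewrite mxE /=.
by case: unliftP => [j ->|->] //=; rewrite mxE.
Qed.

End rV_cons.

Lemma measurable_rV_coord d (T : measurableType d) n (i : 'I_n) :
  measurable_fun [set: 'rV[T]_n] (fun x => x ord0 i).
Proof.
move=> _ Y mY; rewrite setTI; apply: sub_sigma_algebra => /=.
rewrite -bigcup_seq/=; exists i => /=; first by rewrite mem_index_enum.
by exists Y => //; rewrite setTI.
Qed.

Lemma measurable_fun_rV d1 d2 (T1 : measurableType d1) (T2 : measurableType d2)
    n (f : T1 -> 'rV[T2]_n) :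
  (forall i, measurable_fun [set: T1] (fun x => f x ord0 i)) ->
  measurable_fun [set: T1] f.
Proof.
move=> mf; suff H : g_sigma_preimage (fun i => @rV_coord _ T2 n i \o f)
    `<=` measurable.
  move=> _ A mA; rewrite setTI; apply: H.
  by rewrite g_sigma_preimage_comp; exists A => //; rewrite setTI.
apply: smallest_sub; first exact: sigma_algebra_measurable.
case: n => [|n] in f mf *; first by rewrite big_ord0.
rewrite -bigcup_mkord_ord; apply: bigcup_sub => i Ii.
by move=> A [B mB <-]; exact: mf.
Qed.

Lemma measurable_rV_cons (R : realType) n :
  measurable_fun setT (@rV_cons R n).
Proof.
apply: measurable_fun_rV => i.
case: (unliftP ord0 i) => [j ->|->].
  rewrite (_ : (fun _ => _) = (fun p : measurableTypeR R * 'rV[R]_n => p.2 ord0 j)).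
    exact: (measurableT_comp (measurable_rV_coord (j : 'I_n)) (@measurable_snd _ _ _ _)).
  by apply/funext => p; rewrite mxE liftK.
rewrite (_ : (fun _ => _) = fst) //.
by apply/funext => p; rewrite mxE unlift_none.
Qed.

Lemma measurable_rV_uncons (R : realType) n :
  measurable_fun setT (@rV_uncons R n).
Proof.
apply/measurable_fun_pairP; split; first exact: measurable_rV_coord.
apply: measurable_fun_rV => i.
rewrite (_ : (fun _ => _) = (fun x : 'rV[R]_n.+1 => x ord0 (lift ord0 i))).
  exact: measurable_rV_coord.
by apply/funext => x; rewrite /= mxE.
Qed.

Section rV_cons_measure.
Context {R : realType} (n : nat).
Variable m : {sigma_finite_measure set 'rV[R]_n -> \bar R}.

(* The image of the product measure dt * dm on R * R^n under
   (t, x) |-> (t, x_1, ..., x_n). *)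
Definition rV_cons_measure : set 'rV[R]_n.+1 -> \bar R :=
  pushforward (lebesgue_measure \x m)%E (@rV_cons R n).

HB.instance Definition _ := Measure.copy rV_cons_measure
  (measure_function_pushforward__canonical__measure_function_Measure
    (lebesgue_measure \x m)%E (@measurable_rV_cons R n)).

Let rV_cons_measure_sigma_finite : sigma_finite setT rV_cons_measure.
Proof.
have /sigma_finiteP[F [TF ndF Foo]] := sigma_finiteT (@lebesgue_measure R).
have /sigma_finiteP[G [TG ndG Goo]] := sigma_finiteT m.
exists (fun k => (@rV_uncons R n) @^-1` (F k `*` G k)).
  apply/esym; rewrite -subTset => x _.
  have [i _ Fi] : (\bigcup_k F k) (rV_uncons x).1 by rewrite -TF.
  have [j _ Gj] : (\bigcup_k G k) (rV_uncons x).2 by rewrite -TG.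
  exists (maxn i j) => //; split.
    by move: Fi; exact/subsetPset/ndF/leq_maxl.
  by move: Gj; exact/subsetPset/ndG/leq_maxr.
move=> k; have [mF Fk] := Foo k; have [mG Gk] := Goo k; split.
  rewrite -[X in measurable X]setTI; apply: measurable_rV_uncons => //.
  exact: measurableX.
rewrite /rV_cons_measure /pushforward -comp_preimage.
rewrite (_ : _ \o _ = id) ?preimage_id; last exact/funext/rV_consK.
by rewrite product_measure1E// lte_mul_pinfty// ge0_fin_numE.
Qed.

HB.instance Definition _ := Measure_isSigmaFinite.Build _ _ _
  rV_cons_measure rV_cons_measure_sigma_finite.

End rV_cons_measure.

Fixpoint lebesgue_rV (R : realType) (n : nat) :
    {sigma_finite_measure set 'rV[R]_n -> \bar R} :=
  match n with
  | 0 => \d_ (0 : 'rV[R]_0)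
  | n'.+1 => rV_cons_measure (lebesgue_rV R n')
  end.
Arguments lebesgue_rV {R n}.

Section sphere.
Context {R : realType} (n : nat).

Definition enorm (x : 'rV[R]_n) : R := Num.sqrt (\sum_i x ord0 i ^+ 2).

Definition unit_ball : set 'rV[R]_n := [set x | enorm x <= 1].

Definition unit_sphere : set 'rV[R]_n := [set x | enorm x = 1].

(* x / |x|, with value 0 at the origin *)
Definition direction (x : 'rV[R]_n) : 'rV[R]_n := (enorm x)^-1 *: x.

Let enorm_sum_ge0 (x : 'rV[R]_n) : 0 <= \sum_i x ord0 i ^+ 2.
Proof. by apply: sumr_ge0 => i _; rewrite sqr_ge0. Qed.

Let measurable_enorm_sum :
  measurable_fun setT (fun x : 'rV[R]_n => \sum_i x ord0 i ^+ 2).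
Proof.
apply: measurable_sum => i; apply: measurable_funX; exact: measurable_rV_coord.
Qed.

Lemma measurable_enorm : measurable_fun setT enorm.
Proof.
rewrite (_ : enorm = (fun y => y `^ 2^-1) \o
    (fun x : 'rV[R]_n => \sum_i x ord0 i ^+ 2)).
  by apply: measurableT_comp => //; exact: measurable_powR.
by apply/funext => x /=; rewrite powR12_sqrt.
Qed.

Lemma measurable_unit_ball : measurable unit_ball.
Proof.
rewrite (_ : unit_ball = enorm @^-1` `]-oo, 1]).
  by rewrite -[X in measurable X]setTI; exact: measurable_enorm.
by apply/seteqP; split => x; rewrite /= in_itv.
Qed.

Lemma measurable_direction : measurable_fun setT direction.
Proof.
apply: measurable_fun_rV => i.
rewrite (_ : (fun _ => _) = (fun x => enorm x `^ (-1) * x ord0 i)).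
  apply: measurable_funM; last exact: measurable_rV_coord.
  apply: (measurableT_comp (f := fun y : R => y `^ (-1))).
    exact: measurable_powR.
  exact: measurable_enorm.
apply/funext => x; rewrite mxE; congr (_ * _).
by rewrite powR_inv1// sqrtr_ge0.
Qed.

Definition direction_measure : set 'rV[R]_n -> \bar R :=
  pushforward (mrestr lebesgue_rV measurable_unit_ball) direction.

HB.instance Definition _ := Measure.copy direction_measure
  (measure_function_pushforward__canonical__measure_function_Measure
    (mrestr lebesgue_rV measurable_unit_ball) measurable_direction).

(* The cone measure: A |-> n * Leb {x | |x| <= 1, x / |x| \in A}.  It is
   carried by the unit sphere, on which it is the usual surface measure; its
   normalization is that of dx = r^(n-1) dr dsigma. *)
Definition surface_measure : set 'rV[R]_n -> \bar R :=
  mscale (n%:R%:nng : {nonneg R}) direction_measure.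

HB.instance Definition _ := Measure.on surface_measure.

End sphere.
Arguments surface_measure {R n}.

Notation normc := ComplexField.Normc.normc.

Section complex_L2.
Context d (T : measurableType d) (R : realType).
Variable mu : {measure set T -> \bar R}.
Implicit Types (D : set T) (f : T -> R[i]).

Definition cmeasurable_fun D f :=
  measurable_fun D (fun x => complex.Re (f x)) /\
  measurable_fun D (fun x => complex.Im (f x)).

Definition cintegral f : R[i] :=
  Rintegral mu setT (fun x => complex.Re (f x)) +i*
  Rintegral mu setT (fun x => complex.Im (f x)).

Definition L2norm f : \bar R :=
  Lnorm mu 2%:E (fun x => (normc (f x))%:E).

Definition L2 f := cmeasurable_fun setT f /\ (L2norm f < +oo)%E.

End complex_L2.

Section calculus.
Context {R : realType} (n : nat).
Implicit Types (f u v phi : 'rV[R]_n -> R[i]) (s : seq 'I_n).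

Definition basis_vec (i : 'I_n) : 'rV[R]_n := delta_mx ord0 i.

Definition pderive (i : 'I_n) f (x : 'rV[R]_n) : R[i] :=
  'D_(basis_vec i) (fun y => complex.Re (f y)) x
    +i* 'D_(basis_vec i) (fun y => complex.Im (f y)) x.

Definition pderives s f := foldr pderive f s.

(* C^oo on A, where A is meant to be open *)
Definition smooth_on (A : set 'rV[R]_n) f := forall s x, A x ->
  [/\ continuous_at x (fun y => complex.Re (pderives s f y)),
      continuous_at x (fun y => complex.Im (pderives s f y)) &
      forall i, derivable (fun y => complex.Re (pderives s f y)) x (basis_vec i) /\
                derivable (fun y => complex.Im (pderives s f y)) x (basis_vec i)].

Definition laplacian f (x : 'rV[R]_n) : R[i] :=
  \sum_(i < n) pderives [:: i; i] f x.

Definition test_function phi :=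
  smooth_on setT phi /\ compact (closure [set x | phi x != 0]).

Definition weak_pderives s u v := forall phi, test_function phi ->
  cintegral lebesgue_rV (fun x => u x * pderives s phi x) =
  (-1) ^+ size s * cintegral lebesgue_rV (fun x => v x * phi x).

Definition sobolev (k : nat) u := L2 lebesgue_rV u /\
  forall s, (size s <= k)%N -> exists2 v, L2 lebesgue_rV v & weak_pderives s u v.

End calculus.

Section operators.
Context {R : realType} (n : nat).
Local Notation F := ('rV[R]_n -> R[i]).
Implicit Types (u v f g : F) (A : F -> F) (D : set F) (G : F -> F -> Prop).

(* The closure in L^2 x L^2 of the graph of A with domain D; u and g stand for
   their classes modulo almost-everywhere equality. *)
Definition graph_closure D A u g :=
  [/\ L2 lebesgue_rV u, L2 lebesgue_rV g &
      exists u_ : nat -> F, [/\ forall k, D (u_ k),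
        L2norm lebesgue_rV (fun x => u_ k x - u x) @[k --> \oo] --> 0%E &
        L2norm lebesgue_rV (fun x => A (u_ k) x - g x) @[k --> \oo] --> 0%E]].

Definition resolvent_eq G (lambda : R[i]) f u :=
  exists2 g, G u g & (fun x => lambda * u x - g x) = f %[ae lebesgue_rV].

Definition resolvent_set G : set R[i] := [set lambda |
  [/\ forall f, L2 lebesgue_rV f -> exists u, resolvent_eq G lambda f u,
      forall u, resolvent_eq G lambda (fun=> 0) u ->
        u = (fun=> 0) %[ae lebesgue_rV] &
      exists M : R, forall f u, L2 lebesgue_rV f -> resolvent_eq G lambda f u ->
        (L2norm lebesgue_rV u <= M%:E * L2norm lebesgue_rV f)%E]].

(* For lambda in the resolvent set, a representative of (lambda - G)^-1 f. *)
Definition resolvent G (lambda : R[i]) f : F :=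
  xget (fun=> 0) [set u | resolvent_eq G lambda f u].

End operators.

Section operator_L.
Context {R : realType} (n : nat).
Implicit Types (V : R -> R[i]) (u : 'rV[R]_n -> R[i]).

Definition japanese (r : R) : R := Num.sqrt (1 + r ^+ 2).

(* The derivative at r of a function on [0, +oo[, one-sided at r = 0 *)
Definition is_halfline_derive V (r : R) (l : R[i]) :=
  ((complex.Re (V s) - complex.Re (V r)) / (s - r) @[s --> within [set s | 0 <= s] r^'] --> complex.Re l)
  /\
  ((complex.Im (V s) - complex.Im (V r)) / (s - r) @[s --> within [set s | 0 <= s] r^'] --> complex.Im l).

Definition admissible_potential V := exists2 C : R, 0 < C &
  (forall r, 0 <= r -> normc (V r) <= C * japanese r ^- 2) /\
  exists V' : R -> R[i], forall r, 0 <= r ->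
    is_halfline_derive V r (V' r) /\ normc (V' r) <= C * japanese r ^- 3.

Definition diff_op V u (x : 'rV[R]_n) : R[i] :=
  laplacian u x - 2 * (\sum_(i < n) (x ord0 i)%:C * pderive i u x)
  + V (enorm x) * u x.

Definition diff_dom V : set ('rV[R]_n -> R[i]) := [set u |
  [/\ sobolev 2 u, smooth_on setT u & L2 lebesgue_rV (diff_op V u)]].

Definition op_L V := graph_closure (diff_dom V) (diff_op V).

End operator_L.

Section harmonics.
Context {R : realType} (n : nat).
Implicit Types (Y f : 'rV[R]_n -> R[i]) (g : R -> R[i]).

(* Functions on the sphere are given by (measurable) functions on R^n, of which
   only the values on the sphere matter.  The Laplace-Beltrami operator is the
   restriction to the sphere of the Laplacian of the extension that is
   homogeneous of degree 0. *)
Definition sphere_extension Y (x : 'rV[R]_n) : R[i] := Y (direction x).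

Definition is_spherical_harmonic (l : nat) Y :=
  smooth_on [set x | x != 0] (sphere_extension Y) /\
  forall x, unit_sphere x ->
    - laplacian (sphere_extension Y) x = (l * (l + n - 2))%N%:R * Y x.

Definition orthonormal_basis (I : eqType) (Omega : set I)
    (Y : I -> 'rV[R]_n -> R[i]) :=
  [/\ forall i, Omega i -> L2 surface_measure (Y i),
      forall i j, Omega i -> Omega j ->
        cintegral surface_measure (fun x => Y i x * (Y j x)^*) = (i == j)%:R &
      forall f, L2 surface_measure f -> forall e : R, 0 < e ->
        exists (s : seq I) (c : I -> R[i]),
          (forall i, i \in s -> Omega i) /\
          (L2norm surface_measure (fun x => f x - \sum_(i <- s) c i * Y i x)%R
            <= e%:E)%E].

Definition harmonic_basis (Omega : set (nat * int))
    (Y : nat * int -> 'rV[R]_n -> R[i]) :=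
  [/\ orthonormal_basis Omega Y,
      forall l m, Omega (l, m) -> is_spherical_harmonic l (Y (l, m)) &
      forall l, exists m, Omega (l, m)].

(* Functions on [0, +oo[ are given by functions on R of which only the values
   on [0, +oo[ matter. *)
Definition radial_norm g : \bar R :=
  ((\int[lebesgue_measure]_(r in `[0%R, +oo[)
      (normc (g r) ^+ 2 * r ^+ n.-1)%:E) `^ 2^-1)%E.

Definition L2rad g :=
  cmeasurable_fun (`[0, +oo[ : set R) g /\ (radial_norm g < +oo)%E.

Definition radial_opnorm (T : (R -> R[i]) -> (R -> R[i])) : \bar R :=
  ereal_sup [set radial_norm (T g) | g in [set g | L2rad g /\
                                                   (radial_norm g <= 1)%E]].

Definition proj_P Y f (r : R) : R[i] :=
  cintegral surface_measure (fun theta => f (r *: theta) * (Y theta)^*).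

Definition lift_Q Y g (x : 'rV[R]_n) : R[i] := g (enorm x) * Y (direction x).

Definition reduced_resolvent V Y (lambda : R[i]) g : R -> R[i] :=
  proj_P Y (resolvent (op_L V) lambda (lift_Q Y g)).

End harmonics.

(* Main.v *)
(* The whole resolvent is bounded by 2/b; P and Q are contractions by polar
   coordinates and Cauchy-Schwarz, so the bound passes to the reduced resolvents
   uniformly in (l, m).

   Write L_0 for the operator without potential and lambda = d + b + i omega.
   Testing f = (lambda - L_0) u against u with cutoffs, the real part gives
   b |u| <= |f| and control of grad u, while the imaginary part, with a cutoff
   on a fixed ball, gives omega |u|^2 <= O(|f|^2) on that ball.  As V is small
   off a large ball, 2 |V u| <= |f| once omega is large, hence
   |u| <= (2/b) |(lambda - L_0 - V) u|, and V can be absorbed by a contraction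
   in the surjectivity of lambda - L once lambda - L_0 has dense range.

   The density is explicit: the flow of L_0 maps Gaussians to Gaussians (Mehler's
   formula), so Riemann sums of its Laplace transform show that each Gaussian
   is a limit of (lambda - L_0) v with v a combination of Gaussians, and
   Gaussians span a dense subspace of L^2 because products of windows built
   from powers of 1 - e^(-m (t - y)^2) tend to indicators of boxes. *)

Require Import Defs.
From mathcomp Require Import all_boot all_order all_algebra.
From mathcomp Require Import all_classical all_reals all_analysis.
From mathcomp Require Import measurable_realfun complex.
From mathcomp Require Import ring lra.

Set Implicit Arguments.
Unset Strict Implicit.
Unset Printing Implicit Defensive.
Import Order.TTheory GRing.Theory Num.Def Num.Theory.
Import numFieldNormedType.Exports.

Local Open Scope classical_set_scope.
Local Open Scope complex_scope.
Local Open Scope ring_scope.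

(** Integration by parts in the drift gives Re (L_0 u, u) = d |u|^2 - |grad u|^2; this is where the
    abscissa d comes from, and Re lambda = d + b leaves a margin b. The margin may be smaller than
    sup |V|, so V cannot be absorbed by its size alone: a large omega has to make u small where V is
    large. Every integration by parts is made against the cutoff max(0, 1 - c |x|^2)^2. The real
    part survives c -> 0; the imaginary part does not, since its drift term has size |x| |u| |grad
    u|, and it is used with one fixed c. The a priori bound yields only injectivity and closed
    range. Surjectivity needs approximate solutions in the smooth domain, and polynomials times
    Gaussians are stable under L_0. The oscillation e^(-i omega t) of the Laplace transform is left
    out of the flow: it returns as a factor 1 - i h omega at each time step h, whose modulus is 1 +
    O(h^2), so that small steps lose little. *)

Section normc_lemmas.
Context {R : realType}.
Implicit Types z w : R[i].

Lemma normc_sqr z : normc z ^+ 2 = complex.Re z ^+ 2 + complex.Im z ^+ 2.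
Proof. by case: z => a b /=; rewrite sqr_sqrtr// addr_ge0// sqr_ge0. Qed.

Lemma normc_nneg z : 0 <= normc z.
Proof. by case: z => a b /=; rewrite sqrtr_ge0. Qed.

Lemma normc_triangle z w : normc (z + w) <= normc z + normc w.
Proof. exact: (@complex.le_normcD R z w). Qed.

Lemma normc_Re_le z : `|complex.Re z| <= normc z.
Proof.
rewrite -(@ler_pXn2r _ 2) ?nnegrE ?normc_nneg// normc_sqr.
by rewrite real_normK ?num_real// lerDl sqr_ge0.
Qed.

Lemma normc_Im_le z : `|complex.Im z| <= normc z.
Proof.
rewrite -(@ler_pXn2r _ 2) ?nnegrE ?normc_nneg// normc_sqr.
by rewrite real_normK ?num_real// lerDr sqr_ge0.
Qed.

Lemma normc_real (a : R) : normc a%:C = `|a|.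
Proof. by rewrite /= expr0n/= addr0 sqrtr_sqr. Qed.

Lemma ReD z w : complex.Re (z + w) = complex.Re z + complex.Re w.
Proof. by case: z; case: w. Qed.
Lemma ImD z w : complex.Im (z + w) = complex.Im z + complex.Im w.
Proof. by case: z; case: w. Qed.
Lemma ReN z : complex.Re (- z) = - complex.Re z.
Proof. by case: z. Qed.
Lemma ImN z : complex.Im (- z) = - complex.Im z.
Proof. by case: z. Qed.
Lemma ReM z w : complex.Re (z * w) =
  complex.Re z * complex.Re w - complex.Im z * complex.Im w.
Proof. by case: z; case: w. Qed.
Lemma ImM z w : complex.Im (z * w) =
  complex.Re z * complex.Im w + complex.Im z * complex.Re w.
Proof. by case: z; case: w. Qed.

Definition ReImE := (ReD, ImD, ReN, ImN, ReM, ImM).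

Lemma complex_eq z w : complex.Re z = complex.Re w ->
  complex.Im z = complex.Im w -> z = w.
Proof. by case: z; case: w => /= ? ? ? ? -> ->. Qed.

Lemma poweR_half_le (x : \bar R) (e : R) : (0 <= x)%E -> 0 <= e ->
  (x `^ 2^-1 <= e%:E)%E = (x <= (e ^+ 2)%:E)%E.
Proof.
move=> x0 e0; case: x x0 => [x|_|//]; last by rewrite poweRyr ?leye_eq ?invr_neq0.
rewrite lee_fin => x0; rewrite poweR_EFin !lee_fin powR12_sqrt//.
by rewrite -(ler_pXn2r (ltn0Sn 1)) ?nnegrE ?sqrtr_ge0// sqr_sqrtr.
Qed.

End normc_lemmas.

(** * Measurability of complex-valued functions *)

Section cmeasurable.
Context d (T : measurableType d) {R : realType}.
Implicit Types (f g h : T -> R[i]).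

Lemma cmeasurable_cst (D : set T) (c : R[i]) : cmeasurable_fun D (fun=> c).
Proof. by split; apply: measurable_cst. Qed.

Lemma cmeasurableD (D : set T) f g : cmeasurable_fun D f -> cmeasurable_fun D g ->
  cmeasurable_fun D (fun x => f x + g x).
Proof.
move=> [rf jf] [rg jg]; split.
- under eq_fun do rewrite ReD; exact: measurable_funD.
- under eq_fun do rewrite ImD; exact: measurable_funD.
Qed.

Lemma cmeasurableM (D : set T) f g : cmeasurable_fun D f -> cmeasurable_fun D g ->
  cmeasurable_fun D (fun x => f x * g x).
Proof.
move=> [rf jf] [rg jg]; split.
- under eq_fun do rewrite ReM.
  by apply: measurable_funB; apply: measurable_funM.
- under eq_fun do rewrite ImM.
  by apply: measurable_funD; apply: measurable_funM.
Qed.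

Lemma cmeasurableN (D : set T) f : cmeasurable_fun D f ->
  cmeasurable_fun D (fun x => - f x).
Proof.
move=> mf; under eq_fun do rewrite -mulN1r.
by apply: cmeasurableM => //; exact: cmeasurable_cst.
Qed.

Lemma cmeasurableB (D : set T) f g : cmeasurable_fun D f -> cmeasurable_fun D g ->
  cmeasurable_fun D (fun x => f x - g x).
Proof. by move=> mf mg; apply: cmeasurableD => //; exact: cmeasurableN. Qed.

Lemma measurable_normc_sqr (D : set T) f : cmeasurable_fun D f ->
  measurable_fun D (fun x => normc (f x) ^+ 2).
Proof.
move=> [rf jf]; under eq_fun do rewrite normc_sqr.
by apply: measurable_funD; apply: measurable_funX.
Qed.

Lemma measurable_normc (D : set T) f : cmeasurable_fun D f ->
  measurable_fun D (fun x => normc (f x)).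
Proof.
move=> /measurable_normc_sqr mf.
under eq_fun do rewrite -[normc _]ger0_norm ?normc_nneg// -sqrtr_sqr -powR12_sqrt ?sqr_ge0//.
by apply: (measurableT_comp (f := fun y : R => y `^ 2^-1)) => //; exact: measurable_powR.
Qed.

End cmeasurable.

(** * The space L^2 of complex-valued functions *)

Section L2_space.
Context d (T : measurableType d) {R : realType}.
Variable mu : {measure set T -> \bar R}.
Implicit Types (f g h : T -> R[i]).
Local Open Scope ereal_scope.

Definition energy f : \bar R := \int[mu]_x (normc (f x) ^+ 2)%:E.

Lemma energy_ge0 f : 0 <= energy f.
Proof. by apply: integral_ge0 => x _; rewrite lee_fin sqr_ge0. Qed.

Lemma L2normE f : L2norm mu f = energy f `^ 2^-1.
Proof.
rewrite /L2norm unlock; congr (_ `^ _); apply: eq_integral => x _ /=.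
rewrite ger0_norm ?normc_nneg// -powR_mulrn ?normc_nneg//.
Qed.

Lemma L2norm_ge0 f : 0 <= L2norm mu f.
Proof. by rewrite /L2norm Lnorm_ge0. Qed.

Lemma L2norm_leP f (e : R) : (0 <= e)%R ->
  (L2norm mu f <= e%:E) = (energy f <= (e ^+ 2)%:E).
Proof. by move=> e0; rewrite L2normE poweR_half_le ?energy_ge0. Qed.

Lemma L2norm_lty f : (L2norm mu f < +oo) = (energy f < +oo).
Proof.
rewrite L2normE; have := energy_ge0 f; case: (energy f) => [r r0|_|//].
  by rewrite poweR_EFin !ltry.
by rewrite poweRyr ?invr_neq0.
Qed.

Lemma L2_energyP f : L2 mu f <-> cmeasurable_fun setT f /\ energy f < +oo.
Proof. by rewrite /L2 L2norm_lty. Qed.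

Lemma L2_ge0_fin f : L2 mu f -> L2norm mu f \is a fin_num.
Proof. by move=> [_ ?]; rewrite ge0_fin_numE// L2norm_ge0. Qed.

Lemma energy_le f g : cmeasurable_fun setT f -> cmeasurable_fun setT g ->
  (forall x, normc (f x) <= normc (g x))%R -> energy f <= energy g.
Proof.
move=> mf mg fg; apply: ge0_le_integral => //.
- by move=> x _; rewrite lee_fin sqr_ge0.
- exact/measurable_EFinP/measurable_normc_sqr.
- exact/measurable_EFinP/measurable_normc_sqr.
- by move=> x _; rewrite lee_fin ler_pXn2r ?nnegrE ?normc_nneg.
Qed.

Lemma L2norm_le f g : cmeasurable_fun setT f -> cmeasurable_fun setT g ->
  (forall x, normc (f x) <= normc (g x))%R -> L2norm mu f <= L2norm mu g.
Proof.
move=> mf mg fg; rewrite !L2normE; apply: gt0_ler_poweR.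
- by rewrite invr_ge0.
- by rewrite in_itv/= energy_ge0 leey.
- by rewrite in_itv/= energy_ge0 leey.
- exact: energy_le.
Qed.

(** Reduction to the real Minkowski inequality for the moduli, through |f + g| <= |f| + |g|. *)
Lemma L2norm_normD f g : cmeasurable_fun setT f -> cmeasurable_fun setT g ->
  L2norm mu (fun x => f x + g x)%R <= L2norm mu f + L2norm mu g.
Proof.
move=> mf mg; have mN := @measurable_normc _ T R setT.
have mnn h : cmeasurable_fun setT h ->
    cmeasurable_fun setT (fun x => (normc (h x))%:C).
  by move=> mh; split => /=; [exact: mN|exact: measurable_cst].
have -> : L2norm mu f = L2norm mu (fun x => (normc (f x))%:C).
  by apply: eq_Lnorm => x; rewrite normc_real ger0_norm ?normc_nneg.
have -> : L2norm mu g = L2norm mu (fun x => (normc (g x))%:C).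
  by apply: eq_Lnorm => x; rewrite normc_real ger0_norm ?normc_nneg.
apply: (@le_trans _ _ (L2norm mu (fun x => (normc (f x))%:C + (normc (g x))%:C)%R)).
  apply: L2norm_le.
  - exact: cmeasurableD.
  - by apply: cmeasurableD; exact: mnn.
  - move=> x; rewrite -rmorphD normc_real ger0_norm ?normc_triangle//.
    by rewrite addr_ge0 ?normc_nneg.
have := @minkowski_EFin _ T R mu (fun x => normc (f x)) (fun x => normc (g x)) 2%R
  (mN _ mf) (mN _ mg).
rewrite ler1n => /(_ isT); rewrite /L2norm.
under [X in X <= _ -> _]eq_Lnorm => x do
  rewrite /= -[X in X%:E]ger0_norm ?addr_ge0 ?normc_nneg// -normc_real rmorphD.
move=> /le_trans; apply; rewrite le_eqVlt; apply/orP; left; apply/eqP.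
congr (_ + _); apply: eq_Lnorm => x.
  by rewrite normc_real ger0_norm ?normc_nneg.
by rewrite normc_real ger0_norm ?normc_nneg.
Qed.

Lemma L2normZ (c : R[i]) f : cmeasurable_fun setT f ->
  L2norm mu (fun x => c * f x)%R = (normc c)%:E * L2norm mu f.
Proof.
move=> mf; rewrite !L2normE /energy.
under eq_integral do rewrite ComplexField.Normc.normcM exprMn EFinM.
rewrite ge0_integralZl//=; last 3 first.
- exact/measurable_EFinP/measurable_normc_sqr.
- by move=> x _; rewrite lee_fin sqr_ge0.
- by rewrite lee_fin sqr_ge0.
rewrite poweRM ?lee_fin ?sqr_ge0 ?energy_ge0//; congr (_ * _).
by rewrite poweR_EFin powR12_sqrt ?sqr_ge0// sqrtr_sqr ger0_norm// normc_nneg.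
Qed.

Lemma L2normN f : L2norm mu (fun x => - f x)%R = L2norm mu f.
Proof. by apply: eq_Lnorm => x; rewrite complex.normcN. Qed.

Lemma L2norm_distC f g :
  L2norm mu (fun x => f x - g x)%R = L2norm mu (fun x => g x - f x)%R.
Proof. by rewrite -L2normN; apply: eq_Lnorm => x; rewrite opprB. Qed.

Lemma L2norm_normB f g : cmeasurable_fun setT f -> cmeasurable_fun setT g ->
  L2norm mu (fun x => f x - g x)%R <= L2norm mu f + L2norm mu g.
Proof.
by move=> mf mg; rewrite -(L2normN g); apply: L2norm_normD => //; exact: cmeasurableN.
Qed.

Lemma L2norm_triangle f g h : cmeasurable_fun setT f -> cmeasurable_fun setT g ->
  cmeasurable_fun setT h ->
  L2norm mu (fun x => f x - h x)%R <=
  L2norm mu (fun x => f x - g x)%R + L2norm mu (fun x => g x - h x)%R.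
Proof.
move=> mf mg mh.
rewrite [leLHS](_ : _ = L2norm mu (fun x => (f x - g x) + (g x - h x))%R).
  by apply: L2norm_normD; exact: cmeasurableB.
by apply: eq_Lnorm => x; congr (normc _)%:E; ring.
Qed.

Lemma L2D f g : L2 mu f -> L2 mu g -> L2 mu (fun x => f x + g x)%R.
Proof.
move=> [mf lf] [mg lg]; split; first exact: cmeasurableD.
by rewrite (le_lt_trans (L2norm_normD mf mg))// lte_add_pinfty.
Qed.

Lemma L2Z (c : R[i]) f : L2 mu f -> L2 mu (fun x => c * f x)%R.
Proof.
move=> [mf lf]; split; first by apply: cmeasurableM => //; exact: cmeasurable_cst.
by rewrite L2normZ// lte_mul_pinfty// lee_fin normc_nneg.
Qed.

Lemma L2N f : L2 mu f -> L2 mu (fun x => - f x)%R.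
Proof. by move=> [mf lf]; split; [exact: cmeasurableN|rewrite L2normN]. Qed.

Lemma L2B f g : L2 mu f -> L2 mu g -> L2 mu (fun x => f x - g x)%R.
Proof. by move=> Lf Lg; apply: L2D => //; exact: L2N. Qed.

Lemma L2norm0 : L2norm mu (fun=> 0%R) = 0.
Proof.
rewrite /L2norm (@eq_Lnorm _ _ _ _ _ _ (cst 0)) ?Lnorm0 ?eqe//.
by move=> x /=; rewrite expr0n/= addr0 sqrtr0.
Qed.

Lemma L20 : L2 mu (fun=> 0%R).
Proof. by split; [exact: cmeasurable_cst|rewrite L2norm0 ltry]. Qed.

Lemma L2_le f g : cmeasurable_fun setT f -> L2 mu g ->
  (forall x, normc (f x) <= normc (g x))%R -> L2 mu f.
Proof.
by move=> mf [mg lg] fg; split => //; apply: le_lt_trans lg; exact: L2norm_le.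
Qed.

Lemma energy_ae_eq f g : cmeasurable_fun setT f -> cmeasurable_fun setT g ->
  f = g %[ae mu] -> energy f = energy g.
Proof.
move=> mf mg fg; apply: ge0_ae_eq_integral => //.
- exact/measurable_EFinP/measurable_normc_sqr.
- exact/measurable_EFinP/measurable_normc_sqr.
- by move=> x _; rewrite lee_fin sqr_ge0.
- by move=> x _; rewrite lee_fin sqr_ge0.
- by apply: filterS fg => x /= fgx _; rewrite fgx.
Qed.

Lemma L2norm_ae_eq f g : cmeasurable_fun setT f -> cmeasurable_fun setT g ->
  f = g %[ae mu] -> L2norm mu f = L2norm mu g.
Proof. by move=> mf mg fg; rewrite !L2normE (energy_ae_eq mf mg fg). Qed.

Lemma L2norm_eq0 f : cmeasurable_fun setT f -> L2norm mu f = 0 ->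
  f = (fun=> 0%R) %[ae mu].
Proof.
move=> mf f0; have : (fun x => (normc (f x))%:E) = cst 0 %[ae mu].
  apply: Lnorm_eq0_eq0 f0; last by rewrite lte_fin.
  exact/measurable_EFinP/measurable_normc.
apply: filterS => x /= + _ => /(_ Logic.I) [].
exact: ComplexField.Normc.eq0_normc.
Qed.

Lemma cvge0P (u : nat -> \bar R) : (forall k, 0 <= u k) ->
  u k @[k --> \oo] --> 0 <->
  forall e : R, (0 < e)%R -> exists N, forall k, (N <= k)%N -> u k <= e%:E.
Proof.
move=> u0; split.
  move=> /fine_cvgP[ufin] /cvgrPdist_le uc e e0.
  have [N _ hN] := filterI ufin (uc e e0).
  exists N => k /hN [uk] /=; rewrite sub0r normrN ger0_norm ?fine_ge0// => ke.
  by rewrite -(fineK uk) lee_fin.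
move=> h; apply/fine_cvgP; split.
  have [N hN] := h 1%R ltr01; exists N => // k /hN uk.
  by rewrite ge0_fin_numE// (le_lt_trans uk)// ltry.
apply/cvgrPdist_le => e e0; have [N hN] := h e e0.
exists N => // k /= /hN uk; rewrite sub0r normrN ger0_norm ?fine_ge0//.
by rewrite -lee_fin fineK// ge0_fin_numE// (le_lt_trans uk)// ltry.
Unshelve. all: by end_near. Qed.

Lemma L2norm_dominated (f_ : nat -> T -> R[i]) f g :
  (forall k, cmeasurable_fun setT (f_ k)) -> cmeasurable_fun setT f -> L2 mu g ->
  (forall x, normc (f_ k x - f x)%R @[k --> \oo] --> 0%R) ->
  (forall k x, (normc (f_ k x - f x) <= normc (g x))%R) ->
  L2norm mu (fun x => f_ k x - f x)%R @[k --> \oo] --> 0.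
Proof.
move=> mf_ mf Lg cv fg; have [mg gfin] := (L2_energyP g).1 Lg.
have ecv : energy (fun x => f_ k x - f x)%R @[k --> \oo] --> 0.
  rewrite -(integral0 mu setT); apply: (@dominated_cvg _ _ _ _ _ _
    (fun k x => (normc (f_ k x - f x) ^+ 2)%:E) _ (fun x => (normc (g x) ^+ 2)%:E)) => //.
  - by move=> k; apply/measurable_EFinP/measurable_normc_sqr/cmeasurableB.
  - move=> x _; apply: cvg_EFin; first exact: nearW.
    rewrite -(mul0r (0:R)%R) /comp /=; under eq_fun do rewrite expr2.
    by apply: cvgM; exact: cv.
  - apply/integrableP; split; first exact/measurable_EFinP/measurable_normc_sqr.
    by under eq_integral do rewrite gee0_abs ?lee_fin ?sqr_ge0//.
  - move=> k x _; rewrite gee0_abs ?lee_fin ?sqr_ge0//.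
    by rewrite ler_pXn2r ?nnegrE ?normc_nneg.
apply/cvge0P => [k|e e0]; first exact: L2norm_ge0.
have [N hN] := (cvge0P (fun k => energy_ge0 _)).1 ecv (e ^+ 2)%R (exprn_gt0 2 e0).
by exists N => k /hN; rewrite L2norm_leP// ltW.
Qed.

(** * Completeness, for geometrically fast Cauchy sequences *)

Section completeness.
Variables (f_ : nat -> T -> R[i]) (M : R).
Hypothesis M0 : (0 <= M)%R.
Hypothesis Lf : forall k, L2 mu (f_ k).
Hypothesis fM : forall k,
  L2norm mu (fun x => f_ k.+1 x - f_ k x)%R <= (M * 4^-1 ^+ k)%:E.

Let mf k : cmeasurable_fun setT (f_ k). Proof. by have [] := Lf k. Qed.

Let tail k j : L2norm mu (fun x => f_ (j + k)%N x - f_ k x)%R <=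
  (2 * M * 4^-1 ^+ k)%:E.
Proof.
elim: j k => [|j ih] k.
  rewrite add0n (_ : (fun x => _) = fun=> 0%R); last by apply/funext => x; rewrite subrr.
  by rewrite L2norm0 lee_fin !mulr_ge0// exprn_ge0// invr_ge0.
apply: (le_trans (L2norm_triangle (mf _) (mf k.+1) (mf _))).
rewrite addSnnS; apply: (le_trans (leeD (ih _) (fM k))).
rewrite -EFinD lee_fin exprS.
have : (0 <= M * 4^-1 ^+ k)%R by rewrite mulr_ge0// exprn_ge0// invr_ge0.
lra.
Qed.

(** The squared increments have integral at most M^2 16^-k, so the weight 4^k still leaves a
    summable series. Where the sum [h] is finite, the k-th increment is at most sqrt(h) 2^-k, hence
    the sequence converges pointwise. *)
Let w k x : \bar R := (4 ^+ k * normc (f_ k.+1 x - f_ k x) ^+ 2)%:E.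

Let w0 k x : 0 <= w k x.
Proof. by rewrite /w lee_fin mulr_ge0 ?sqr_ge0// exprn_ge0. Qed.

Let mw k : measurable_fun setT (w k).
Proof.
apply/measurable_EFinP; apply: measurable_funM; first exact: measurable_cst.
exact/measurable_normc_sqr/cmeasurableB.
Qed.

Let h x := \sum_(0 <= k <oo) w k x.

Let mh : measurable_fun setT h.
Proof. by apply: ge0_emeasurable_sum => // k x _ _; exact: w0. Qed.

Let int_h : \int[mu]_x h x < +oo.
Proof.
rewrite integral_nneseries//.
(* The majorant is M^2 2^-k written in the shape of [epsilon_trick0]; the integrals are in fact at
   most M^2 4^-k. *)
apply: (@le_lt_trans _ _ (\sum_(0 <= k <oo) ((2 * M ^+ 2) / (2 ^ k.+1)%:R)%:E)); last first.
  apply: (le_lt_trans (epsilon_trick0 xpredT _)); rewrite ?ltry//.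
  by rewrite mulr_ge0// sqr_ge0.
apply: lee_nneseries => [k _ _|k _]; first by apply: integral_ge0 => x _; exact: w0.
rewrite /w; under eq_integral do rewrite EFinM.
rewrite ge0_integralZl//; last 2 first.
- exact/measurable_EFinP/measurable_normc_sqr/cmeasurableB.
- by move=> x _; rewrite lee_fin sqr_ge0.
have := fM k; rewrite L2norm_leP; last by rewrite mulr_ge0// exprn_ge0// invr_ge0.
move=> ek; apply: (le_trans (lee_wpmul2l _ ek)); first by rewrite lee_fin exprn_ge0.
rewrite -EFinM lee_fin natrX.
have q1 : (4 ^+ k * 4^-1 ^+ k = 1 :> R)%R by rewrite -exprMn divff ?expr1n// pnatr_eq0.
rewrite (_ : 4 ^+ k * _ = M ^+ 2 * 4^-1 ^+ k)%R; last first.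
  transitivity (M ^+ 2 * 4^-1 ^+ k * (4 ^+ k * 4^-1 ^+ k))%R; first by ring.
  by rewrite q1 mulr1.
rewrite (_ : 2 * M ^+ 2 / _ = M ^+ 2 * 2^-1 ^+ k)%R; last first.
  by rewrite exprVn (exprS 2%R) invfM (mulrC 2%R) -mulrA mulVKf ?pnatr_eq0.
by rewrite ler_wpM2l ?sqr_ge0// lerXn2r ?nnegrE//; lra.
Qed.

Let A := [set x | h x < +oo].

Let mA : measurable A.
Proof. by rewrite -[A]setTI; exact: emeasurable_fun_infty_o. Qed.

Let negA : mu (~` A) = 0.
Proof.
have : mu.-integrable setT h.
  apply/integrableP; split => //.
  under eq_integral do rewrite gee0_abs ?nneseries_ge0//.
  exact: int_h.
move=> /(integrable_ae measurableT) [N [mN N0 subN]].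
apply/eqP; rewrite eq_le measure_ge0 andbT -N0; apply: le_measure.
- by rewrite inE; exact: measurableC.
- by rewrite inE.
- move=> x Ax; apply: subN => /= /(_ Logic.I) hx; apply: Ax.
  by rewrite /A /= ltey; case: (h x) hx.
Qed.

Let incr_bound x : A x -> exists C : R,
  forall k, (normc (f_ k.+1 x - f_ k x) <= C * 2^-1 ^+ k)%R.
Proof.
rewrite /A/= => Ax; have h0 : 0 <= h x by exact: nneseries_ge0.
have hfin : h x \is a fin_num by rewrite ge0_fin_numE.
exists (Num.sqrt (fine (h x))) => k.
rewrite -(@ler_pXn2r _ 2) ?nnegrE ?normc_nneg//.
rewrite exprMn sqr_sqrtr ?fine_ge0// -exprM mulnC exprM exprVn -natrX /=.
rewrite exprVn ler_pdivlMr ?exprn_gt0// mulrC -lee_fin fineK//.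
rewrite /h (@nneseriesD1 _ _ k)// /w mulrC leeDl//.
by apply: nneseries_ge0 => *; exact: w0.
Qed.

Let cvg_incr (u : nat -> R) (C : R) :
  (forall k, `|u k.+1 - u k| <= C * 2^-1 ^+ k)%R -> cvgn u.
Proof.
move=> uC; have C0 : (0 <= C)%R.
  by have := uC 0%N; rewrite expr0 mulr1; exact: le_trans.
have -> : u = (fun n => u 0%N + series (telescope u) n)%R.
  by apply/funext => n; rewrite -eq_sum_telescope.
apply: is_cvgD; first exact: is_cvg_cst.
apply: normed_cvg; apply: (@series_le_cvg _ _ (geometric C 2^-1)) => //.
- by move=> n /=.
- by move=> n /=; rewrite mulr_ge0// exprn_ge0// invr_ge0.
- by apply: is_cvg_geometric_series; rewrite ger0_norm//; lra.
Qed.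

(** The value 0 off [A], whose complement is null, makes the limit measurable everywhere. *)
Let limRe x := if x \in A then limn (fun k => complex.Re (f_ k x)) else 0%R.
Let limIm x := if x \in A then limn (fun k => complex.Im (f_ k x)) else 0%R.

Let cvg_limRe x : A x -> complex.Re (f_ k x) @[k --> \oo] --> limRe x.
Proof.
move=> Ax; rewrite /limRe mem_set//; have [C hC] := incr_bound Ax.
apply: (@cvg_incr _ C) => k; apply: le_trans (hC k).
by rewrite -ReN -ReD; exact: normc_Re_le.
Qed.

Let cvg_limIm x : A x -> complex.Im (f_ k x) @[k --> \oo] --> limIm x.
Proof.
move=> Ax; rewrite /limIm mem_set//; have [C hC] := incr_bound Ax.
apply: (@cvg_incr _ C) => k; apply: le_trans (hC k).
by rewrite -ImN -ImD; exact: normc_Im_le.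
Qed.

Let mlim (u_ : nat -> T -> R) (u : T -> R) :
  (forall k, measurable_fun setT (u_ k)) ->
  (forall x, A x -> u_ k x @[k --> \oo] --> u x) ->
  (forall x, ~ A x -> u x = 0%R) -> measurable_fun setT u.
Proof.
move=> mu_ ucv u0.
apply: (@measurable_fun_cvg _ _ _ _ (fun k x => u_ k x * \1_A x)%R).
  by move=> k; apply: measurable_funM.
move=> x _; rewrite indicE; case: (pselect (A x)) => Ax.
  by rewrite mem_set//; under eq_fun do rewrite mulr1; exact: ucv.
by rewrite memNset// u0//; under eq_fun do rewrite mulr0; exact: cvg_cst.
Qed.

Let f x : R[i] := limRe x +i* limIm x.

Let mlimf : cmeasurable_fun setT f.
Proof.
split; rewrite /f /=.
- apply: (@mlim (fun k x => complex.Re (f_ k x))) => //.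
    by move=> k; have [] := mf k.
  by move=> x Ax; rewrite /limRe memNset.
- apply: (@mlim (fun k x => complex.Im (f_ k x))) => //.
    by move=> k; have [] := mf k.
  by move=> x Ax; rewrite /limIm memNset.
Qed.

(** Fatou's lemma in j for f_(j+k) - f_k: the bound of [tail] is uniform in j and survives the
    limit. *)
Let energy_tail k : L2norm mu (fun x => f x - f_ k x)%R <= (2 * M * 4^-1 ^+ k)%:E.
Proof.
have M4 : (0 <= 2 * M * 4^-1 ^+ k)%R.
  by rewrite mulr_ge0 ?mulr_ge0// exprn_ge0// invr_ge0.
rewrite L2norm_leP//.
have cv x : A x -> (normc (f_ (j + k)%N x - f_ k x) ^+ 2)%:E @[j --> \oo] -->
    (normc (f x - f_ k x) ^+ 2)%:E.
  move=> Ax; apply: cvg_EFin; first exact: nearW.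
  rewrite normc_sqr !ReImE /comp /=; under eq_fun do rewrite normc_sqr !ReImE.
  have cR := cvg_limRe Ax; have cI := cvg_limIm Ax.
  by apply: cvgD; rewrite expr2; under eq_fun do rewrite expr2; apply: cvgM;
    apply: cvgB; try exact: cvg_cst;
    rewrite (cvg_shiftn k (fun j => complex.Re (f_ j x))) ||
    rewrite (cvg_shiftn k (fun j => complex.Im (f_ j x))).
have -> : energy (fun x => f x - f_ k x)%R =
    \int[mu]_x limn_einf (fun j => (normc (f_ (j + k)%N x - f_ k x) ^+ 2)%:E).
  apply: ge0_ae_eq_integral => //.
  - exact/measurable_EFinP/measurable_normc_sqr/cmeasurableB.
  - under eq_fun do rewrite limn_einf_lim.
    apply: (emeasurable_fun_cvg (fun n x =>
        einfs (fun j => (normc (f_ (j + k)%N x - f_ k x) ^+ 2)%:E) n)).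
      apply: measurable_fun_einfs => j.
      exact/measurable_EFinP/measurable_normc_sqr/cmeasurableB.
    by move=> x _; exact: is_cvg_einfs.
  - by move=> x _; rewrite lee_fin sqr_ge0.
  - move=> x _; rewrite limn_einf_lim; apply: lime_ge; first exact: is_cvg_einfs.
    apply: nearW => n; apply: le_ereal_inf_tmp => _ [m _ <-].
    by rewrite lee_fin sqr_ge0.
  - exists (~` A); split => //; first exact: measurableC.
    move=> x /= h1 Ax; apply: h1 => _.
    by rewrite (cvg_limn_einf_sup (cv x Ax)).
apply: le_trans (fatou _ measurableT _ _) _.
- by move=> j; exact/measurable_EFinP/measurable_normc_sqr/cmeasurableB.
- by move=> j x _; rewrite lee_fin sqr_ge0.
rewrite limn_einf_lim; apply: lime_le; first exact: is_cvg_einfs.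
apply: nearW => n; apply: le_trans (_ : energy (fun x => f_ (n + k)%N x - f_ k x)%R <= _).
  by apply: ereal_inf_lbound; exists n => //=.
by rewrite -L2norm_leP.
Qed.

Lemma L2_complete : exists2 g, L2 mu g &
  L2norm mu (fun x => f_ k x - g x)%R @[k --> \oo] --> 0.
Proof.
have Lff : L2 mu (fun x => f x - f_ 0%N x)%R.
  split; first exact: cmeasurableB.
  by rewrite (le_lt_trans (energy_tail 0))// ltry.
exists f.
  rewrite (_ : f = fun x => (f x - f_ 0%N x) + f_ 0%N x)%R; first exact: L2D.
  by apply/funext => x; rewrite subrK.
apply/cvge0P => [k|e e0]; first exact: L2norm_ge0.
have /cvgrPdist_le/(_ _ e0)[N _ hN] : (geometric (2 * M) (4^-1 : R))%R @ \oo --> (0 : R)%R.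
  by apply: cvg_geometric; rewrite ger0_norm//; lra.
exists N => k /hN /=; rewrite sub0r normrN ger0_norm; last first.
  by rewrite mulr_ge0 ?mulr_ge0// exprn_ge0// invr_ge0.
by move=> h1; rewrite L2norm_distC (le_trans (energy_tail k))// lee_fin.
Qed.

End completeness.
End L2_space.

(** * Topology and measurability of row vectors *)

Section rV_topology.
Context {R : realType}.

Lemma cvg_rV (T : Type) (F : set_system T) {FF : Filter F} n
    (f : T -> 'rV[R]_n) (a : 'rV[R]_n) :
  (forall i, f t ord0 i @[t --> F] --> a ord0 i) -> f t @[t --> F] --> a.
Proof.
move=> fa; apply/cvgrPdist_lt => e e0.
suff : \forall t \near F, forall i, `|a ord0 i - f t ord0 i| < e.
  apply: filterS => t h; rewrite [ltLHS]/normr/= mx_normrE.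
  by apply/bigmax_ltP; split => // -[i j] _ /=; rewrite !mxE ord1.
by apply: filter_forall => i; have /cvgrPdist_lt := fa i; exact.
Qed.

Lemma norm_coord_le n (x : 'rV[R]_n) i : `|x ord0 i| <= `|x|.
Proof.
rewrite [leRHS]/normr/= mx_normrE.
by apply/bigmax_geP; right => /=; exists (ord0, i).
Qed.

(** As g has countably many values, a preimage under the composite is a countable union of fibers of
    g; h may be arbitrary. *)
Lemma measurable_fun_countable_fibers d (T : measurableType d) (J : countType)
    d' (U : measurableType d') (g : T -> J) (h : J -> U) :
  (forall z, measurable [set x | g x = z]) -> measurable_fun setT (h \o g).
Proof.
move=> mg _ Y mY; rewrite setTI.
have -> : (h \o g) @^-1` Y = \bigcup_m
    (if unpickle m is Some z then (if `[< Y (h z) >] then [set x | g x = z] else set0)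
     else set0).
  apply/seteqP; split => x /=.
    move=> Yx; exists (pickle (g x)) => //; rewrite pickleK.
    by case: asboolP.
  by move=> [m _]; case: unpickle => // z; case: asboolP => // Yz /= ->.
apply: bigcupT_measurable => m; case: unpickle => [z|//].
by case: ifP => // _; exact: mg.
Qed.

Definition rV_floor n (k : nat) (x : 'rV[R]_n) : 'rV[int]_n :=
  \row_i Num.floor (k.+1%:R * x ord0 i).

Lemma measurable_rV_floor n k (z : 'rV[int]_n) :
  measurable [set x : 'rV[R]_n | rV_floor k x = z].
Proof.
have -> : [set x : 'rV[R]_n | rV_floor k x = z] = \bigcap_(i in [set: 'I_n])
    ((fun x : 'rV[R]_n => k.+1%:R * x ord0 i) @^-1`
      `[(z ord0 i)%:~R, (z ord0 i + 1)%:~R[).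
  apply/seteqP; split => x /=.
    by move=> <- i _ /=; rewrite mxE in_itv/= -floor_eq//.
  move=> h; apply/rowP => i; rewrite mxE; apply/eqP.
  by have := h i Logic.I; rewrite /= in_itv/= -floor_eq.
apply: fin_bigcap_measurable => // i _.
rewrite -[X in measurable X]setTI.
have : measurable_fun setT (fun x : 'rV[R]_n => k.+1%:R * x ord0 i).
  by apply: measurable_funM => //; exact: measurable_rV_coord.
by apply.
Qed.

(** The sigma-algebra is generated by coordinates, not by open sets, so f is sampled: it is the
    pointwise limit of its values at the points of the grid of mesh 1/(k+1) just below x, and each
    sampled function factors through the integer vector [rV_floor k]. *)
Lemma continuous_measurable_rV n (f : 'rV[R]_n -> R) :
  continuous f -> measurable_fun setT f.
Proof.
move=> cf.
pose p k (z : 'rV[int]_n) : 'rV[R]_n := \row_i ((z ord0 i)%:~R / k.+1%:R).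
apply: (@measurable_fun_cvg _ _ _ _ (fun k => f \o p k \o rV_floor k)).
  move=> k; apply: measurable_fun_countable_fibers => z.
  exact: measurable_rV_floor.
move=> x _; apply: (cvg_comp (fun k => p k (rV_floor k x)) f); last exact: cf.
apply: cvg_rV => i; apply/cvgrPdist_le => e e0.
have /cvgrPdist_le/(_ _ e0) := @cvg_harmonic R.
apply: filterS => k /=; rewrite sub0r normrN ger0_norm ?invr_ge0// => /(le_trans _); apply.
rewrite !mxE; have kp : (0 : R) < k.+1%:R by [].
rewrite -(@ler_pM2l _ k.+1%:R)// divff ?gt_eqF// -[X in X * `|_|]ger0_norm ?ltW//.
rewrite -normrM mulrBr mulrCA divff ?gt_eqF// mulr1.
have := floor_itv (k.+1%:R * x ord0 i); rewrite intrD => /andP[h1 h2].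
by rewrite ger0_norm ?subr_ge0// ltrBlDl.
Qed.

End rV_topology.

(** * Iterated integrals and Gaussian integrals *)

Section rV_integral.
Context {R : realType}.
Local Open Scope ereal_scope.

Lemma ge0_integral_rV_cons n (f : 'rV[R]_n.+1 -> \bar R) :
  measurable_fun setT f -> (forall x, 0 <= f x) ->
  \int[lebesgue_rV]_x f x =
  \int[lebesgue_measure]_t \int[lebesgue_rV]_y f (rV_cons (t, y)).
Proof.
move=> mf f0.
rewrite [LHS](ge0_integral_pushforward (@measurable_rV_cons R n) (lebesgue_measure \x lebesgue_rV))//.
rewrite preimage_setT (fubini_tonelli1 (f \o @rV_cons R n))//.
  exact: (measurableT_comp mf (@measurable_rV_cons R n)).
by move=> x; exact: f0.
Qed.

Lemma integral_rV_cons n (f : 'rV[R]_n.+1 -> \bar R) :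
  lebesgue_rV.-integrable setT f ->
  \int[lebesgue_rV]_x f x =
  \int[lebesgue_measure]_t \int[lebesgue_rV]_y f (rV_cons (t, y)).
Proof.
move=> intf; have mf := measurable_int _ intf.
have mfc : measurable_fun setT (f \o @rV_cons R n).
  exact: (measurableT_comp mf (@measurable_rV_cons R n)).
have intfc : (lebesgue_measure \x lebesgue_rV).-integrable setT (f \o @rV_cons R n).
  apply/integrableP; split => //.
  have /integrableP[_] := intf.
  rewrite (ge0_integral_pushforward (@measurable_rV_cons R n) (lebesgue_measure \x lebesgue_rV))//.
  exact: measurableT_comp.
rewrite [LHS](integral_pushforward (@measurable_rV_cons R n))//.
by rewrite preimage_setT -integral12_prod_meas1.
Qed.

Lemma integral_rV0 (f : 'rV[R]_0 -> \bar R) :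
  measurable_fun setT f ->
  \int[lebesgue_rV]_x f x = f 0%R.
Proof.
by move=> mf; rewrite integral_dirac// diracT mul1e.
Qed.

Lemma integral_rV_prod n (h : 'I_n -> R -> R) :
  (forall i, measurable_fun setT (h i)) -> (forall i t, 0 <= h i t)%R ->
  \int[lebesgue_rV]_x (\prod_i h i (x ord0 i))%:E =
  \big[*%E/1]_i \int[lebesgue_measure]_t (h i t)%:E.
Proof.
elim: n h => [|n ih] h mh h0.
  rewrite integral_rV0 ?big_ord0//.
  under eq_fun do rewrite big_ord0; exact: measurable_cst.
rewrite ge0_integral_rV_cons; last 2 first.
- apply/measurable_EFinP; apply: measurable_prod => i _.
  by apply: measurableT_comp => //; exact: measurable_rV_coord.
- by move=> x; rewrite lee_fin prodr_ge0.
have mih : measurable_fun [set: 'rV[R]_n]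
    (fun y => (\prod_i h (lift ord0 i) (y ord0 i))%:E).
  apply/measurable_EFinP; apply: measurable_prod => i _.
  by apply: measurableT_comp => //; exact: measurable_rV_coord.
have E t (y : 'rV[R]_n) : (\prod_i h i (rV_cons (t, y) ord0 i))%:E =
    (h ord0 t)%:E * (\prod_i h (lift ord0 i) (y ord0 i))%:E.
  rewrite big_ord_recl /= mxE unlift_none EFinM; congr (_ * _%:E).
  by apply: eq_bigr => i _; rewrite mxE liftK.
transitivity (\int[lebesgue_measure]_t ((h ord0 t)%:E *
    \big[*%E/1]_i \int[lebesgue_measure]_t (h (lift ord0 i) t)%:E)).
  apply: eq_integral => t _; under eq_integral do rewrite E.
  rewrite ge0_integralZl ?lee_fin//; last by move=> y _; rewrite lee_fin prodr_ge0.
  congr (_ * _); exact: (ih (fun i => h (lift ord0 i))).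
rewrite ge0_integralZr//; last 3 first.
- by apply/measurable_EFinP; exact: mh.
- by move=> t _; rewrite lee_fin.
- by apply: prode_ge0 => i _; apply: integral_ge0 => t _; rewrite lee_fin.
by rewrite big_ord_recl.
Qed.

(** The integrand is sqrt(pi / a) times the normal density of mean m and variance 1/(2a). *)
Lemma integral_gauss (a m : R) : (0 < a)%R ->
  \int[lebesgue_measure]_t (expR (- (a * (t - m) ^+ 2)))%:E = (Num.sqrt (pi / a))%:E.
Proof.
move=> a0; pose s : R := (Num.sqrt (2 * a)^-1)%R.
have ss : (s ^+ 2 = (2 * a)^-1)%R by rewrite sqr_sqrtr// invr_ge0 mulr_ge0// ltW.
have s0 : (s != 0)%R by rewrite gt_eqF// sqrtr_gt0 invr_gt0 mulr_gt0.
have pa : (0 < Num.sqrt (pi / a))%R by rewrite sqrtr_gt0 divr_gt0// pi_gt0.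
have E t : (expR (- (a * (t - m) ^+ 2)) = Num.sqrt (pi / a) * normal_pdf m s t)%R.
  rewrite normal_pdfE// /normal_peak /normal_fun ss /=.
  have -> : ((2 * a)^-1 * pi *+ 2 = pi / a)%R.
    by rewrite -mulr_natr; field; rewrite gt_eqF.
  rewrite mulVKf ?gt_eqF//; congr expR.
  by rewrite -mulr_natr; field; rewrite gt_eqF.
under eq_integral do rewrite E EFinM.
rewrite ge0_integralZl//.
- by rewrite integral_normal_pdf mule1.
- by apply/measurable_EFinP; exact: measurable_normal_pdf.
- by move=> t _; rewrite lee_fin normal_pdf_ge0.
Qed.

Lemma integral_gauss_prod n (a m : 'I_n -> R) : (forall i, 0 < a i)%R ->
  \int[lebesgue_rV]_x (expR (- \sum_i (a i * (x ord0 i - m i) ^+ 2)))%:E =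
  (\prod_i Num.sqrt (pi / a i))%:E.
Proof.
move=> a0.
under eq_integral => x _ do rewrite -sumrN expR_sum.
rewrite (@integral_rV_prod _ (fun i t => expR (- (a i * (t - m i) ^+ 2)))).
- rewrite -prodEFin; apply: eq_bigr => i _; exact: integral_gauss.
- move=> i; apply: measurableT_comp => //; apply: measurableT_comp => //.
  by apply: measurable_funM => //; apply: measurable_funX; exact: measurable_funB.
- by move=> i t; exact: expR_ge0.
Qed.

End rV_integral.

(** * Partial derivatives of compactly supported functions have integral 0 *)

Section lines.
Context {R : realType}.

Lemma is_derive_line n (g : 'rV[R]_n -> R) (v x : 'rV[R]_n) (t : R) (dg : R) :
  is_derive (x + t *: v) v g dg -> is_derive t 1 (fun s => g (x + s *: v)) dg.
Proof.
move=> [dv <-].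
have E : (fun h : R => h^-1 *: ((g \o shift (x + t *: v)) (h *: v) - g (x + t *: v))) =
    (fun h : R => h^-1 *: (((fun s => g (x + s *: v)) \o shift t) (h *: (1 : R)) - g (x + t *: v))).
  apply/funext => h /=; congr (_ *: (g _ - _)).
  by rewrite /shift /= [h%:A]mulr1 scalerDl addrCA.
split.
- by rewrite /derivable -E.
- by rewrite /derive -E.
Qed.

Lemma integral_derive_line (g dg : R -> R) (r : R) :
  (forall t : R, is_derive t 1 g (dg t)) -> continuous dg ->
  (forall t, r <= `|t| -> g t = 0) -> (forall t, r <= `|t| -> dg t = 0) ->
  (\int[lebesgue_measure]_t (dg t)%:E = 0)%E.
Proof.
move=> Dg cdg g0 dg0; pose r' : R := `|r| + 1.
have r'0 : 0 < r' by rewrite ltr_wpDl.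
have rr' : r <= r' by rewrite (le_trans (ler_norm _))// lerDl.
transitivity (\int[lebesgue_measure]_(t in `[(- r')%R, r'%R]) (dg t)%:E)%E.
  rewrite [RHS]integral_mkcond; apply: eq_integral => t _.
  rewrite patchE; case: ifPn => //; rewrite notin_setE /= in_itv /= => /negP h.
  rewrite dg0// (le_trans rr')// leNgt; apply: contra h.
  by rewrite ltr_norml => /andP[/ltW -> /ltW ->].
have cg : continuous g.
  by move=> t; apply/differentiable_continuous/derivable1_diffP; case: (Dg t).
rewrite (@continuous_FTC2 _ dg g).
- by rewrite !g0 ?normrN ?gtr0_norm// subee.
- by rewrite gtrN.
- by apply: continuous_subspaceT => t; exact: cdg.
- split.
  + by move=> t _; case: (Dg t).
  + by apply: cvg_at_right_filter; exact: cg.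
  + by apply: cvg_at_left_filter; exact: cg.
- by move=> t _; rewrite derive1E; case: (Dg t).
Qed.

(** Support in a cube rather than in a ball: the condition passes to slices obtained by fixing the
    first coordinate. *)
Definition rV_supported n (r : R) (g : 'rV[R]_n -> R) :=
  forall x : 'rV[R]_n, (exists i, r <= `|x ord0 i|) -> g x = 0.

Lemma rV_cons_line0 n t (y : 'rV[R]_n) (s : R) :
  rV_cons (t, y) + s *: basis_vec ord0 = rV_cons (t + s, y).
Proof.
apply/rowP => i; rewrite !mxE ?eqxx /=.
case: (unliftP ord0 i) => [j ->|->] /=.
  by rewrite mulr0 addr0.
by rewrite mulr1.
Qed.

Lemma rV_cons_line n t (y : 'rV[R]_n) (s : R) (j : 'I_n) :
  rV_cons (t, y) + s *: basis_vec (lift ord0 j) =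
  rV_cons (t, y + s *: basis_vec j).
Proof.
apply/rowP => i; rewrite !mxE ?eqxx /=.
case: (unliftP ord0 i) => [k ->|->] /=.
  by rewrite !mxE eqxx /= (inj_eq (@lift_inj _ _)).
by rewrite mulr0 addr0.
Qed.

Lemma continuous_rV_cons n (t : R) : continuous (fun y : 'rV[R]_n => rV_cons (t, y)).
Proof.
move=> y; apply: (@cvg_rV R _ (nbhs y) (nbhs_filter y)) => i; case: (unliftP ord0 i) => [j ->|->].
  rewrite (_ : (fun y : 'rV[R]_n => _) = fun y : 'rV[R]_n => y ord0 j); last first.
    by apply/funext => z; rewrite mxE liftK.
  by rewrite mxE liftK /=; exact: coord_continuous.
rewrite (_ : (fun y : 'rV[R]_n => _) = fun=> t); last first.
  by apply/funext => z; rewrite mxE unlift_none.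
by rewrite mxE unlift_none /=; exact: cvg_cst.
Qed.

Lemma rV_supported_bounded n (r : R) (g : 'rV[R]_n -> R) :
  continuous g -> rV_supported r g -> exists M : R, forall x, `|g x| <= M.
Proof.
move=> cg sg.
have cK : compact [set x : 'rV[R]_n | forall i, `[(- r), r]%classic (x ord0 i)].
  by apply: (@rV_compact _ _ (fun=> `[(- r), r]%classic)) => i; exact: segment_compact.
have /compact_bounded[M [_ hM]] : compact (g @` [set x : 'rV[R]_n | forall i, `[(- r), r]%classic (x ord0 i)]).
  by apply: continuous_compact cK; exact: continuous_subspaceT.
exists (`|M| + 1) => x.
case: (pselect (forall i, `[(- r), r]%classic (x ord0 i))) => h.
  apply: hM; first by rewrite (le_lt_trans (ler_norm _))// ltrDl.
  by exists x.
rewrite sg ?normr0 ?addr_ge0//.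
move/existsNP : h => [i hi]; exists i; rewrite leNgt; apply/negP => h; apply: hi.
by rewrite /= in_itv /=; move: h; rewrite ltr_norml => /andP[/ltW -> /ltW ->].
Qed.

(** A Gaussian stands in for the volume of the cube: where g may be nonzero |x|^2 <= n r^2, so a
    bound M of |g| is at most M e^(n r^2) e^(-|x|^2), whose integral is known. *)
Lemma rV_supported_integrable n (r : R) (g : 'rV[R]_n -> R) :
  continuous g -> rV_supported r g -> lebesgue_rV.-integrable setT (EFin \o g).
Proof.
move=> cg sg; have [M hM] := rV_supported_bounded cg sg.
have M0 : 0 <= M by apply: le_trans (hM 0).
pose G (x : 'rV[R]_n) := expR (- \sum_i (1 * (x ord0 i - 0) ^+ 2)).
have mG : measurable_fun setT G.
  apply: measurableT_comp => //; apply: measurableT_comp => //.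
  apply: measurable_sum => i; apply: measurable_funM => //; apply: measurable_funX.
  by apply: measurable_funB => //; exact: measurable_rV_coord.
apply: (@le_integrable _ _ _ _ _ measurableT _ (fun x => (M * expR (n%:R * r ^+ 2) * G x)%:E)).
- by apply/measurable_EFinP; exact: continuous_measurable_rV.
- move=> x _ /=; rewrite lee_fin [leRHS]ger0_norm; last first.
    by rewrite !mulr_ge0 ?expR_ge0.
  case: (pselect (exists i, r <= `|x ord0 i|)) => h.
    by rewrite sg// normr0 !mulr_ge0 ?expR_ge0.
  apply: (le_trans (hM x)); rewrite -mulrA ler_peMr// /G -expRD -[leLHS]expR0 ler_expR.
  rewrite subr_ge0.
  have -> : n%:R * r ^+ 2 = \sum_(i < n) r ^+ 2 by rewrite sumr_const card_ord mulr_natl.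
  apply: ler_sum => i _; rewrite mul1r subr0 -real_normK ?num_real//.
  have hi : `|x ord0 i| < r by rewrite ltNge; apply/negP => h'; apply: h; exists i.
  by rewrite ler_sqr ?nnegrE// ltW// (le_lt_trans _ hi).
- apply/integrableP; split.
    by apply/measurable_EFinP; exact: measurable_funM.
  under eq_integral do rewrite gee0_abs ?lee_fin ?mulr_ge0 ?expR_ge0// EFinM.
  rewrite ge0_integralZl ?lee_fin ?mulr_ge0 ?expR_ge0//; last 2 first.
  + exact/measurable_EFinP.
  + by move=> x _; rewrite lee_fin expR_ge0.
  by rewrite (@integral_gauss_prod _ n (fun=> 1) (fun=> 0))// -EFinM ltry.
Qed.

(** Induction on the dimension. A direction other than the first is still a coordinate direction of
    the slices, to which the induction hypothesis applies; for the first direction Fubini makes the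
    line integral the inner one. *)
Lemma integral_lines0 n (i : 'I_n) (r : R) (G : 'rV[R]_n -> R) :
  continuous G -> rV_supported r G ->
  (forall x, \int[lebesgue_measure]_t (G (x + t *: basis_vec i))%:E = 0)%E ->
  (\int[lebesgue_rV]_x (G x)%:E = 0)%E.
Proof.
elim: n i G => [[]//|n ih] i G cG sG G0.
have cGt t : continuous (fun y : 'rV[R]_n => G (rV_cons (t, y))).
  by move=> y; apply: continuous_comp; [exact: continuous_rV_cons|exact: cG].
have sGt t : rV_supported r (fun y : 'rV[R]_n => G (rV_cons (t, y))).
  move=> y [j hj]; apply: sG; exists (lift ord0 j).
  by rewrite mxE liftK.
have iG := rV_supported_integrable cG sG.
case: (unliftP ord0 i) => [j|] ij; rewrite {i}ij in G0.
  rewrite integral_rV_cons//; transitivity (\int[@lebesgue_measure R]_t (0%:E : \bar R))%E.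
    apply: eq_integral => t _; apply: (ih j) => //.
    by move=> y; under eq_integral do rewrite -rV_cons_line; exact: G0.
  by rewrite integral0.
have iGc : (lebesgue_measure \x lebesgue_rV)%E.-integrable setT
    ((EFin \o G) \o @rV_cons R n).
  have mG := measurable_int _ iG.
  apply/integrableP; split.
    exact: (measurableT_comp mG (@measurable_rV_cons R n)).
  have /integrableP[_] := iG.
  rewrite (ge0_integral_pushforward (@measurable_rV_cons R n) (lebesgue_measure \x lebesgue_rV)%E)//.
  exact: measurableT_comp.
rewrite integral_rV_cons//.
rewrite (Fubini iGc).
transitivity (\int[@lebesgue_rV R n]_y (0%:E : \bar R))%E; last by rewrite integral0.
apply: eq_integral => y _; rewrite -[RHS](G0 (rV_cons (0, y))).
by apply: eq_integral => t _; rewrite rV_cons_line0 add0r.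
Qed.

Theorem integral_partial0 n (i : 'I_n) (r : R) (g dg : 'rV[R]_n -> R) :
  (forall x, is_derive x (basis_vec i) g (dg x)) -> continuous dg ->
  rV_supported r g -> rV_supported r dg ->
  (\int[lebesgue_rV]_x (dg x)%:E = 0)%E.
Proof.
move=> Dg cdg sg sdg; apply: (integral_lines0 (i := i) cdg sdg) => x.
(* The line is parametrized from x, so it is surely outside the cube only once |t| >= r + |x_i|. *)
have sup t : r + `|x ord0 i| <= `|t| ->
    exists j, r <= `|(x + t *: basis_vec i) ord0 j|.
  move=> h; exists i; rewrite !mxE !eqxx mulr1 addrC.
  by rewrite -lerBrDr in h; rewrite (le_trans h)// lerB_normD.
apply: (@integral_derive_line (fun t => g (x + t *: basis_vec i)) _ (r + `|x ord0 i|)).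
- by move=> t; exact: is_derive_line.
- move=> t; apply: continuous_comp; last exact: cdg.
  by apply: cvgD; [exact: cvg_cst|apply: cvgZr_tmp; exact: cvg_id].
- by move=> t /sup; exact: sg.
- by move=> t /sup; exact: sdg.
Qed.

End lines.

(** * Rules for partial derivatives and continuity *)

Section calculus.
Context {R : realType} (n : nat).
Implicit Types (f g : 'rV[R]_n -> R) (i j : 'I_n).

Definition is_partial i f df := forall x, is_derive x (basis_vec i) f (df x).

Lemma is_partial_ext i f g df dg : is_partial i f df -> f =1 g -> df =1 dg ->
  is_partial i g dg.
Proof. by move=> h /funext <- /funext <-. Qed.

Lemma is_partialD i f g df dg : is_partial i f df -> is_partial i g dg ->
  is_partial i (fun x => f x + g x) (fun x => df x + dg x).
Proof. by move=> hf hg x; exact: is_deriveD. Qed.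

Lemma is_partialN i f df : is_partial i f df ->
  is_partial i (fun x => - f x) (fun x => - df x).
Proof. by move=> hf x; exact: is_deriveN. Qed.

Lemma is_partialB i f g df dg : is_partial i f df -> is_partial i g dg ->
  is_partial i (fun x => f x - g x) (fun x => df x - dg x).
Proof. by move=> hf hg x; exact: is_deriveB. Qed.

Lemma is_partialM i f g df dg : is_partial i f df -> is_partial i g dg ->
  is_partial i (fun x => f x * g x) (fun x => df x * g x + f x * dg x).
Proof.
move=> hf hg x; apply: is_derive_eq; first exact: is_deriveM.
by rewrite addrC; congr (_ + _); rewrite -[LHS]/(_ * _) mulrC.
Qed.

Lemma is_partial_cst i (c : R) : is_partial i (fun=> c) (fun=> 0).
Proof. by move=> x; exact: is_derive_cst. Qed.

Lemma is_partial_sum i (I : Type) (s : seq I) (f df : I -> 'rV[R]_n -> R) :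
  (forall k, is_partial i (f k) (df k)) ->
  is_partial i (fun x => \sum_(k <- s) f k x) (fun x => \sum_(k <- s) df k x).
Proof.
move=> h; elim: s => [|k s ih].
  by apply: (is_partial_ext (is_partial_cst i 0)) => x; rewrite big_nil.
by apply: (is_partial_ext (is_partialD (h k) ih)) => x; rewrite big_cons.
Qed.

Lemma is_partial_line i f df : (forall x, is_derive (0:R) (1:R) (fun s => f (x + s *: basis_vec i)) (df x)) ->
  is_partial i f df.
Proof.
move=> h x; have [dv e] := h x.
have E : (fun h : R => h^-1 *: ((f \o shift x) (h *: basis_vec i) - f x)) =
    (fun h : R => h^-1 *: (((fun s => f (x + s *: basis_vec i)) \o shift (0:R)) (h *: (1 : R)) - f (x + (0:R) *: basis_vec i))).
  apply/funext => s /=; congr (_ *: (f _ - f _)).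
    by rewrite /shift /= addr0 [s%:A]mulr1 addrC.
  by rewrite scale0r addr0.
split.
- by rewrite /derivable E.
- by rewrite /derive E.
Qed.

Lemma is_partial_coord i j :
  is_partial i (fun x => x ord0 j) (fun=> (i == j)%:R).
Proof.
apply: is_partial_line => x.
rewrite (_ : (fun s => _) = fun s : R => x ord0 j + s * (i == j)%:R); last first.
  by apply/funext => s; rewrite !mxE eqxx eq_sym.
by apply: is_derive_eq; rewrite /= ?scaler0 add0r ?[_ *: _]mulr1 ?add0r ?scale1r ?mulr1 ?addr0 ?mul1r.
Qed.

Lemma is_partial_comp i (h dh : R -> R) f df : (forall t : R, is_derive t 1 h (dh t)) ->
  is_partial i f df -> is_partial i (fun x => h (f x)) (fun x => dh (f x) * df x).
Proof.
move=> hh hf; apply: is_partial_line => x.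
apply: (@is_derive1_comp _ h (fun s => f (x + s *: basis_vec i))).
  by rewrite scale0r addr0.
apply: is_derive_line; rewrite scale0r addr0; exact: hf.
Qed.

(** This criterion is meant for max(0, t)^2 at its kink t = 0, where the factor max(0, t) has no
    derivative and the product rule is of no help. *)
Lemma is_derive_quadratic (h : R -> R) (t l C : R) :
  (forall s, `|h (t + s) - h t - s * l| <= C * s ^+ 2) -> is_derive t 1 h l.
Proof.
move=> hC.
have C0 : 0 <= C.
  by have := hC 1; rewrite expr1n mulr1; exact: le_trans.
suff cv : s^-1 *: ((h \o shift t) (s *: (1:R)) - h t) @[s --> 0^'] --> l.
  by split; [apply/cvg_ex; exists l|apply/cvg_lim].
apply/cvgrPdist_le => e e0.
near=> s; rewrite /= [s%:A]mulr1.
have s0 : s != 0 by near: s; exact: nbhs_dnbhs_neq.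
have -> : l - s^-1 *: (h (s + t) - h t) = - (s^-1 * (h (t + s) - h t - s * l)).
  by rewrite -[_ *: _]/(_ * _) (addrC s t); field.
rewrite normrN normrM normfV.
apply: (@le_trans _ _ (`|s|^-1 * (C * s ^+ 2))); first by rewrite ler_wpM2l.
rewrite -real_normK ?num_real// mulrCA expr2 mulKf ?normr_eq0//.
have : `|s| <= e / (C + 1).
  by near: s; apply: dnbhs0_le; rewrite divr_gt0// ltr_wpDl.
rewrite ler_pdivlMr ?ltr_wpDl//; apply: le_trans.
by rewrite mulrC ler_wpM2l// lerDl.
Unshelve. all: by end_near. Qed.

Lemma is_derive_pos_sqr (t : R) :
  is_derive t 1 (fun s => Num.max 0 s ^+ 2) (2 * Num.max 0 t).
Proof.
apply: (@is_derive_quadratic _ _ _ 1) => s; rewrite mul1r.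
rewrite ler_norml.
by case: (leP 0 (t + s)) => h1; case: (leP 0 t) => h2; apply/andP; split; nra.
Qed.

Lemma rV_contM f g : continuous f -> continuous g -> continuous (fun x => f x * g x).
Proof. by move=> cf cg x; exact: (cvgM (cf x) (cg x)). Qed.
Lemma rV_contD f g : continuous f -> continuous g -> continuous (fun x => f x + g x).
Proof. by move=> cf cg x; exact: (cvgD (cf x) (cg x)). Qed.
Lemma rV_contN f : continuous f -> continuous (fun x => - f x).
Proof. by move=> cf x; exact: (cvgN (cf x)). Qed.
Lemma rV_contB f g : continuous f -> continuous g -> continuous (fun x => f x - g x).
Proof. by move=> cf cg; apply: rV_contD => //; exact: rV_contN. Qed.
Lemma rV_cont_pair f g (h k : 'rV[R]_n -> R) : continuous f -> continuous g ->
  continuous h -> continuous k -> continuous (fun x => f x * g x + h x * k x).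
Proof. by move=> cf cg ch ck; exact: (rV_contD (rV_contM cf cg) (rV_contM ch ck)). Qed.
Lemma rV_cont_cst (c : R) : continuous (fun _ : 'rV[R]_n => c).
Proof. exact: cst_continuous. Qed.
Lemma rV_cont_coord j : continuous (fun x : 'rV[R]_n => x ord0 j).
Proof. exact: coord_continuous. Qed.
Lemma rV_cont_sum (I : Type) (s : seq I) (f : I -> 'rV[R]_n -> R) :
  (forall k, continuous (f k)) -> continuous (fun x => \sum_(k <- s) f k x).
Proof.
move=> cf; elim: s => [|k s ih].
  under eq_fun do rewrite big_nil; exact: rV_cont_cst.
under eq_fun do rewrite big_cons; exact: rV_contD.
Qed.

End calculus.

(** * The cutoff max(0, 1 - c |x|^2)^2 *)

Section cutoff.
Context {R : realType} (n : nat) (c : R).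
Hypothesis c0 : 0 < c.

Definition sqnorm (x : 'rV[R]_n) := \sum_i x ord0 i ^+ 2.

Lemma sqnorm_ge0 x : 0 <= sqnorm x.
Proof. by apply: sumr_ge0 => i _; exact: sqr_ge0. Qed.

(** Squaring this root gives a C^1 cutoff with gradient -4 c m x, where m is the root itself: one
    factor m remains in the gradient, exactly what is needed to complete a square with m grad u. *)
Definition cut_root (x : 'rV[R]_n) := Num.max 0 (1 - c * sqnorm x).
Definition cutoff x := cut_root x ^+ 2.

Lemma cut_root_ge0 x : 0 <= cut_root x.
Proof. by rewrite /cut_root le_max lexx. Qed.

Lemma cut_root_le1 x : cut_root x <= 1.
Proof. by rewrite /cut_root ge_max ler01 gerBl mulr_ge0 ?sqnorm_ge0// ltW. Qed.

Lemma cutoff_ge0 x : 0 <= cutoff x.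
Proof. exact: sqr_ge0. Qed.

Lemma cutoff_le1 x : cutoff x <= 1.
Proof. by rewrite /cutoff expr_le1// ?cut_root_le1// cut_root_ge0. Qed.

(** Used to see that the cutoffs tend to 1 pointwise as c tends to 0. *)
Lemma cutoff_ge x : 1 - 2 * (c * sqnorm x) <= cutoff x.
Proof.
rewrite /cutoff /cut_root; have := sqnorm_ge0 x; move: (sqnorm x) => s s0.
have := mulr_ge0 (ltW c0) s0; move: (c * s) => y y0.
by case: (leP 0 (1 - y)) => h; nra.
Qed.

Lemma cut_root_gt0 x : 0 < cut_root x -> c * sqnorm x < 1.
Proof. by rewrite /cut_root lt_max ltxx subr_gt0. Qed.

Lemma sqnorm_partial i :
  is_partial i sqnorm (fun x => 2 * x ord0 i).
Proof.
apply: (is_partial_ext (is_partial_sum (index_enum 'I_n)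
  (fun k => is_partialM (is_partial_coord (R := R) i k) (is_partial_coord i k)))) => x.
  by apply: eq_bigr => k _; rewrite expr2.
rewrite (bigD1 i)//= big1 ?addr0 => [|k ki].
  by rewrite eqxx mul1r mulr1 mulr_natl mulr2n.
by rewrite eq_sym (negbTE ki) mul0r mulr0 addr0.
Qed.

Lemma cutoff_partial i :
  is_partial i cutoff (fun x => - (4 * c * cut_root x * x ord0 i)).
Proof.
apply: (is_partial_ext (is_partial_comp (is_derive_pos_sqr (R := R))
  (is_partialB (is_partial_cst i 1) (is_partialM (is_partial_cst i c) (sqnorm_partial i))))) => x.
  by [].
by rewrite /cut_root /=; ring.
Qed.

Lemma continuous_sqnorm : continuous sqnorm.
Proof.
apply: rV_cont_sum => i; under eq_fun do rewrite expr2.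
by apply: rV_contM; exact: rV_cont_coord.
Qed.

Lemma continuous_cut_root : continuous cut_root.
Proof.
move=> x; apply: (@continuous_comp _ _ _ (fun x => 1 - c * sqnorm x) (fun t : R => Num.max 0 t)).
  by apply: rV_contB; [exact: rV_cont_cst|apply: rV_contM;
    [exact: rV_cont_cst|exact: continuous_sqnorm]].
by apply: continuous_max; [exact: cvg_cst|exact: cvg_id].
Qed.

Lemma continuous_cutoff : continuous cutoff.
Proof.
rewrite /cutoff; under eq_fun do rewrite expr2.
by apply: rV_contM; exact: continuous_cut_root.
Qed.

Lemma cut_root_supported : rV_supported (Num.sqrt c^-1) cut_root.
Proof.
move=> x [i hi]; apply/eqP; rewrite eq_le cut_root_ge0 andbT leNgt.
apply/negP => /cut_root_gt0; apply/negP; rewrite -leNgt.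
rewrite -ler_pdivrMl// mulr1 /sqnorm (bigD1 i)//=.
apply: (@le_trans _ _ (x ord0 i ^+ 2)); last first.
  by rewrite lerDl sumr_ge0// => j _; exact: sqr_ge0.
have cs : 0 <= c^-1 by rewrite invr_ge0 ltW.
rewrite -real_normK ?num_real// -[leLHS]sqr_sqrtr//.
by rewrite ler_sqr ?nnegrE ?sqrtr_ge0.
Qed.

Lemma cutoff_supported : rV_supported (Num.sqrt c^-1) cutoff.
Proof. by move=> x /cut_root_supported h; rewrite /cutoff h expr0n. Qed.

(** Where c r2 <= 1/2 the cutoff is at least 1/4 and v <= C. Elsewhere 1 + r2 > 1/(2c), so v <= 2 c
    C. The first term will be beaten by the frequency, the second by the choice of c. *)
Lemma cutoff_dominates (r2 C v : R) : 0 <= r2 -> 0 <= v -> v <= C / (1 + r2) ->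
  v ^+ 2 <= 4 * C ^+ 2 * Num.max 0 (1 - c * r2) ^+ 2 + 4 * C ^+ 2 * c ^+ 2.
Proof.
move=> r0 v0 vC.
have C0 : 0 <= C.
  have : 0 <= C / (1 + r2) by exact: le_trans vC.
  by rewrite pmulr_lge0 // invr_gt0 ltr_wpDr.
have v2 : v ^+ 2 * (1 + r2) ^+ 2 <= C ^+ 2.
  by rewrite -exprMn ler_sqr ?nnegrE ?mulr_ge0 ?addr_ge0// -ler_pdivlMr// ltr_wpDr.
case: (leP (c * r2) 2^-1) => h.
  have m2 : 2^-1 <= Num.max 0 (1 - c * r2) by rewrite le_max; apply/orP; right; lra.
  have : 4^-1 <= Num.max 0 (1 - c * r2) ^+ 2 by nra.
  have : v ^+ 2 <= C ^+ 2.
    apply: le_trans v2; rewrite ler_peMr ?sqr_ge0// expr_ge1//; lra.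
  have := sqr_ge0 (C * c); nra.
have h2 : 1 <= 4 * c ^+ 2 * (1 + r2) ^+ 2.
  have : 1 <= 2 * c * (1 + r2) by nra.
  move=> h3; rewrite (_ : 4 * c ^+ 2 * _ = (2 * c * (1 + r2)) ^+ 2); last by ring.
  by rewrite exprn_ege1.
have : v ^+ 2 <= 4 * C ^+ 2 * c ^+ 2.
  apply: (@le_trans _ _ (v ^+ 2 * (4 * c ^+ 2 * (1 + r2) ^+ 2))).
    by rewrite ler_peMr// sqr_ge0.
  rewrite (_ : v ^+ 2 * _ = (v ^+ 2 * (1 + r2) ^+ 2) * (4 * c ^+ 2)); last by ring.
  rewrite (_ : 4 * C ^+ 2 * _ = C ^+ 2 * (4 * c ^+ 2)); last by ring.
  by rewrite ler_wpM2r// mulr_ge0// sqr_ge0.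
have : 0 <= 4 * C ^+ 2 * Num.max 0 (1 - c * r2) ^+ 2 by rewrite mulr_ge0 ?sqr_ge0// mulr_ge0// sqr_ge0.
lra.
Qed.

End cutoff.

(** * Pointwise inequalities behind the energy identities, one coordinate at a time *)

Section energy_pointwise.
Context {R : realType}.

(* [b1] and [b2] stand for the divergence terms of the two energy identities. *)
Lemma energy_pointwise1 (c m x p q p1 q1 p2 q2 b1 : R) :
  0 < c -> 0 <= m <= 1 ->
  b1 = - (4 * c * m * x) * (p * p1 + q * q1) +
       m ^+ 2 * (p1 * p1 + p * p2 + (q1 * q1 + q * q2)) -
       (- (4 * c * m * x) * (x * (p * p + q * q)) +
        m ^+ 2 * (1 * (p * p + q * q) + x * (p1 * p + p * p1 + (q1 * q + q * q1)))) ->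
  2^-1 * m ^+ 2 * (p1 ^+ 2 + q1 ^+ 2) - b1 <=
  - (m ^+ 2 * (p * (p2 - 2 * x * p1) + q * (q2 - 2 * x * q1))) +
  m ^+ 2 * (p ^+ 2 + q ^+ 2) + 8 * c ^+ 2 * ((0 < m)%R%:R * x ^+ 2) * (p ^+ 2 + q ^+ 2).
Proof.
move=> c0 /andP[m0 m1] ->; rewrite -subr_ge0.
case: (ltP 0 m) => hm /=; rewrite ?mulr1n ?mulr0n ?mul1r ?mul0r.
  set e := (X in 0 <= X).
  (* The two squares absorb the product of grad u with the gradient of the cutoff, at the price of
     half of m^2 |u_i|^2 and of the term 8 c^2 x^2 |u|^2. The last summand is the drift falling on
     the cutoff; its sign is favourable because the cutoff decreases away from the origin. *)
  have -> : e = 2^-1 * (m * p1 - 4 * c * x * p) ^+ 2 +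
    2^-1 * (m * q1 - 4 * c * x * q) ^+ 2 + 4 * c * m * (x ^+ 2 * (p ^+ 2 + q ^+ 2)).
    by rewrite /e; field.
  have h : 0 <= x ^+ 2 * (p ^+ 2 + q ^+ 2) by rewrite mulr_ge0 ?addr_ge0 ?sqr_ge0.
  have h1 := mulr_ge0 (mulr_ge0 (ltW c0) m0) h.
  have h2 := sqr_ge0 (m * p1 - 4 * c * x * p).
  have h3 := sqr_ge0 (m * q1 - 4 * c * x * q).
  rewrite (_ : 4 * c * m * _ = 4 * (c * m * (x ^+ 2 * (p ^+ 2 + q ^+ 2)))); last by ring.
  by rewrite addr_ge0 ?addr_ge0 ?(mulr_ge0 _ h1) ?(mulr_ge0 _ h2) ?(mulr_ge0 _ h3) ?invr_ge0.
have -> : m = 0 by apply/eqP; rewrite eq_le hm m0.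
by rewrite expr0n /= ; lra.
Qed.

Lemma energy_pointwise2 (c m x p q p1 q1 p2 q2 b2 : R) :
  0 < c -> 0 <= m <= 1 ->
  b2 = - (4 * c * m * x) * (p * q1 - q * p1) +
       m ^+ 2 * (p1 * q1 + p * q2 - (q1 * p1 + q * p2)) ->
  m ^+ 2 * (p * (q2 - 2 * x * q1) - q * (p2 - 2 * x * p1)) - b2 <=
  (2 * c + 1) * ((0 < m)%R%:R * x ^+ 2 * (p ^+ 2 + q ^+ 2) + m ^+ 2 * (p1 ^+ 2 + q1 ^+ 2)).
Proof.
move=> c0 /andP[m0 m1] ->; set lhs := (X in X <= _).
have -> : lhs = (4 * c * m * x - 2 * m ^+ 2 * x) * (p * q1 - q * p1).
  by rewrite /lhs; ring.
case: (ltP 0 m) => hm /=; rewrite ?mulr1n ?mulr0n ?mul1r ?mul0r; last first.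
  have -> : m = 0 by apply/eqP; rewrite eq_le hm m0.
  by rewrite expr0n /=; lra.
apply: (le_trans (ler_norm _)); rewrite normrM.
have h1 : `|4 * c * m * x - 2 * m ^+ 2 * x| <= (4 * c + 2) * `|m * x|.
  rewrite (_ : _ - _ = (4 * c - 2 * m) * (m * x)); last by ring.
  by rewrite normrM ler_wpM2r// ler_norml; apply/andP; split; lra.
apply: (le_trans (ler_wpM2r (normr_ge0 _) h1)).
rewrite -mulrA -normrM (_ : 4 * c + 2 = (2 * c + 1) * 2); last by ring.
rewrite -mulrA ler_wpM2l//; first by lra.
rewrite -ler_pdivlMl// ler_norml.
(* The factor x goes to u and the factor m to the derivative: x is bounded on the support of the
   cutoff, and m^2 |u_i|^2 is controlled by the first energy estimate. *)
have e1 : m * x * (p * q1 - q * p1) = (x * p) * (m * q1) - (x * q) * (m * p1) by ring.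
rewrite e1.
have := sqr_ge0 (x * p - m * q1); have := sqr_ge0 (x * p + m * q1).
have := sqr_ge0 (x * q - m * p1); have := sqr_ge0 (x * q + m * p1).
by move=> *; apply/andP; split; lra.
Qed.

End energy_pointwise.

(** * Energy estimates for (lambda - L_0) u = f *)

Section energy_integrated.
Context {R : realType} (n : nat).
Local Open Scope ereal_scope.

(** Divergences of compactly supported fields integrate to 0, so they may be added freely to a
    pointwise inequality before integrating. When H has infinite integral nothing is claimed. *)
Lemma integral_le_divergence (r : R) (A H : 'rV[R]_n -> R)
    (B dB : 'I_n -> 'rV[R]_n -> R) :
  continuous A -> rV_supported r A ->
  (forall i, is_partial i (B i) (dB i)) -> (forall i, continuous (dB i)) ->
  (forall i, rV_supported r (B i)) -> (forall i, rV_supported r (dB i)) ->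
  measurable_fun setT H -> (forall x, 0 <= H x)%R ->
  (forall x, A x - \sum_i dB i x <= H x)%R ->
  \int[lebesgue_rV]_x (A x)%:E <= \int[lebesgue_rV]_x (H x)%:E.
Proof.
move=> cA sA DB cdB sB sdB mH H0 AH.
have iA := rV_supported_integrable cA sA.
have idB i := rV_supported_integrable (cdB i) (sdB i).
case: (ltP (\int[lebesgue_rV]_x (H x)%:E) +oo) => [Hfin|]; last first.
  by rewrite leye_eq => /eqP ->; exact: leey.
have iH : lebesgue_rV.-integrable setT (EFin \o H).
  apply/integrableP; split; first exact/measurable_EFinP.
  by under eq_integral do rewrite gee0_abs ?lee_fin//.
have cS : continuous (fun x => \sum_i dB i x)%R by exact: rV_cont_sum.
have sS : rV_supported r (fun x => \sum_i dB i x)%R.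
  by move=> x hx; rewrite big1// => i _; exact: sdB.
have iS := rV_supported_integrable cS sS.
have S0 : \int[lebesgue_rV]_x (\sum_i dB i x)%:E = 0.
  under eq_integral do rewrite -sumEFin.
  rewrite integral_sum//; apply: big1 => i _.
  exact: (integral_partial0 (DB i) (cdB i) (sB i) (sdB i)).
rewrite -[leLHS]sube0 -S0 -integralB_EFin//.
apply: le_integral => //; first by apply: integrableB.
by move=> x _; rewrite /= -EFinB lee_fin.
Qed.

Variables (p q : 'rV[R]_n -> R) (p1 q1 p2 q2 : 'I_n -> 'rV[R]_n -> R).
Variables (b w U N : R).
Hypothesis b0 : (0 < b)%R.
Hypotheses (Dp : forall i, is_partial i p (p1 i)) (Dq : forall i, is_partial i q (q1 i)).
Hypotheses (Dp1 : forall i, is_partial i (p1 i) (p2 i)) (Dq1 : forall i, is_partial i (q1 i) (q2 i)).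
Hypotheses (cp : continuous p) (cq : continuous q).
Hypotheses (cp1 : forall i, continuous (p1 i)) (cq1 : forall i, continuous (q1 i)).
Hypotheses (cp2 : forall i, continuous (p2 i)) (cq2 : forall i, continuous (q2 i)).

Let drift (g1 g2 : 'I_n -> 'rV[R]_n -> R) x : R :=
  (\sum_i (g2 i x - 2 * x ord0 i * g1 i x))%R.
(** For u = p + i q, [F] and [G] are the real and imaginary parts of f = (n + b + i w) u - L_0 u;
    [usq], [fsq] and [gsq] are |u|^2, |f|^2 and |grad u|^2. *)
Let F x : R := ((n%:R + b) * p x - w * q x - drift p1 p2 x)%R.
Let G x : R := ((n%:R + b) * q x + w * p x - drift q1 q2 x)%R.
Let usq x : R := (p x ^+ 2 + q x ^+ 2)%R.
Let fsq x : R := (F x ^+ 2 + G x ^+ 2)%R.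
Let gsq x : R := (\sum_i (p1 i x ^+ 2 + q1 i x ^+ 2))%R.

Hypothesis hU : \int[lebesgue_rV]_x (usq x)%:E = U%:E.
Hypothesis hN : \int[lebesgue_rV]_x (fsq x)%:E = N%:E.

Let c2 (g : 'rV[R]_n -> R) : continuous g -> continuous (fun x => g x ^+ 2)%R.
Proof. by move=> cg; under eq_fun do rewrite expr2; exact: rV_contM. Qed.

Let cusq : continuous usq.
Proof. by apply: rV_contD; exact: c2. Qed.

Let cgsq : continuous gsq.
Proof. by apply: rV_cont_sum => i; apply: rV_contD; exact: c2. Qed.

Let cdrift (g1 g2 : 'I_n -> 'rV[R]_n -> R) : (forall i, continuous (g1 i)) ->
  (forall i, continuous (g2 i)) -> continuous (drift g1 g2).
Proof.
move=> h1 h2; apply: rV_cont_sum => i; apply: rV_contB => //.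
apply: rV_contM => //; apply: rV_contM; [exact: rV_cont_cst|exact: rV_cont_coord].
Qed.

Let cF : continuous F.
Proof.
apply: rV_contB; last exact: cdrift.
by apply: rV_contB; apply: rV_contM => //; exact: rV_cont_cst.
Qed.

Let cG : continuous G.
Proof.
apply: rV_contB; last exact: cdrift.
by apply: rV_contD; apply: rV_contM => //; exact: rV_cont_cst.
Qed.

Let cfsq : continuous fsq.
Proof. by apply: rV_contD; exact: c2. Qed.

Let usq0 x : (0 <= usq x)%R. Proof. by rewrite addr_ge0// sqr_ge0. Qed.
Let fsq0 x : (0 <= fsq x)%R. Proof. by rewrite addr_ge0// sqr_ge0. Qed.
Let gsq0 x : (0 <= gsq x)%R.
Proof. by apply: sumr_ge0 => i _; rewrite addr_ge0// sqr_ge0. Qed.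

Let U0 : (0 <= U)%R.
Proof. by rewrite -lee_fin -hU; apply: integral_ge0 => x _; rewrite lee_fin. Qed.
Let N0 : (0 <= N)%R.
Proof. by rewrite -lee_fin -hN; apply: integral_ge0 => x _; rewrite lee_fin. Qed.

Let int_comb (a1 a2 : R) : (0 <= a1)%R -> (0 <= a2)%R ->
  \int[lebesgue_rV]_x (a1 * fsq x + a2 * usq x)%:E = (a1 * N + a2 * U)%:E.
Proof.
move=> h1 h2.
have m1 : measurable_fun setT (EFin \o fsq) by apply/measurable_EFinP; exact: continuous_measurable_rV.
have m2 : measurable_fun setT (EFin \o usq) by apply/measurable_EFinP; exact: continuous_measurable_rV.
under eq_integral do rewrite EFinD !EFinM.
rewrite ge0_integralD//.
- rewrite !ge0_integralZl ?lee_fin//.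
  + by rewrite hU hN.
  + by move=> x _; rewrite lee_fin.
  + by move=> x _; rewrite lee_fin.
- by move=> x _; rewrite mule_ge0 ?lee_fin.
- exact: measurable_funeM.
- by move=> x _; rewrite mule_ge0 ?lee_fin.
- exact: measurable_funeM.
Qed.

Section fixed_cutoff.
Variable c : R.
Hypothesis c0 : (0 < c)%R.
Local Notation phi := (@cutoff R n c).
Local Notation m := (@cut_root R n c).
Let r := Num.sqrt c^-1.

Let cphi : continuous phi := @continuous_cutoff R n c.
Let cm : continuous m := @continuous_cut_root R n c.

Let dphi i : is_partial i phi (fun x => - (4 * c * m x * x ord0 i))%R.
Proof. exact: cutoff_partial. Qed.

Let cdphi i : continuous (fun x : 'rV[R]_n => - (4 * c * m x * x ord0 i))%R.
Proof.
apply: rV_contN; apply: rV_contM; last exact: rV_cont_coord.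
by apply: rV_contM => //; exact: rV_cont_cst.
Qed.

Let sphi (g : 'rV[R]_n -> R) : rV_supported r (fun x => phi x * g x)%R.
Proof. by move=> x hx; rewrite (cutoff_supported c0 hx) mul0r. Qed.

Let sdphi i (g : 'rV[R]_n -> R) :
  rV_supported r (fun x => - (4 * c * m x * x ord0 i) * g x)%R.
Proof. by move=> x hx; rewrite (cut_root_supported c0 hx) mulr0 mul0r oppr0 mul0r. Qed.

Let rV_supportedD (f g : 'rV[R]_n -> R) : rV_supported r f -> rV_supported r g ->
  rV_supported r (fun x => f x + g x)%R.
Proof. by move=> sf sg x hx; rewrite sf// sg// addr0. Qed.

Let rV_supportedB (f g : 'rV[R]_n -> R) : rV_supported r f -> rV_supported r g ->
  rV_supported r (fun x => f x - g x)%R.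
Proof. by move=> sf sg x hx; rewrite sf// sg// subr0. Qed.

Let is_partial_coord_self i : is_partial (R := R) (n := n) i (fun x => x ord0 i) (fun=> 1%R).
Proof. by apply: (is_partial_ext (is_partial_coord i i)) => // x; rewrite eqxx. Qed.

Let m01 (x : 'rV[R]_n) : (0 <= m x <= 1)%R.
Proof. by rewrite cut_root_ge0 cut_root_le1. Qed.

(** The support condition c |x|^2 < 1 is what turns the error 8 c^2 |x|^2 |u|^2 into 8 c |u|^2,
    which vanishes with c. *)
Let sum_ind x : ((0 < m x)%R%:R * \sum_i x ord0 i ^+ 2 <= c^-1 :> R)%R.
Proof.
rewrite -/(sqnorm x); case: (ltP 0%R (m x)) => /= hm; last first.
  by rewrite mul0r invr_ge0 ltW.
by rewrite mul1r -[leRHS]mulr1 ler_pdivlMl// ltW// cut_root_gt0.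
Qed.

(** The real part of the identity. The field [B] contains phi x_i |u|^2, whose divergence brings n
    phi |u|^2 and consumes the n of lambda. Of the remaining b phi |u|^2, one half pays for phi Re
    (f conj(u)) through Young's inequality and the other half stays on the left. *)
Lemma energy_estimate1 :
  \int[lebesgue_rV]_x (b / 2 * (phi x * usq x) + 2^-1 * (phi x * gsq x))%:E <=
  (N / (2 * b) + 8 * c * U)%:E.
Proof.
have -> : (N / (2 * b) + 8 * c * U)%:E =
    \int[lebesgue_rV]_x ((2 * b)^-1 * fsq x + 8 * c * usq x)%:E.
  rewrite int_comb ?[(N / _)%R]mulrC// ?invr_ge0 ?mulr_ge0//; exact: ltW.
pose B i x := (phi x * (p x * p1 i x + q x * q1 i x) -
  phi x * (x ord0 i * (p x * p x + q x * q x)))%R.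
pose dB i x := (- (4 * c * m x * x ord0 i) * (p x * p1 i x + q x * q1 i x) +
   phi x * (p1 i x * p1 i x + p x * p2 i x + (q1 i x * q1 i x + q x * q2 i x)) -
   (- (4 * c * m x * x ord0 i) * (x ord0 i * (p x * p x + q x * q x)) +
    phi x * (1 * (p x * p x + q x * q x) +
       x ord0 i * (p1 i x * p x + p x * p1 i x + (q1 i x * q x + q x * q1 i x)))))%R.
have co i : continuous (fun x : 'rV[R]_n => x ord0 i) by exact: rV_cont_coord.
apply: (@integral_le_divergence r _ _ B dB).
- by apply: rV_contD; (apply: rV_contM; first exact: rV_cont_cst); apply: rV_contM.
- apply: rV_supportedD => x hx.
    by rewrite (cutoff_supported c0 hx) mul0r mulr0.
  by rewrite (cutoff_supported c0 hx) mul0r mulr0.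
- move=> i; apply: is_partialB.
    apply: is_partialM => //.
    by apply: is_partialD; apply: is_partialM.
  apply: is_partialM => //; apply: is_partialM; first exact: is_partial_coord_self.
  by apply: is_partialD; apply: is_partialM.
- move=> i; pose cu := rV_cont_pair cp cp cq cq.
  have k1 := rV_cont_pair (@cdphi i) (rV_cont_pair cp (@cp1 i) cq (@cq1 i)) cphi
    (rV_contD (rV_cont_pair (@cp1 i) (@cp1 i) cp (@cp2 i)) (rV_cont_pair (@cq1 i) (@cq1 i) cq (@cq2 i))).
  have k2 := rV_cont_pair (@rV_cont_cst R n 1%R) cu (co i)
    (rV_contD (rV_cont_pair (@cp1 i) cp cp (@cp1 i)) (rV_cont_pair (@cq1 i) cq cq (@cq1 i))).
  have k3 := rV_cont_pair (@cdphi i) (rV_contM (co i) cu) cphi k2.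
  exact: (rV_contB k1 k3).
- by move=> i; apply: rV_supportedB; exact: sphi.
- move=> i; apply: rV_supportedB; apply: rV_supportedD;
    solve [exact: sphi|exact: sdphi].
- apply: continuous_measurable_rV.
  by apply: rV_contD; apply: rV_contM => //; exact: rV_cont_cst.
- move=> x; rewrite addr_ge0// mulr_ge0// ?invr_ge0 ?mulr_ge0//; exact: ltW.
- move=> x.
have key i : (2^-1 * (phi x * (p1 i x ^+ 2 + q1 i x ^+ 2)) - dB i x <=
   - (phi x * (p x * (p2 i x - 2 * x ord0 i * p1 i x) +
               q x * (q2 i x - 2 * x ord0 i * q1 i x))) +
    phi x * usq x + 8 * c ^+ 2 * usq x * ((0 < m x)%R%:R * x ord0 i ^+ 2))%R.
  have := @energy_pointwise1 R c (m x) (x ord0 i) (p x) (q x) (p1 i x) (q1 i x)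
    (p2 i x) (q2 i x) (dB i x) c0 (m01 x) erefl.
  rewrite /usq /cutoff => h; rewrite [X in (_ <= _ + X)%R]mulrAC (mulrA 2^-1%R); exact: h.
clearbody dB.
have sumkey := ler_sum (index_enum 'I_n) (fun i (_ : true) => key i).
have {sumkey} : (2^-1 * (phi x * gsq x) - \sum_i dB i x <=
   - (phi x * (p x * drift p1 p2 x + q x * drift q1 q2 x)) +
   n%:R * (phi x * usq x) + 8 * c * usq x)%R.
  have -> : (2^-1 * (phi x * gsq x) - \sum_i dB i x =
      \sum_i (2^-1 * (phi x * (p1 i x ^+ 2 + q1 i x ^+ 2)) - dB i x))%R.
    by rewrite sumrB -!mulr_sumr.
  apply: (le_trans sumkey); rewrite !big_split/= sumr_const card_ord.
  rewrite [(n%:R * _)%R]mulr_natl sumrN -!mulr_sumr big_split/= -!mulr_sumr.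
  rewrite -/(drift p1 p2 x) -/(drift q1 q2 x) lerD2l.
  apply: (le_trans (ler_wpM2l _ (sum_ind x))).
    by rewrite mulr_ge0// mulr_ge0// sqr_ge0.
  rewrite le_eqVlt; apply/orP; left; apply/eqP; field; exact: lt0r_neq0.
have young : (phi x * (p x * F x + q x * G x) <=
    b / 2 * (phi x * usq x) + (2 * b)^-1 * fsq x)%R.
  have y1 : (p x * F x + q x * G x <= b / 2 * usq x + (2 * b)^-1 * fsq x)%R.
    rewrite -subr_ge0 (_ : (_ - _)%R = ((2 * b)^-1 * ((F x - b * p x) ^+ 2 + (G x - b * q x) ^+ 2))%R).
      by rewrite mulr_ge0 ?addr_ge0 ?sqr_ge0// invr_ge0 mulr_ge0// ltW.
    by rewrite /usq /fsq; field; exact: lt0r_neq0.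
  apply: (le_trans (ler_wpM2l (cutoff_ge0 c x) y1)).
  rewrite mulrDr mulrCA lerD2l ler_piMl// ?cutoff_le1//.
  by rewrite mulr_ge0// invr_ge0 mulr_ge0// ltW.
have e : (phi x * (p x * F x + q x * G x) = (n%:R + b) * (phi x * usq x) -
   phi x * (p x * drift p1 p2 x + q x * drift q1 q2 x))%R.
  by rewrite /F /G /usq; ring.
rewrite e in young.
by lra.
Qed.

(** The imaginary part. The drift and the gradient of the cutoff both leave a multiple of m x_i Im
    (conj(u) u_i), bounded through |x|^2 < 1/c; this is the origin of (2 c + 1) / c and rules out c
    -> 0. The resulting phi |grad u|^2 is paid for by [energy_estimate1]. No w occurs on the right,
    so u is small near the origin when w is large. *)
Lemma energy_estimate2 :
  \int[lebesgue_rV]_x (w * (phi x * usq x))%:E <=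
  (2^-1 * N + (2^-1 + (2 * c + 1) / c) * U +
    2 * (2 * c + 1) * (N / (2 * b) + 8 * c * U))%:E.
Proof.
have c21 : (0 <= 2 * c + 1)%R by have := ltW c0; lra.
have a0 : (0 <= 2^-1 + (2 * c + 1) / c)%R.
  by rewrite addr_ge0// ?invr_ge0// divr_ge0// ltW.
pose E x := (b / 2 * (phi x * usq x) + 2^-1 * (phi x * gsq x))%R.
have E0 x : (0 <= E x)%R.
  have h1 := mulr_ge0 (cutoff_ge0 c x) (usq0 x).
  have h2 := mulr_ge0 (cutoff_ge0 c x) (gsq0 x).
  have h3 : (0 <= b / 2)%R by rewrite divr_ge0// ltW.
  have := mulr_ge0 h3 h1; rewrite /E; lra.
have cE : continuous E.
  have h1 := rV_contM cphi cusq; have h2 := rV_contM cphi cgsq.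
  exact: (rV_cont_pair (@rV_cont_cst R n (b / 2)%R) h1 (@rV_cont_cst R n 2^-1%R) h2).
have mE : measurable_fun setT (EFin \o E).
  by apply/measurable_EFinP; exact: continuous_measurable_rV.
pose K x := (2^-1 * fsq x + (2^-1 + (2 * c + 1) / c) * usq x)%R.
have K0 x : (0 <= K x)%R by rewrite addr_ge0// mulr_ge0// invr_ge0.
have cK : continuous K.
  exact: (rV_cont_pair (@rV_cont_cst R n 2^-1%R) cfsq (@rV_cont_cst R n (2^-1 + (2 * c + 1) / c)%R) cusq).
have mK : measurable_fun setT (EFin \o K).
  by apply/measurable_EFinP; exact: continuous_measurable_rV.
apply: (@le_trans _ _ (\int[lebesgue_rV]_x (K x + 2 * (2 * c + 1) * E x)%:E)); last first.
  under eq_integral do rewrite EFinD EFinM.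
  rewrite ge0_integralD//.
  - rewrite EFinD leeD//; first by rewrite int_comb// invr_ge0.
    rewrite ge0_integralZl ?lee_fin ?mulr_ge0//.
    + rewrite [leRHS]EFinM; apply: lee_wpmul2l; last exact: energy_estimate1.
      by rewrite lee_fin mulr_ge0.
    + by move=> x _; rewrite lee_fin.
  - by move=> x _; rewrite lee_fin.
  - by move=> x _; rewrite mule_ge0 ?lee_fin ?mulr_ge0.
  - exact: measurable_funeM.
pose B i x := (phi x * (p x * q1 i x - q x * p1 i x))%R.
pose dB i x := (- (4 * c * m x * x ord0 i) * (p x * q1 i x - q x * p1 i x) +
   phi x * (p1 i x * q1 i x + p x * q2 i x - (q1 i x * p1 i x + q x * p2 i x)))%R.
apply: (@integral_le_divergence r _ _ B dB).
- exact: (rV_contM (@rV_cont_cst R n w) (rV_contM cphi cusq)).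
- by move=> x hx; rewrite (cutoff_supported c0 hx) mul0r mulr0.
- by move=> i; apply: is_partialM => //; apply: is_partialB; apply: is_partialM.
- move=> i.
  have k1 := rV_contB (rV_contM cp (@cq1 i)) (rV_contM cq (@cp1 i)).
  have k2 := rV_contB (rV_cont_pair (@cp1 i) (@cq1 i) cp (@cq2 i))
    (rV_cont_pair (@cq1 i) (@cp1 i) cq (@cp2 i)).
  exact: (rV_cont_pair (@cdphi i) k1 cphi k2).
- by move=> i; exact: sphi.
- by move=> i; apply: rV_supportedD; [exact: sdphi|exact: sphi].
- apply: continuous_measurable_rV.
  exact: (rV_contD cK (rV_contM (@rV_cont_cst R n (2 * (2 * c + 1))%R) cE)).
- by move=> x; rewrite addr_ge0// mulr_ge0// mulr_ge0.
move=> x.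
have key i : (phi x * (p x * (q2 i x - 2 * x ord0 i * q1 i x) -
               q x * (p2 i x - 2 * x ord0 i * p1 i x)) - dB i x <=
   (2 * c + 1) * (usq x * ((0 < m x)%R%:R * x ord0 i ^+ 2) +
      phi x * (p1 i x ^+ 2 + q1 i x ^+ 2)))%R.
  have := @energy_pointwise2 R c (m x) (x ord0 i) (p x) (q x) (p1 i x) (q1 i x)
    (p2 i x) (q2 i x) (dB i x) c0 (m01 x) erefl.
  by rewrite /usq /cutoff (mulrC (p x ^+ 2 + q x ^+ 2)%R).
clearbody dB.
have sumkey := ler_sum (index_enum 'I_n) (fun i (_ : true) => key i).
have {sumkey} : (phi x * (p x * drift q1 q2 x - q x * drift p1 p2 x) - \sum_i dB i x <=
   (2 * c + 1) * (usq x / c + phi x * gsq x))%R.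
  have -> : (phi x * (p x * drift q1 q2 x - q x * drift p1 p2 x) - \sum_i dB i x =
      \sum_i (phi x * (p x * (q2 i x - 2 * x ord0 i * q1 i x) -
               q x * (p2 i x - 2 * x ord0 i * p1 i x)) - dB i x))%R.
    by rewrite sumrB -!mulr_sumr sumrB -!mulr_sumr.
  apply: (le_trans sumkey); rewrite -mulr_sumr ler_wpM2l// big_split/= -!mulr_sumr.
  by rewrite lerD2r ler_wpM2l.
have young : (phi x * (p x * G x - q x * F x) <= 2^-1 * fsq x + 2^-1 * usq x)%R.
  have y1 : (p x * G x - q x * F x <= 2^-1 * fsq x + 2^-1 * usq x)%R.
    rewrite -subr_ge0 (_ : (_ - _)%R = (2^-1 * ((G x - p x) ^+ 2 + (F x + q x) ^+ 2))%R).
      by rewrite mulr_ge0 ?addr_ge0 ?sqr_ge0// invr_ge0.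
    by rewrite /usq /fsq; field.
  apply: (le_trans (ler_wpM2l (cutoff_ge0 c x) y1)).
  by rewrite ler_piMl// ?cutoff_le1// addr_ge0// mulr_ge0// invr_ge0.
have e : (phi x * (p x * G x - q x * F x) = w * (phi x * usq x) -
   phi x * (p x * drift q1 q2 x - q x * drift p1 p2 x))%R.
  by rewrite /F /G /usq; ring.
rewrite e in young.
have h3 : (0 <= (2 * c + 1) * b * (phi x * usq x))%R.
  apply: mulr_ge0; first by rewrite mulr_ge0// ltW.
  exact: mulr_ge0 (cutoff_ge0 c x) (usq0 x).
rewrite /K /E => h4.
rewrite (_ : (2^-1 + (2 * c + 1) / c) * usq x =
  2^-1 * usq x + (2 * c + 1) * (usq x / c))%R; last by ring.
lra.
Qed.

End fixed_cutoff.

(** The limit of [energy_estimate1] along c = 1/(k+1), without its gradient term: (b / 2) U <= N /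
    (2 b). The left side converges by dominated convergence under |u|^2. *)
Lemma energy_coercive : (b ^+ 2 * U <= N)%R.
Proof.
pose c k : R := (k.+1%:R^-1)%R.
have cpos k : (0 < c k)%R by rewrite invr_gt0.
have mphi k : measurable_fun setT (fun x => (cutoff (c k) x * usq x)%:E).
  apply/measurable_EFinP; apply: continuous_measurable_rV.
  exact: (rV_contM (@continuous_cutoff R n (c k)) cusq).
have musq : measurable_fun setT (EFin \o usq).
  by apply/measurable_EFinP; exact: continuous_measurable_rV.
have cv : \int[lebesgue_rV]_x (cutoff (c k) x * usq x)%:E @[k --> \oo] --> U%:E.
  rewrite -hU; apply: (@dominated_cvg _ _ _ _ _ _ _ _ (EFin \o usq)) => //.
  - move=> x _; apply: cvg_EFin; first exact: nearW.
    rewrite -[X in _ --> X]mul1r; apply: cvgM; last exact: cvg_cst.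
    apply: (squeeze_cvgr (f := (fun k => 1 - 2 * (c k * sqnorm x))%R) (h := fun=> 1%R)).
    + by apply: nearW => k; rewrite cutoff_le1// cutoff_ge.
    + rewrite -[X in _ --> X]subr0 -[X in (_ - X)%R](mulr0 2%R).
      apply: cvgB; first exact: cvg_cst.
      apply: cvgMl_tmp; rewrite -(mul0r (sqnorm x)); apply: cvgMr_tmp.
      exact: (@cvg_harmonic R).
    + exact: cvg_cst.
  - apply/integrableP; split => //.
    by under eq_integral do rewrite gee0_abs ?lee_fin//; rewrite hU ltry.
  - move=> k x _; rewrite gee0_abs lee_fin; last by rewrite mulr_ge0// cutoff_ge0.
    by rewrite ler_piMl// cutoff_le1.
have cv2 : (N / b ^+ 2 + 16 * U / b * c k)%:E @[k --> \oo] --> (N / b ^+ 2)%:E.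
  apply: cvg_EFin; first exact: nearW.
  rewrite -[X in _ --> X]addr0 -[X in (_ + X)%R](mulr0 (16 * U / b)%R) /comp /=.
  apply: cvgD; first exact: cvg_cst.
  by apply: cvgMl_tmp; exact: (@cvg_harmonic R).
have le12 k : \int[lebesgue_rV]_x (cutoff (c k) x * usq x)%:E <=
    (N / b ^+ 2 + 16 * U / b * c k)%:E.
  have := energy_estimate1 (cpos k).
  have b2 : (0 <= b / 2)%R by rewrite divr_ge0// ltW.
  have le1 : \int[lebesgue_rV]_x (b / 2 * (cutoff (c k) x * usq x))%:E <=
      \int[lebesgue_rV]_x (b / 2 * (cutoff (c k) x * usq x) + 2^-1 * (cutoff (c k) x * gsq x))%:E.
    have k1 := rV_contM (@continuous_cutoff R n (c k)) cusq.
    have k2 := rV_contM (@continuous_cutoff R n (c k)) cgsq.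
    apply: ge0_le_integral => //.
    - by move=> x _; rewrite lee_fin mulr_ge0// mulr_ge0// cutoff_ge0.
    - apply/measurable_EFinP; apply: continuous_measurable_rV.
      exact: (rV_contM (@rV_cont_cst R n (b / 2)%R) k1).
    - apply/measurable_EFinP; apply: continuous_measurable_rV.
      exact: (rV_cont_pair (@rV_cont_cst R n (b / 2)%R) k1 (@rV_cont_cst R n 2^-1%R) k2).
    - by move=> x _; rewrite lee_fin lerDl mulr_ge0 ?invr_ge0// mulr_ge0// cutoff_ge0.
  move=> /(le_trans le1); under eq_integral do rewrite EFinM.
  rewrite ge0_integralZl ?lee_fin//; last first.
    by move=> x _; rewrite lee_fin mulr_ge0// cutoff_ge0.
  rewrite -lee_pdivlMl ?divr_gt0// => /le_trans; apply.
  rewrite -EFinM lee_fin le_eqVlt; apply/orP; left; apply/eqP.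
  by field; exact: lt0r_neq0.
have := lee_lim (cvgP _ cv) (cvgP _ cv2) (nearW _ le12).
rewrite (cvg_lim _ cv)// (cvg_lim _ cv2)// lee_fin.
by move=> /(_ _ _); rewrite ler_pdivlMr ?exprn_gt0// mulrC; apply.
Qed.

End energy_integrated.

(** * The free operator on smooth functions, in real and imaginary parts *)

Section smooth_functions.
Context {R : realType} (n : nat).
Implicit Types (u : 'rV[R]_n -> R[i]) (s : seq 'I_n).

Lemma Re_sum (I : Type) (r : seq I) (f : I -> R[i]) :
  complex.Re (\sum_(i <- r) f i) = \sum_(i <- r) complex.Re (f i).
Proof. by elim/big_ind2 : _ => // a b c d; rewrite ReD => -> ->. Qed.

Lemma Im_sum (I : Type) (r : seq I) (f : I -> R[i]) :
  complex.Im (\sum_(i <- r) f i) = \sum_(i <- r) complex.Im (f i).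
Proof. by elim/big_ind2 : _ => // a b c d; rewrite ImD => -> ->. Qed.

Lemma smooth_Re_partial u s i : smooth_on setT u ->
  is_partial i (fun x => complex.Re (pderives s u x))
               (fun x => complex.Re (pderives (i :: s) u x)).
Proof. by move=> su x; have [_ _ /(_ i)[dR dI]] := su s x Logic.I; split. Qed.

Lemma smooth_Im_partial u s i : smooth_on setT u ->
  is_partial i (fun x => complex.Im (pderives s u x))
               (fun x => complex.Im (pderives (i :: s) u x)).
Proof. by move=> su x; have [_ _ /(_ i)[dR dI]] := su s x Logic.I; split. Qed.

Lemma smooth_Re_continuous u s : smooth_on setT u ->
  continuous (fun x => complex.Re (pderives s u x)).
Proof. by move=> su x; have [] := su s x Logic.I. Qed.

Lemma smooth_Im_continuous u s : smooth_on setT u ->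
  continuous (fun x => complex.Im (pderives s u x)).
Proof. by move=> su x; have [] := su s x Logic.I. Qed.

Definition free_op u (x : 'rV[R]_n) : R[i] :=
  laplacian u x - 2 * (\sum_(i < n) (x ord0 i)%:C * pderive i u x).

Lemma diff_opE V u x : diff_op V u x = free_op u x + V (enorm x) * u x.
Proof. by []. Qed.

Lemma free_op_Re u x : complex.Re (free_op u x) =
  \sum_i (complex.Re (pderives [:: i; i] u x) -
          2 * x ord0 i * complex.Re (pderives [:: i] u x)).
Proof.
rewrite /free_op /laplacian (_ : 2 = (2 : R)%:C); last by rewrite rmorph_nat.
rewrite !ReImE !Re_sum Im_sum /= mul0r subr0 mulr_sumr -sumrB.
apply: eq_bigr => i _; congr (_ - _); by rewrite mul0r subr0 mulrA.
Qed.

Lemma free_op_Im u x : complex.Im (free_op u x) =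
  \sum_i (complex.Im (pderives [:: i; i] u x) -
          2 * x ord0 i * complex.Im (pderives [:: i] u x)).
Proof.
rewrite /free_op /laplacian (_ : 2 = (2 : R)%:C); last by rewrite rmorph_nat.
rewrite !ReImE !Im_sum Re_sum /= mul0r addr0 mulr_sumr -sumrB.
apply: eq_bigr => i _; congr (_ - _); by rewrite mul0r addr0 mulrA.
Qed.

Lemma enorm_sqr (x : 'rV[R]_n) : enorm x ^+ 2 = sqnorm x.
Proof. by rewrite /enorm sqr_sqrtr// sqnorm_ge0. Qed.

Lemma japanese_bound (C : R) (x : 'rV[R]_n) :
  C * japanese (enorm x) ^- 2 = C / (1 + sqnorm x).
Proof. by rewrite /japanese sqr_sqrtr ?enorm_sqr// addr_ge0// sqnorm_ge0. Qed.

End smooth_functions.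

(** * The a priori bound and the smallness of V u at high frequency *)

Section a_priori.
Context {R : realType} (n : nat).
Variables (b C : R) (V : R -> R[i]).
Hypotheses (b0 : 0 < b) (C0 : 0 <= C).
Hypothesis mV : cmeasurable_fun setT (fun x : 'rV[R]_n => V (enorm x)).
Hypothesis VC : forall r, 0 <= r -> normc (V r) <= C * japanese r ^- 2.

(** This [c] makes 4 C^2 c^2 |u|^2 at most |f|^2 / 8; C + 1 instead of C avoids dividing by 0. The
    constant [kap] is that of [energy_estimate2] after replacing U by its bound N / b^2. *)
Let c : R := b / (8 * (C + 1)).
Let kap : R := 2^-1 + (2^-1 + (2 * c + 1) / c) / b ^+ 2 +
  2 * (2 * c + 1) * ((2 * b)^-1 + 8 * c / b ^+ 2).

Let c0 : 0 < c. Proof. by rewrite divr_gt0// mulr_gt0// ltr_wpDl. Qed.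

Let kap0 : 0 <= kap.
Proof.
have h : 0 <= 2 * c + 1 by have := ltW c0; lra.
have b2 : 0 <= b ^+ 2 by exact: sqr_ge0.
have h1 : 0 <= (2 * c + 1) / c by rewrite divr_ge0// ltW.
have h2 : 0 <= (2^-1 + (2 * c + 1) / c) / b ^+ 2 by rewrite divr_ge0// addr_ge0// invr_ge0.
have h3 : 0 <= 8 * c / b ^+ 2 by rewrite divr_ge0// mulr_ge0// ltW.
have h4 : 0 <= (2 * b)^-1 by rewrite invr_ge0 mulr_ge0// ltW.
have h5 : 0 <= 2 * (2 * c + 1) * ((2 * b)^-1 + 8 * c / b ^+ 2).
  by rewrite mulr_ge0// ?mulr_ge0// addr_ge0.
rewrite /kap; lra.
Qed.

(** From here on 4 C^2 kap / w <= 1/8; adding 1 keeps w positive. *)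
Definition resolvent_threshold := 32 * C ^+ 2 * kap + 1.

(** The first bound is [energy_coercive]. For the second, [cutoff_dominates] splits |V|^2: the part
    carried by the cutoff gains 1/w from [energy_estimate2], the remainder is small by the choice of
    [c]. Each contributes at most |f|^2 / 8, so |V u|^2 <= |f|^2 / 4. *)
Lemma a_priori (w : R) (u : 'rV[R]_n -> R[i]) : resolvent_threshold <= w ->
  smooth_on setT u -> L2 lebesgue_rV u ->
  L2 lebesgue_rV (fun x => ((n%:R + b) +i* w) * u x - free_op u x) ->
  (b%:E * L2norm lebesgue_rV u <=
    L2norm lebesgue_rV (fun x => ((n%:R + b) +i* w) * u x - free_op u x)%R)%E /\
  (2%:E * L2norm lebesgue_rV (fun x => V (enorm x) * u x)%R <=
    L2norm lebesgue_rV (fun x => ((n%:R + b) +i* w) * u x - free_op u x)%R)%E.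
Proof.
move=> tw su Lu Lf; set f := fun x => _ - _.
have w0 : 0 < w.
  by apply: lt_le_trans tw; rewrite ltr_wpDl// !mulr_ge0// sqr_ge0.
have [mu Uoo] := (L2_energyP _ _).1 Lu; have [mf Noo] := (L2_energyP _ _).1 Lf.
pose U := fine (energy lebesgue_rV u); pose N := fine (energy lebesgue_rV f).
have eU : energy lebesgue_rV u = U%:E by rewrite fineK// ge0_fin_numE// energy_ge0.
have eN : energy lebesgue_rV f = N%:E by rewrite fineK// ge0_fin_numE// energy_ge0.
have U0 : 0 <= U by rewrite fine_ge0// energy_ge0.
have N0 : 0 <= N by rewrite fine_ge0// energy_ge0.
have hU : (\int[lebesgue_rV]_x (complex.Re (u x) ^+ 2 + complex.Im (u x) ^+ 2)%:E = U%:E)%E.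
  by rewrite -eU /energy; apply: eq_integral => x _; rewrite normc_sqr.
have hR s := @smooth_Re_continuous R n u s su; have hI s := @smooth_Im_continuous R n u s su.
have dR s i := @smooth_Re_partial R n u s i su; have dI s i := @smooth_Im_partial R n u s i su.
pose p1 i x := complex.Re (pderives [:: i] u x).
pose q1 i x := complex.Im (pderives [:: i] u x).
pose p2 i x := complex.Re (pderives [:: i; i] u x).
pose q2 i x := complex.Im (pderives [:: i; i] u x).
have hN : (\int[lebesgue_rV]_x
   (((n%:R + b) * complex.Re (u x) - w * complex.Im (u x) -
     \sum_i (p2 i x - 2 * x ord0 i * p1 i x)) ^+ 2 +
    ((n%:R + b) * complex.Im (u x) + w * complex.Re (u x) -
     \sum_i (q2 i x - 2 * x ord0 i * q1 i x)) ^+ 2)%:E = N%:E)%E.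
  rewrite -eN /energy; apply: eq_integral => x _; rewrite normc_sqr /f.
  by rewrite ReD ImD ReN ImN free_op_Re free_op_Im ReM ImM.
have D1 i := dR [::] i; have D2 i := dI [::] i.
have D3 i := dR [:: i] i; have D4 i := dI [:: i] i.
have coer := @energy_coercive R n _ _ p1 q1 p2 q2 b w U N b0 D1 D2 D3 D4
  (hR [::]) (hI [::]) (fun i => hR [:: i]) (fun i => hI [:: i])
  (fun i => hR [:: i; i]) (fun i => hI [:: i; i]) hU hN.
have est2 := @energy_estimate2 R n _ _ p1 q1 p2 q2 b w U N b0 D1 D2 D3 D4
  (hR [::]) (hI [::]) (fun i => hR [:: i]) (fun i => hI [:: i])
  (fun i => hR [:: i; i]) (fun i => hI [:: i; i]) hU hN c c0.
have UN : U <= N / b ^+ 2 by rewrite ler_pdivlMr ?exprn_gt0// mulrC.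
have nE (g : 'rV[R]_n -> R[i]) (e : R) : energy lebesgue_rV g = (e%:E)%E -> 0 <= e ->
    L2norm lebesgue_rV g = (Num.sqrt e)%:E.
  by move=> ge e0; rewrite L2normE ge poweR_EFin powR12_sqrt.
rewrite (nE _ _ eU U0) (nE _ _ eN N0); split.
  rewrite -EFinM lee_fin -[X in X * _]gtr0_norm// -sqrtr_sqr -sqrtrM ?sqr_ge0//.
  by rewrite ler_wsqrtr.
have eV : (energy lebesgue_rV (fun x => V (enorm x) * u x)%R <=
    (4 * C ^+ 2 / w * (kap * N) + 4 * C ^+ 2 * c ^+ 2 * U)%:E)%E.
  have mu2 : measurable_fun setT (fun x => normc (u x) ^+ 2) by exact: measurable_normc_sqr.
  have mphi : measurable_fun setT (@cutoff R n c).
    by apply: continuous_measurable_rV; exact: continuous_cutoff.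
  apply: (@le_trans _ _ (\int[lebesgue_rV]_x ((4 * C ^+ 2 / w)%:E * (w * (cutoff c x * normc (u x) ^+ 2))%:E +
      (4 * C ^+ 2 * c ^+ 2)%:E * (normc (u x) ^+ 2)%:E)%E)%E).
    apply: ge0_le_integral => //.
    - by move=> x _; rewrite lee_fin sqr_ge0.
    - by apply/measurable_EFinP/measurable_normc_sqr; exact: cmeasurableM.
    - apply: emeasurable_funD; apply: measurable_funeM; apply/measurable_EFinP => //.
      by apply: measurable_funM => //; exact: measurable_funM.
    - move=> x _; rewrite -!EFinM -EFinD lee_fin ComplexField.Normc.normcM exprMn.
      rewrite (_ : 4 * C ^+ 2 / w * _ = 4 * C ^+ 2 * cutoff c x * normc (u x) ^+ 2); last first.
        by field; exact: lt0r_neq0.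
      rewrite -mulrDl ler_wpM2r ?sqr_ge0//.
      have := VC (sqrtr_ge0 (\sum_i x ord0 i ^+ 2)); rewrite -/(enorm x) japanese_bound => hV.
      exact: (cutoff_dominates c (sqnorm_ge0 x) (normc_nneg _) hV).
  have a1 : 0 <= 4 * C ^+ 2 / w by exact: divr_ge0 (mulr_ge0 (ler0n _ 4) (sqr_ge0 C)) (ltW w0).
  have a2 : 0 <= 4 * C ^+ 2 * c ^+ 2 by exact: mulr_ge0 (mulr_ge0 (ler0n _ 4) (sqr_ge0 C)) (sqr_ge0 c).
  have a3 x : 0 <= w * (cutoff c x * normc (u x) ^+ 2).
    by exact: mulr_ge0 (ltW w0) (mulr_ge0 (cutoff_ge0 c x) (sqr_ge0 _)).
  have m3 : measurable_fun setT (fun x : 'rV[R]_n => (w * (cutoff c x * normc (u x) ^+ 2))%:E).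
    by apply/measurable_EFinP; apply: measurable_funM => //; exact: measurable_funM.
  have m4 : measurable_fun setT (fun x => (normc (u x) ^+ 2)%:E) by exact/measurable_EFinP.
  rewrite ge0_integralD//; last 4 first.
  - by move=> x _; rewrite mule_ge0 ?lee_fin.
  - exact: measurable_funeM.
  - by move=> x _; rewrite mule_ge0 ?lee_fin ?sqr_ge0.
  - exact: measurable_funeM.
  rewrite ge0_integralZl ?lee_fin//; last by move=> x _; rewrite lee_fin.
  rewrite ge0_integralZl ?lee_fin//; last by move=> x _; rewrite lee_fin sqr_ge0.
  rewrite -/(energy _ u) eU -EFinM EFinD leeD//.
  rewrite [leRHS]EFinM lee_wpmul2l ?lee_fin//.
  under eq_integral do rewrite normc_sqr.
  apply: (le_trans est2); rewrite lee_fin.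
  have c2 : 0 <= 2 * c + 1 by have := ltW c0; lra.
  have h1 : 0 <= 2^-1 + (2 * c + 1) / c by rewrite addr_ge0 ?invr_ge0// divr_ge0// ltW.
  have h2 : 0 <= 8 * c by rewrite mulr_ge0// ltW.
  rewrite (_ : kap * N = 2^-1 * N + (2^-1 + (2 * c + 1) / c) * (N / b ^+ 2) +
    2 * (2 * c + 1) * (N / (2 * b) + 8 * c * (N / b ^+ 2))); last first.
    by rewrite /kap; field; rewrite !gt_eqF.
  apply: lerD; first by apply: lerD => //; exact: ler_wpM2l.
  apply: ler_wpM2l; first by rewrite mulr_ge0.
  by apply: lerD => //; exact: ler_wpM2l.
have eV4 : (energy lebesgue_rV (fun x => V (enorm x) * u x)%R <= (N / 4)%:E)%E.
  apply: (le_trans eV); rewrite lee_fin.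
  have h1 : 4 * C ^+ 2 / w * (kap * N) <= N / 8.
    rewrite mulrAC ler_pdivrMr//.
    have : N * (32 * C ^+ 2 * kap) <= N * w by rewrite ler_wpM2l// (le_trans _ tw)// lerDl.
    by lra.
  have h2 : 4 * C ^+ 2 * c ^+ 2 * U <= N / 8.
    have C2 : C ^+ 2 * c ^+ 2 * 64 <= b ^+ 2.
      rewrite /c exprMn exprVn exprMn.
      rewrite (_ : _ * 64 = b ^+ 2 * (C ^+ 2 / (C + 1) ^+ 2)); last first.
        by field; rewrite gt_eqF// ltr_wpDl.
      rewrite ler_piMr ?sqr_ge0// ler_pdivrMr ?exprn_gt0 ?ltr_wpDl// mul1r.
      by rewrite ler_sqr ?nnegrE ?addr_ge0// lerDl.
    have := ler_wpM2r U0 C2; lra.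
  by lra.
have N4 : 0 <= Num.sqrt N / 2 by rewrite divr_ge0// sqrtr_ge0.
have : (L2norm lebesgue_rV (fun x => V (enorm x) * u x)%R <= (Num.sqrt N / 2)%:E)%E.
  rewrite L2norm_leP//; apply: (le_trans eV4); rewrite exprMn sqr_sqrtr// lee_fin.
  by rewrite exprVn -natrX.
move=> /(lee_wpmul2l (_ : (0 <= 2%:E)%E)) => /(_ _)/le_trans; apply; first by rewrite lee_fin.
by rewrite -EFinM lee_fin mulrCA divff ?mulr1.
Qed.

End a_priori.

(** * Polynomials times Gaussians *)

Section gaussian_class.
Context {R : realType} (n : nat).

Definition gaussian (a y : 'I_n -> R) (x : 'rV[R]_n) : R :=
  expR (- \sum_i (a i * (x ord0 i - y i) ^+ 2)).

(** Multiplication by coordinates is included because derivatives of Gaussians and the drift produce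
    it; with it the class is stable under L_0. Being inductive, it yields derivatives and decay
    bounds by structural induction. *)
Inductive gpoly : ('rV[R]_n -> R) -> Prop :=
| gpoly_gaussian a y : (forall i, 0 < a i) -> gpoly (gaussian a y)
| gpolyD f g : gpoly f -> gpoly g -> gpoly (fun x => f x + g x)
| gpolyZ c f : gpoly f -> gpoly (fun x => c * f x)
| gpoly_coord i f : gpoly f -> gpoly (fun x => x ord0 i * f x).

Lemma gpoly_ext f g : gpoly f -> f =1 g -> gpoly g.
Proof. by move=> gf /funext <-. Qed.

Lemma gpoly0 : gpoly (fun=> 0).
Proof.
apply: (@gpoly_ext (fun x => 0 * gaussian (fun=> 1) (fun=> 0) x)).
  by apply: gpolyZ; exact: gpoly_gaussian.
by move=> x; rewrite mul0r.
Qed.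

Lemma gpolyN f : gpoly f -> gpoly (fun x => - f x).
Proof. by move=> gf; apply: (gpoly_ext (gpolyZ (-1) gf)) => x; rewrite mulN1r. Qed.

Lemma gpolyB f g : gpoly f -> gpoly g -> gpoly (fun x => f x - g x).
Proof. by move=> gf gg; apply: gpolyD => //; exact: gpolyN. Qed.

Lemma gpoly_sum (I : Type) (r : seq I) (f : I -> 'rV[R]_n -> R) :
  (forall k, gpoly (f k)) -> gpoly (fun x => \sum_(k <- r) f k x).
Proof.
move=> gf; elim: r => [|k r ih].
  by apply: (gpoly_ext gpoly0) => x; rewrite big_nil.
by apply: (gpoly_ext (gpolyD (gf k) ih)) => x; rewrite big_cons.
Qed.

Lemma continuous_gaussian a y : continuous (gaussian a y).
Proof.
move=> x; apply: (@continuous_comp _ _ _ (fun x : 'rV[R]_n => - \sum_i (a i * (x ord0 i - y i) ^+ 2)) expR).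
  apply: rV_contN; apply: rV_cont_sum => i.
  under eq_fun do rewrite expr2.
  have h := rV_contB (@rV_cont_coord R n i) (@rV_cont_cst R n (y i)).
  exact: (rV_contM (@rV_cont_cst R n (a i)) (rV_contM h h)).
exact: continuous_expR.
Qed.

Lemma gpoly_continuous f : gpoly f -> continuous f.
Proof.
elim=> {f} [a y _|f g _ cf _ cg|c f _ cf|i f _ cf].
- exact: continuous_gaussian.
- exact: rV_contD.
- exact: (rV_contM (@rV_cont_cst R n c) cf).
- exact: (rV_contM (@rV_cont_coord R n i) cf).
Qed.

Lemma gaussian_partial a y i : is_partial i (gaussian a y)
  (fun x => (2 * a i * y i) * gaussian a y x + (- (2 * a i)) * (x ord0 i * gaussian a y x)).
Proof.
have H (k : 'I_n) := is_partialB (is_partial_coord i k) (is_partial_cst i (y k)).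
have H2 k := is_partialM (is_partial_cst i (a k)) (is_partialM (H k) (H k)).
have H3 := is_partial_comp (is_derive_expR (R := R)) (is_partialN (is_partial_sum (index_enum 'I_n) H2)).
apply: (is_partial_ext H3) => x.
  by rewrite /gaussian; congr (expR (- _)); apply: eq_bigr => k _; rewrite expr2.
have -> : expR (- (\sum_(k : 'I_n) a k * ((x ord0 k - y k) * (x ord0 k - y k)))) = gaussian a y x.
  by rewrite /gaussian; congr (expR (- _)); apply: eq_bigr => k _; rewrite expr2.
rewrite (bigD1 i)//= big1 => [|k ki]; first by rewrite eqxx mulr1n; ring.
by rewrite eq_sym (negbTE ki) mulr0n; ring.
Qed.

Lemma gpoly_partial f i : gpoly f -> exists2 df, gpoly df & is_partial i f df.
Proof.
elim=> {f} [a y a0|f g gf [df gdf Df] gg [dg gdg Dg]|c f gf [df gdf Df]|j f gf [df gdf Df]].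
- exists (fun x => (2 * a i * y i) * gaussian a y x + (- (2 * a i)) * (x ord0 i * gaussian a y x)).
    by apply: gpolyD; apply: gpolyZ; [|apply: gpoly_coord]; exact: gpoly_gaussian.
  exact: gaussian_partial.
- by exists (fun x => df x + dg x); [exact: gpolyD|exact: is_partialD].
- exists (fun x => c * df x); first exact: gpolyZ.
  by apply: (is_partial_ext (is_partialM (is_partial_cst i c) Df)) => x//; rewrite mul0r add0r.
- exists (fun x => (i == j)%:R * f x + x ord0 j * df x).
    by apply: gpolyD; [exact: gpolyZ|exact: gpoly_coord].
  exact: is_partialM (is_partial_coord i j) Df.
Qed.

(** The inverse of 1 + sum 1/a_i is below every a_i and makes sense for an empty family too. *)
Lemma pos_lower_bound (a : 'I_n -> R) : (forall i, 0 < a i) ->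
  exists2 c, 0 < c & forall i, c <= a i.
Proof.
move=> a0; exists (1 + \sum_i (a i)^-1)^-1.
  by rewrite invr_gt0 ltr_wpDr// sumr_ge0// => i _; rewrite invr_ge0 ltW.
move=> i; rewrite -[leRHS]invrK lef_pV2 ?posrE ?invr_gt0//; last first.
  by rewrite ltr_wpDr// sumr_ge0// => j _; rewrite invr_ge0 ltW.
rewrite (bigD1 i)//= addrCA lerDl addr_ge0// sumr_ge0// => j _.
by rewrite invr_ge0 ltW.
Qed.

(** The identity a (x - y)^2 = a x^2 / 2 - a y^2 + (a / 2) (x - 2 y)^2 recentres the Gaussian at the
    origin and costs half of its rate. *)
Lemma gaussian_bound a y : (forall i, 0 < a i) -> exists C c : R,
  [/\ 0 <= C, 0 < c & forall x, gaussian a y x <= C * expR (- (c * sqnorm x))].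
Proof.
move=> a0; have [c c0 ca] := pos_lower_bound a0.
exists (expR (\sum_i a i * y i ^+ 2)), (c / 2); split; rewrite ?expR_ge0 ?divr_gt0// => x.
rewrite /gaussian -expRD ler_expR.
suff : c / 2 * sqnorm x <= \sum_i a i * y i ^+ 2 + \sum_i a i * (x ord0 i - y i) ^+ 2 by lra.
rewrite /sqnorm mulr_sumr -big_split/=.
apply: ler_sum => i _; rewrite -subr_ge0.
have h1 : 0 <= (a i - c) * x ord0 i ^+ 2 by rewrite mulr_ge0 ?sqr_ge0// subr_ge0.
have h2 : 0 <= a i * (x ord0 i - 2 * y i) ^+ 2 by rewrite mulr_ge0 ?sqr_ge0// ltW.
lra.
Qed.

(** A coordinate factor is paid for with half of the Gaussian rate. *)
Lemma coord_expR_le (c : R) (x : 'rV[R]_n) i : 0 < c ->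
  `|x ord0 i| <= (1 + 2 / c) * expR (c / 2 * sqnorm x).
Proof.
move=> c0.
have h : `|x ord0 i| <= 1 + sqnorm x.
  have : x ord0 i ^+ 2 <= sqnorm x.
    by rewrite /sqnorm (bigD1 i)//= lerDl sumr_ge0// => j _; exact: sqr_ge0.
  rewrite -real_normK ?num_real//; have := normr_ge0 (x ord0 i).
  move: `|_| => t t0; nra.
apply: (le_trans h); have := expR_ge1Dx (c / 2 * sqnorm x).
have c2 : 0 <= 1 + 2 / c by rewrite addr_ge0// divr_ge0// ltW.
move=> /(ler_wpM2l c2); apply: le_trans.
rewrite mulrDr mulr1 (_ : (1 + 2 / c) * _ = c / 2 * sqnorm x + sqnorm x); last first.
  by field; exact: lt0r_neq0.
have h1 : 0 <= c / 2 * sqnorm x by rewrite mulr_ge0 ?sqnorm_ge0// divr_ge0// ltW.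
have h2 : 0 <= 2 / c by rewrite divr_ge0// ltW.
lra.
Qed.

Lemma gpoly_bound f : gpoly f -> exists C c : R,
  [/\ 0 <= C, 0 < c & forall x, `|f x| <= C * expR (- (c * sqnorm x))].
Proof.
elim=> {f} [a y a0|f g gf [C [c [C0 c0 h]]] gg [C' [c' [C'0 c'0 h']]]
  |k f gf [C [c [C0 c0 h]]]|i f gf [C [c [C0 c0 h]]]].
- have [C [c [C0 c0 h]]] := gaussian_bound y a0.
  by exists C, c; split => // x; rewrite ger0_norm ?expR_ge0.
- exists (C + C'), (Num.min c c'); split; rewrite ?addr_ge0 ?lt_min ?c0// => x.
  apply: (le_trans (ler_normD _ _)); rewrite mulrDl; apply: lerD.
    apply: (le_trans (h x)); rewrite ler_wpM2l// ler_expR lerN2 ler_wpM2r ?sqnorm_ge0//.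
    by rewrite ge_min lexx.
  apply: (le_trans (h' x)); rewrite ler_wpM2l// ler_expR lerN2 ler_wpM2r ?sqnorm_ge0//.
  by rewrite ge_min lexx orbT.
- exists (`|k| * C), c; split; rewrite ?mulr_ge0// => x.
  by rewrite normrM -mulrA ler_wpM2l.
- exists ((1 + 2 / c) * C), (c / 2).
  have c2 : 0 <= 1 + 2 / c by rewrite addr_ge0// divr_ge0// ltW.
  split; rewrite ?mulr_ge0 ?divr_gt0// => x; rewrite normrM.
  apply: (le_trans (ler_pM (normr_ge0 _) (normr_ge0 _) (coord_expR_le x i c0) (h x))).
  rewrite mulrACA ler_wpM2l ?mulr_ge0// -expRD ler_expR.
  by lra.
Qed.

Lemma gaussian_sq_integral (C c : R) : 0 < c ->
  (\int[lebesgue_rV]_(x in [set: 'rV[R]_n]) ((C * expR (- (c * sqnorm x))) ^+ 2)%:E < +oo)%E.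
Proof.
move=> c0.
have -> : (fun x : 'rV[R]_n => ((C * expR (- (c * sqnorm x))) ^+ 2)%:E) =
    (fun x => (C ^+ 2)%:E * (gaussian (fun=> 2 * c) (fun=> 0) x)%:E)%E.
  apply/funext => x; rewrite -EFinM exprMn; congr (_ * _)%:E.
  rewrite /gaussian expr2 -expRD; congr expR.
  rewrite /sqnorm -opprD -mulrDl mulr_sumr.
  by congr (- _); apply: eq_bigr => i _; rewrite subr0; ring.
rewrite ge0_integralZl ?lee_fin ?sqr_ge0//; last 2 first.
- by apply/measurable_EFinP; apply: continuous_measurable_rV; exact: continuous_gaussian.
- by move=> x _; rewrite lee_fin expR_ge0.
rewrite /gaussian integral_gauss_prod; last by move=> i; rewrite mulr_gt0.
by rewrite -EFinM ltry.
Qed.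

End gaussian_class.

(** * Complex-valued polynomials times Gaussians *)

Section complex_gaussian_class.
Context {R : realType} (n : nat).
Implicit Types (u v : 'rV[R]_n -> R[i]).

Definition cgpoly u := gpoly (fun x => complex.Re (u x)) /\
                       gpoly (fun x => complex.Im (u x)).

Lemma cgpoly_measurable u : cgpoly u -> cmeasurable_fun setT u.
Proof.
by move=> [gR gI]; split; apply: continuous_measurable_rV; exact: gpoly_continuous.
Qed.

Lemma cgpoly_L2 u : cgpoly u -> L2 lebesgue_rV u.
Proof.
move=> gu; apply/L2_energyP; split; first exact: cgpoly_measurable.
have [C [c [C0 c0 hR]]] := gpoly_bound gu.1.
have [C' [c' [C'0 c'0 hI]]] := gpoly_bound gu.2.
have mg (C1 c1 : R) : measurable_fun setT (fun x : 'rV[R]_n => ((C1 * expR (- (c1 * sqnorm x))) ^+ 2)%:E).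
  apply/measurable_EFinP; apply: measurable_funX; apply: measurable_funM => //.
  apply: measurableT_comp => //; apply: measurableT_comp => //; apply: measurable_funM => //.
  by apply: continuous_measurable_rV; exact: continuous_sqnorm.
apply: (@le_lt_trans _ _ (\int[lebesgue_rV]_x (((C * expR (- (c * sqnorm x))) ^+ 2)%:E +
   ((C' * expR (- (c' * sqnorm x))) ^+ 2)%:E)%E)%E).
  apply: ge0_le_integral => //.
  - by move=> x _; rewrite lee_fin sqr_ge0.
  - by apply/measurable_EFinP/measurable_normc_sqr; exact: cgpoly_measurable.
  - exact: emeasurable_funD.
  - move=> x _; rewrite -EFinD lee_fin normc_sqr; apply: lerD.
      by rewrite -real_normK ?num_real// ler_sqr ?nnegrE// (le_trans (normr_ge0 _) (hR x)).
    by rewrite -real_normK ?num_real// ler_sqr ?nnegrE// (le_trans (normr_ge0 _) (hI x)).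
rewrite ge0_integralD//.
- by rewrite lte_add_pinfty// gaussian_sq_integral.
- by move=> x _; rewrite lee_fin sqr_ge0.
- by move=> x _; rewrite lee_fin sqr_ge0.
Qed.

Lemma cgpolyD u v : cgpoly u -> cgpoly v -> cgpoly (fun x => u x + v x).
Proof.
move=> [uR uI] [vR vI]; split.
- by apply: (gpoly_ext (gpolyD uR vR)) => x; rewrite ReD.
- by apply: (gpoly_ext (gpolyD uI vI)) => x; rewrite ImD.
Qed.

Lemma cgpolyZ (c : R[i]) u : cgpoly u -> cgpoly (fun x => c * u x).
Proof.
move=> [uR uI]; split.
- apply: (gpoly_ext (gpolyB (gpolyZ (complex.Re c) uR) (gpolyZ (complex.Im c) uI))) => x.
  by rewrite ReM.
- apply: (gpoly_ext (gpolyD (gpolyZ (complex.Re c) uI) (gpolyZ (complex.Im c) uR))) => x.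
  by rewrite ImM.
Qed.

Lemma cgpoly_pderive u i : cgpoly u ->
  [/\ cgpoly (pderive i u),
      is_partial i (fun x => complex.Re (u x)) (fun x => complex.Re (pderive i u x)) &
      is_partial i (fun x => complex.Im (u x)) (fun x => complex.Im (pderive i u x))].
Proof.
move=> [/(gpoly_partial i)[df gdf Df] /(gpoly_partial i)[dg gdg Dg]].
have eR : df = (fun x => complex.Re (pderive i u x)).
  by apply/funext => x /=; have [_ ->] := Df x.
have eI : dg = (fun x => complex.Im (pderive i u x)).
  by apply/funext => x /=; have [_ ->] := Dg x.
by split; rewrite -?eR -?eI//; split; rewrite -?eR -?eI.
Qed.

Lemma cgpoly_pderives u s : cgpoly u -> cgpoly (pderives s u).
Proof. by move=> gu; elim: s => //= i s /(cgpoly_pderive i)[]. Qed.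

Lemma cgpoly_smooth u : cgpoly u -> smooth_on setT u.
Proof.
move=> gu s x _; have gs := cgpoly_pderives s gu; split.
- exact: (gpoly_continuous gs.1).
- exact: (gpoly_continuous gs.2).
- move=> i; have [_ h1 h2] := cgpoly_pderive i gs.
  by split; [case: (h1 x)|case: (h2 x)].
Qed.

Lemma cgpoly_free_op u : cgpoly u -> cgpoly (free_op u).
Proof.
move=> gu; split.
- apply: (@gpoly_ext _ _ (fun x => \sum_i (complex.Re (pderives [:: i; i] u x) -
      2 * (x ord0 i * complex.Re (pderives [:: i] u x))))); last first.
    by move=> x; rewrite free_op_Re; apply: eq_bigr => i _; rewrite mulrA.
  apply: gpoly_sum => i; apply: gpolyB; first exact: (cgpoly_pderives [:: i; i] gu).1.
  by apply: gpolyZ; apply: gpoly_coord; exact: (cgpoly_pderives [:: i] gu).1.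
- apply: (@gpoly_ext _ _ (fun x => \sum_i (complex.Im (pderives [:: i; i] u x) -
      2 * (x ord0 i * complex.Im (pderives [:: i] u x))))); last first.
    by move=> x; rewrite free_op_Im; apply: eq_bigr => i _; rewrite mulrA.
  apply: gpoly_sum => i; apply: gpolyB; first exact: (cgpoly_pderives [:: i; i] gu).2.
  by apply: gpolyZ; apply: gpoly_coord; exact: (cgpoly_pderives [:: i] gu).2.
Qed.

End complex_gaussian_class.

(** * Weak derivatives of smooth functions, and linearity of the free operator *)

Section weak_derivatives.
Context {R : realType} (n : nat).
Implicit Types (u v phi : 'rV[R]_n -> R[i]).

Lemma Rintegral_by_parts (i : 'I_n) (r : R) (g A B : 'rV[R]_n -> R) :
  is_partial i g (fun x => A x + B x) -> continuous A -> continuous B ->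
  rV_supported r g -> rV_supported r A -> rV_supported r B ->
  Rintegral lebesgue_rV setT A = - Rintegral lebesgue_rV setT B.
Proof.
move=> Dg cA cB sg sA sB; apply/eqP; rewrite -addr_eq0; apply/eqP.
have iA := rV_supported_integrable cA sA; have iB := rV_supported_integrable cB sB.
rewrite -RintegralD// /Rintegral (integral_partial0 Dg _ sg)//.
- exact: rV_contD.
- by move=> x hx; rewrite sA// sB// addr0.
Qed.

Definition crV_supported (r : R) u := forall x : 'rV[R]_n, (exists j, r <= `|x ord0 j|) -> u x = 0.

(** The margin 1 makes u vanish on a whole neighbourhood of the point, hence also its
    derivatives. *)
Lemma crV_supported_pderive r u i : crV_supported r u -> crV_supported (r + 1) (pderive i u).
Proof.
move=> su x [j hj].
have nb : \forall y \near x, u y = 0.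
  near=> y; apply: su; exists j.
  have : `|(x - y) ord0 j| < 1.
    apply: (le_lt_trans (norm_coord_le _ _)).
    by near: y; apply/nbhs_ballP; exists 1 => //= y; rewrite mx_norm_ball /ball_.
  rewrite !mxE => h; have := lerB_dist (x ord0 j) (y ord0 j).
  by move: h hj; set a := `|_ - _|; lra.
apply: complex_eq => /=.
- rewrite (@near_eq_derive _ _ _ _ (fun=> 0 : R) x (basis_vec i))//.
    by rewrite derive_cst.
  by apply: filterS nb => y ->.
- rewrite (@near_eq_derive _ _ _ _ (fun=> 0 : R) x (basis_vec i))//.
    by rewrite derive_cst.
  by apply: filterS nb => y ->.
Unshelve. all: by end_near. Qed.

Lemma crV_supported_pderives r u s : crV_supported r u ->
  crV_supported (r + (size s)%:R) (pderives s u).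
Proof.
move=> su; elim: s => [|i s ih] /=; first by rewrite addr0.
by rewrite -natr1 addrA; exact: crV_supported_pderive.
Qed.

Lemma test_function_supported phi : test_function phi -> exists r, crV_supported r phi.
Proof.
move=> [sphi /compact_bounded[M [_ hM]]].
exists (`|M| + 2) => x [j hj]; apply/eqP/negPn/negP => px.
have : `|x| <= `|M| + 1.
  apply: hM; first by rewrite (le_lt_trans (ler_norm _))// ltrDl.
  by apply: subset_closure.
by have := norm_coord_le x j; lra.
Qed.

Lemma cintegral_by_parts (i : 'I_n) r u phi : smooth_on setT u -> smooth_on setT phi ->
  crV_supported r phi ->
  cintegral lebesgue_rV (fun x => u x * pderive i phi x) =
  - cintegral lebesgue_rV (fun x => pderive i u x * phi x).
Proof.
move=> su sp cp.
have cp1 := crV_supported_pderive i cp.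
have cp0 : crV_supported (r + 1) phi.
  by move=> x [j hj]; apply: cp; exists j; apply: le_trans hj; rewrite lerDl.
have uR s := @smooth_Re_continuous R n u s su; have uI s := @smooth_Im_continuous R n u s su.
have pR s := @smooth_Re_continuous R n phi s sp; have pI s := @smooth_Im_continuous R n phi s sp.
have DuR := @smooth_Re_partial R n u [::] i su; have DuI := @smooth_Im_partial R n u [::] i su.
have DpR := @smooth_Re_partial R n phi [::] i sp; have DpI := @smooth_Im_partial R n phi [::] i sp.
have sP (f : R[i] -> R) (g : 'rV[R]_n -> R) : f 0 = 0 ->
    rV_supported (r + 1) (fun x => g x * f (phi x)).
  by move=> f0 x /cp0 ->; rewrite f0 mulr0.
have sP1 (f : R[i] -> R) (g : 'rV[R]_n -> R) : f 0 = 0 ->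
    rV_supported (r + 1) (fun x => g x * f (pderive i phi x)).
  by move=> f0 x /cp1 ->; rewrite f0 mulr0.
have sB (f g : 'rV[R]_n -> R) : rV_supported (r + 1) f -> rV_supported (r + 1) g ->
    rV_supported (r + 1) (fun x => f x - g x).
  by move=> sf sg x hx; rewrite sf// sg// subr0.
have sD (f g : 'rV[R]_n -> R) : rV_supported (r + 1) f -> rV_supported (r + 1) g ->
    rV_supported (r + 1) (fun x => f x + g x).
  by move=> sf sg x hx; rewrite sf// sg// addr0.
rewrite /cintegral; apply: complex_eq => /=.
- under eq_Rintegral do rewrite ReM; under [in RHS]eq_Rintegral do rewrite ReM.
  apply: (@Rintegral_by_parts i (r + 1)
    (fun x => complex.Re (u x) * complex.Re (phi x) - complex.Im (u x) * complex.Im (phi x))).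
  + apply: (is_partial_ext (is_partialB (is_partialM DuR DpR) (is_partialM DuI DpI))) => x //=.
    by ring.
  + exact: (rV_contB (rV_contM (uR [::]) (pR [:: i])) (rV_contM (uI [::]) (pI [:: i]))).
  + exact: (rV_contB (rV_contM (uR [:: i]) (pR [::])) (rV_contM (uI [:: i]) (pI [::]))).
  + by apply: sB; exact: sP.
  + by apply: sB; exact: sP1.
  + by apply: sB; exact: sP.
- under eq_Rintegral do rewrite ImM; under [in RHS]eq_Rintegral do rewrite ImM.
  apply: (@Rintegral_by_parts i (r + 1)
    (fun x => complex.Re (u x) * complex.Im (phi x) + complex.Im (u x) * complex.Re (phi x))).
  + apply: (is_partial_ext (is_partialD (is_partialM DuR DpI) (is_partialM DuI DpR))) => x //=.
    by ring.
  + exact: (rV_contD (rV_contM (uR [::]) (pI [:: i])) (rV_contM (uI [::]) (pR [:: i]))).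
  + exact: (rV_contD (rV_contM (uR [:: i]) (pI [::])) (rV_contM (uI [:: i]) (pR [::]))).
  + by apply: sD; exact: sP.
  + by apply: sD; exact: sP1.
  + by apply: sD; exact: sP.
Qed.

Lemma pderives_cat s t u : pderives (s ++ t) u = pderives s (pderives t u).
Proof. by rewrite /pderives foldr_cat. Qed.

Lemma smooth_pderives u s : smooth_on setT u -> smooth_on setT (pderives s u).
Proof.
move=> su t x tx; have [h1 h2 h3] := su (t ++ s) x tx.
by rewrite pderives_cat in h1 h2 h3; split.
Qed.

(** Each integration by parts removes the outermost derivative from the test function and applies it
    first to u; the order is therefore reversed, and no symmetry of mixed derivatives is invoked. *)
Lemma smooth_weak_pderives u s : smooth_on setT u ->
  weak_pderives s u (pderives (rev s) u).
Proof.
move=> su phi tphi; have [r sr] := test_function_supported tphi.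
elim: s u su => [|i s ih] u su; first by rewrite expr0 mul1r.
have sp := smooth_pderives s tphi.1.
rewrite [pderives (i :: s) phi]/(pderive i (pderives s phi)).
rewrite (cintegral_by_parts i su sp (@crV_supported_pderives r phi s sr)).
rewrite ih; last exact: (smooth_pderives [:: i] su).
by rewrite rev_cons -cats1 pderives_cat exprS mulN1r mulNr.
Qed.

Lemma cgpoly_sobolev k u : cgpoly u -> sobolev k u.
Proof.
move=> gu; split=> [|s _]; first exact: cgpoly_L2.
exists (pderives (rev s) u); first by apply: cgpoly_L2; exact: cgpoly_pderives.
exact: smooth_weak_pderives (cgpoly_smooth gu).
Qed.

Lemma pderiveD i u v : cgpoly u -> cgpoly v ->
  pderive i (fun x => u x + v x) = (fun x => pderive i u x + pderive i v x).
Proof.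
move=> /(cgpoly_pderive i)[_ uR uI] /(cgpoly_pderive i)[_ vR vI].
apply/funext => x; apply: complex_eq; rewrite ?ReD ?ImD /=.
- rewrite (_ : (fun y => complex.Re (u y + v y)) =
    (fun y => complex.Re (u y) + complex.Re (v y))); last by apply/funext => y; rewrite ReD.
  by have [_ ->] := is_partialD uR vR x.
- rewrite (_ : (fun y => complex.Im (u y + v y)) =
    (fun y => complex.Im (u y) + complex.Im (v y))); last by apply/funext => y; rewrite ImD.
  by have [_ ->] := is_partialD uI vI x.
Qed.

Lemma pderiveZ i (c : R[i]) u : cgpoly u ->
  pderive i (fun x => c * u x) = (fun x => c * pderive i u x).
Proof.
move=> /(cgpoly_pderive i)[_ uR uI].
have cR (k : R) := is_partialM (is_partial_cst (R := R) (n := n) i k) uR.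
have cI (k : R) := is_partialM (is_partial_cst (R := R) (n := n) i k) uI.
apply/funext => x; apply: complex_eq; rewrite ?ReM ?ImM /=.
- rewrite (_ : (fun y => complex.Re (c * u y)) =
    (fun y => complex.Re c * complex.Re (u y) - complex.Im c * complex.Im (u y))); last first.
    by apply/funext => y; rewrite ReM.
  by have [_ ->] := is_partialB (cR (complex.Re c)) (cI (complex.Im c)) x; rewrite !mul0r !add0r.
- rewrite (_ : (fun y => complex.Im (c * u y)) =
    (fun y => complex.Re c * complex.Im (u y) + complex.Im c * complex.Re (u y))); last first.
    by apply/funext => y; rewrite ImM.
  by have [_ ->] := is_partialD (cI (complex.Re c)) (cR (complex.Im c)) x; rewrite !mul0r !add0r.
Qed.

Lemma free_opD u v : cgpoly u -> cgpoly v ->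
  free_op (fun x => u x + v x) = (fun x => free_op u x + free_op v x).
Proof.
move=> gu gv; apply/funext => x; rewrite /free_op.
rewrite [RHS]addrACA -opprD -mulrDr.
congr (_ - _ * _); rewrite -[RHS]big_split; apply: eq_bigr => i _; last first.
  by rewrite pderiveD// mulrDr.
have [gu' _ _] := cgpoly_pderive i gu; have [gv' _ _] := cgpoly_pderive i gv.
by rewrite /pderives/= pderiveD// pderiveD.
Qed.

Lemma free_opZ (c : R[i]) u : cgpoly u ->
  free_op (fun x => c * u x) = (fun x => c * free_op u x).
Proof.
move=> gu; apply/funext => x; rewrite /free_op.
rewrite mulrBr (mulrCA c) /laplacian !mulr_sumr.
congr (_ - _); apply: eq_bigr => i _; last by rewrite pderiveZ// (mulrCA c).
have [gu' _ _] := cgpoly_pderive i gu.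
by rewrite /pderives/= pderiveZ// pderiveZ.
Qed.

End weak_derivatives.

(** * Differentiation rules in one variable *)

Section line_calculus.
Context {R : realType}.
Implicit Types (f g : R -> R) (t a b : R).

Lemma line_deriveD f g t a b : is_derive t 1 f a -> is_derive t 1 g b ->
  is_derive t 1 (fun s => f s + g s) (a + b).
Proof. by move=> hf hg; exact: is_deriveD. Qed.

Lemma line_deriveM f g t a b : is_derive t 1 f a -> is_derive t 1 g b ->
  is_derive t 1 (fun s => f s * g s) (a * g t + f t * b).
Proof.
move=> hf hg; apply: (is_derive_eq (is_deriveM hf hg)).
by rewrite addrC; congr (_ + _); rewrite -[LHS]/(_ * _) mulrC.
Qed.

Lemma line_deriveZ c f t a : is_derive t 1 f a ->
  is_derive t 1 (fun s => c * f s) (c * a).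
Proof.
move=> hf; apply: (is_derive_eq (line_deriveM (is_derive_cst c t 1) hf)).
by rewrite mul0r add0r.
Qed.

Lemma line_derive_scale c t : is_derive t 1 (fun s => c * s) c.
Proof.
by apply: (is_derive_eq (line_deriveZ c (is_derive_id t 1))); rewrite mulr1.
Qed.

Lemma line_derive_sum (I : Type) (r : seq I) (f : I -> R -> R) t (a : I -> R) :
  (forall i, is_derive t 1 (f i) (a i)) ->
  is_derive t 1 (fun s => \sum_(i <- r) f i s) (\sum_(i <- r) a i).
Proof.
move=> h; elim: r => [|i r ih].
  rewrite big_nil (_ : (fun _ => _) = (fun=> 0)); first exact: is_derive_cst.
  by apply/funext => s; rewrite big_nil.
rewrite big_cons (_ : (fun _ => _) = (fun s => f i s + \sum_(j <- r) f j s)).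
  exact: line_deriveD.
by apply/funext => s; rewrite big_cons.
Qed.

Lemma line_derive_expR f t a : is_derive t 1 f a ->
  is_derive t 1 (fun s => expR (f s)) (expR (f t) * a).
Proof. by move=> hf; exact: (is_derive1_comp (is_derive_expR _) hf). Qed.

End line_calculus.

(** * The flow of L_0 on Gaussians *)

Section gaussian_flow.
Context {R : realType} (n : nat).
Variables (mu : R) (a y : 'I_n -> R).
Hypothesis a0 : forall i, 0 < a i.

(** The solution of alpha' = -4 alpha (alpha + 1) with alpha(0) = a, found from the fact that alpha
    / (alpha + 1) decays like e^(-4 t). The center obeys beta' = 2 beta. *)
Definition flow_rate i (t : R) := a i / ((1 + a i) * expR (4 * t) - a i).
Definition flow_center i (t : R) := y i * expR (2 * t).

(* The solution at time t of u' = Delta u - 2 x . grad u - mu u issued from a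
   multiple of [gaussian a y]. *)
Definition flow (t : R) (x : 'rV[R]_n) :=
  expR (- mu * t + \sum_i (2 * t + ln (flow_rate i t) / 2 -
    flow_rate i t * (x ord0 i - flow_center i t) ^+ 2)).

(** The logarithmic time derivative of [flow]. Its sum is also L_0 of the Gaussian divided by the
    Gaussian, which is why [flow] solves the equation. *)
Definition flow_drift (t : R) (x : 'rV[R]_n) := - mu + \sum_i
  (- 2 * flow_rate i t +
   4 * flow_rate i t * (flow_rate i t + 1) * (x ord0 i - flow_center i t) ^+ 2 +
   4 * flow_rate i t * flow_center i t * (x ord0 i - flow_center i t)).

Let den_ge i (t : R) : 0 <= t -> expR (4 * t) <= (1 + a i) * expR (4 * t) - a i.
Proof.
move=> t0; have := @a0 i; have : 1 <= expR (4 * t) by rewrite -expR0 ler_expR mulr_ge0.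
by move: (expR _) => e; nra.
Qed.

Let den_gt0 i (t : R) : 0 <= t -> 0 < (1 + a i) * expR (4 * t) - a i.
Proof. by move=> t0; exact: lt_le_trans (expR_gt0 _) (den_ge i t0). Qed.

Lemma flow_rate_gt0 i (t : R) : 0 <= t -> 0 < flow_rate i t.
Proof. by move=> t0; rewrite divr_gt0// den_gt0. Qed.

Lemma flow_rate_le i (t : R) : 0 <= t -> flow_rate i t <= a i * expR (- (4 * t)).
Proof.
move=> t0; rewrite expRN ler_wpM2l ?(ltW (@a0 i))// lef_pV2 ?posrE ?expR_gt0 ?den_gt0//.
exact: den_ge.
Qed.

Lemma flow_rate_nonincreasing i (s t : R) : 0 <= s -> s <= t -> flow_rate i t <= flow_rate i s.
Proof.
move=> s0 st; rewrite ler_wpM2l ?(ltW (@a0 i))// lef_pV2 ?posrE ?den_gt0// ?(le_trans s0)//.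
rewrite lerB// ler_wpM2l ?ler_expR ?ler_wpM2l//.
by rewrite addr_ge0// (ltW (@a0 i)).
Qed.

Lemma flow_rate0 i : flow_rate i 0 = a i.
Proof. by rewrite /flow_rate mulr0 expR0 mulr1 addrK divr1. Qed.

Lemma flow_rate_derive i (t : R) : 0 <= t ->
  is_derive t 1 (flow_rate i) (- 4 * flow_rate i t * (flow_rate i t + 1)).
Proof.
move=> t0; have d0 := lt0r_neq0 (den_gt0 i t0).
have h1 := line_deriveZ (1 + a i) (line_derive_expR (line_derive_scale 4 t)).
have h2 := line_deriveD h1 (is_derive_cst (- a i) t 1).
have h3 := line_deriveZ (a i) (@is_deriveV _ (fun s => (1 + a i) * expR (4 * s) - a i) _ _ _ d0 h2).
apply: (is_derive_eq h3).
rewrite /flow_rate -[X in a i * X]/(_ * _) addr0.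
set d := _ - a i in d0 *; have -> : (1 + a i) * (expR (4 * t) * 4) = 4 * (d + a i).
  by rewrite /d; ring.
by field.
Qed.

Lemma flow_derive (t : R) x : 0 <= t ->
  is_derive t 1 (flow ^~ x) (flow t x * flow_drift t x).
Proof.
move=> t0; have da i := flow_rate_derive i t0.
have a1 i := flow_rate_gt0 i t0.
have dc i := line_deriveZ (y i) (line_derive_expR (line_derive_scale 2 t)).
have dl i := line_deriveZ 2^-1 (is_derive1_comp (is_derive1_ln (a1 i)) (da i)).
have dx i := line_deriveD (is_derive_cst (x ord0 i) t 1) (line_deriveZ (-1) (dc i)).
have dq i := line_deriveZ (-1) (line_deriveM (da i) (line_deriveM (dx i) (dx i))).
have ds := line_derive_sum (index_enum 'I_n) (fun i =>
  line_deriveD (line_deriveD (line_derive_scale 2 t) (dl i)) (dq i)).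
have H := line_derive_expR (line_deriveD (line_derive_scale (- mu) t) ds).
have E s : - mu * s + \sum_(j <- index_enum 'I_n) (2 * s + 2^-1 * (ln (R:=R) \o flow_rate j) s +
       -1 * (flow_rate j s * ((cst (x ord0 j) s + -1 * (y j * expR (2 * s))) *
           (cst (x ord0 j) s + -1 * (y j * expR (2 * s)))))) =
    - mu * s + \sum_i (2 * s + ln (flow_rate i s) / 2 -
      flow_rate i s * (x ord0 i - flow_center i s) ^+ 2).
  by congr (_ + _); apply: eq_bigr => i _ /=; rewrite /flow_center expr2; ring.
rewrite (_ : flow ^~ x = (fun s => expR (- mu * s + \sum_(j <- index_enum 'I_n) (2 * s + 2^-1 * (ln (R:=R) \o flow_rate j) s +
       -1 * (flow_rate j s * ((cst (x ord0 j) s + -1 * (y j * expR (2 * s))) *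
           (cst (x ord0 j) s + -1 * (y j * expR (2 * s))))))))); last first.
  by apply/funext => s; rewrite E.
apply: (is_derive_eq H); rewrite E; congr (_ * _).
congr (_ + _); apply: eq_bigr => i _; rewrite /flow_center.
have := lt0r_neq0 (a1 i); move: (flow_rate i t) => al al0 /=.
by field.
Qed.

End gaussian_flow.

(** Quadratic growth in x with a constant depending only on bounds of the rate and the center, hence
    uniform over a bounded time interval. *)
Lemma drift_term_bound {R : realType} (A B al be x S : R) : 0 < al -> al <= A ->
  `|be| <= B -> x ^+ 2 <= S ->
  `|- 2 * al + 4 * al * (al + 1) * (x - be) ^+ 2 + 4 * al * be * (x - be)| <=
  (2 * A + 8 * A * (A + 1) * (B ^+ 2 + 1) + 4 * A * B * (1 + B)) * (1 + S).
Proof.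
move=> al0 alA beB xS; have S0 : 0 <= S := le_trans (sqr_ge0 x) xS.
have A0 : 0 <= A := le_trans (ltW al0) alA.
have B0 : 0 <= B := le_trans (normr_ge0 be) beB.
have hx : `|x| <= 1 + S.
  move: xS; rewrite -(real_normK (num_real x)).
  by move: (normr_ge0 x); move: `|_| => z; nra.
have hxb : `|x - be| <= 1 + S + B.
  by apply: (le_trans (ler_normB _ _)); exact: lerD.
have hb2 : be ^+ 2 <= B ^+ 2.
  by rewrite -(real_normK (num_real be)) ler_sqr ?nnegrE.
have hxb2 : (x - be) ^+ 2 <= 2 * S + 2 * B ^+ 2.
  by have := sqr_ge0 (x + be); lra.
have g1 : 4 * al * (al + 1) <= 4 * A * (A + 1) by nra.
have g0 : 0 <= 4 * al * (al + 1) by nra.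
have h1 : `|4 * al * (al + 1) * (x - be) ^+ 2| <= 4 * A * (A + 1) * (2 * S + 2 * B ^+ 2).
  rewrite normrM (ger0_norm g0) (ger0_norm (sqr_ge0 _)).
  exact: (ler_pM g0 (sqr_ge0 _) g1 hxb2).
have h2 : `|4 * al * be * (x - be)| <= 4 * A * B * (1 + S + B).
  have k0 : 0 <= 4 * al by lra.
  have k1 : 4 * al <= 4 * A by lra.
  rewrite normrM (normrM (4 * al)) (ger0_norm k0).
  apply: (ler_pM (mulr_ge0 k0 (normr_ge0 _)) (normr_ge0 _) _ hxb).
  exact: (ler_pM k0 (normr_ge0 _) k1 beB).
have h3 : `|- 2 * al| <= 2 * A by rewrite normrM normrN !ger0_norm; lra.
apply: (le_trans (ler_normD _ _)); apply: (le_trans (lerD (ler_normD _ _) h2)).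
apply: (le_trans (lerD (lerD h3 h1) (lexx _))).
have e2 : 0 <= A * (A + 1) by rewrite mulr_ge0// addr_ge0.
have e1 : 0 <= A * (A + 1) * (S * B ^+ 2) by rewrite (mulr_ge0 e2)// mulr_ge0// sqr_ge0.
have e3 : 0 <= A * B * (S * B) by rewrite mulr_ge0// mulr_ge0.
have e4 : 0 <= A * S by rewrite mulr_ge0.
lra.
Qed.

(** * The evolution equation and a time-uniform Gaussian bound on the speed *)

Section flow_generator.
Context {R : realType} (n : nat).
Variables (mu : R) (a y : 'I_n -> R).
Hypotheses (mu0 : 0 <= mu) (a0 : forall i, 0 < a i).

Local Notation alpha := (flow_rate a).
Local Notation beta := (flow_center y).
Local Notation F := (flow mu a y).
Local Notation drift := (flow_drift mu a y).

Lemma flowE (t : R) (x : 'rV[R]_n) : F t x =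
  expR (- mu * t + \sum_i (2 * t + ln (alpha i t) / 2)) *
  gaussian (alpha ^~ t) (beta ^~ t) x.
Proof.
rewrite /flow /gaussian -expRD; congr expR; by rewrite -addrA -sumrB.
Qed.

Lemma flow_cgpoly (t : R) : 0 <= t -> cgpoly (fun x => (F t x)%:C).
Proof.
move=> t0; split => /=; last exact: gpoly0.
apply: (@gpoly_ext _ _ (fun x => expR (- mu * t + \sum_i (2 * t + ln (alpha i t) / 2)) *
  gaussian (alpha ^~ t) (beta ^~ t) x)); last by move=> x; rewrite flowE.
by apply: gpolyZ; apply: gpoly_gaussian => i; exact: flow_rate_gt0.
Qed.

Lemma free_op_real_gaussian (k : R) (al be : 'I_n -> R) (x : 'rV[R]_n) :
  free_op (fun x => (k * gaussian al be x)%:C) x =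
  (k * gaussian al be x * \sum_i (- 2 * al i + 4 * al i * (al i + 1) * (x ord0 i - be i) ^+ 2
     + 4 * al i * be i * (x ord0 i - be i)))%:C.
Proof.
have d1 i := is_partialM (is_partial_cst i k) (gaussian_partial al be i).
have p1 i : pderive i (fun x => (k * gaussian al be x)%:C) = fun x =>
    (k * ((2 * al i * be i) * gaussian al be x + (- (2 * al i)) * (x ord0 i * gaussian al be x)))%:C.
  apply/funext => z; apply: complex_eq => /=; last by rewrite derive_cst.
  by have [_ ->] := d1 i z; rewrite mul0r add0r.
have d2 i := is_partialM (is_partial_cst i k) (is_partialD
  (is_partialM (is_partial_cst i (2 * al i * be i)) (gaussian_partial al be i))
  (is_partialM (is_partial_cst i (- (2 * al i)))
    (is_partialM (is_partial_coord i i) (gaussian_partial al be i)))).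
apply: complex_eq.
  rewrite free_op_Re [RHS]/= mulr_sumr; apply: eq_bigr => i _.
  rewrite /pderives ![foldr _ _ _]/= p1 /=; have [_ ->] := d2 i x; rewrite eqxx mulr1n.
  by move: (gaussian al be x) => g; ring.
rewrite free_op_Im [RHS]/= big1// => i _; rewrite /pderives ![foldr _ _ _]/= p1 /= !derive_cst.
by rewrite mulr0 subr0.
Qed.

Lemma flow_generator (t : R) (x : 'rV[R]_n) :
  free_op (fun x => (F t x)%:C) x = (mu * F t x + F t x * drift t x)%:C.
Proof.
rewrite (_ : (fun x => _) = (fun x => (expR (- mu * t + \sum_i (2 * t + ln (alpha i t) / 2)) *
  gaussian (alpha ^~ t) (beta ^~ t) x)%:C)); last by apply/funext => z; rewrite flowE.
by rewrite free_op_real_gaussian flowE /flow_drift; congr (_%:C); ring.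
Qed.

(** Rates decrease in time, so their values at T give a common lower bound c. The flow is then below
    a multiple of e^(-c |x|^2 / 2), and half of this decay absorbs the quadratic growth of the
    drift. This is the majorant for all dominated limits in time. *)
Lemma flow_speed_bound (T : R) : 0 < T -> exists C c : R, [/\ 0 <= C, 0 < c &
  forall (t : R) x, 0 <= t -> t <= T -> `|F t x * drift t x| <= C * expR (- (c * sqnorm x))].
Proof.
move=> T0; have [c c0 hc] := pos_lower_bound (fun i => flow_rate_gt0 a0 i (ltW T0)).
pose A := \sum_i a i; pose B := \sum_i `|y i| * expR (2 * T).
have A0 : 0 <= A by apply: sumr_ge0 => i _; exact: ltW.
have B0 : 0 <= B by apply: sumr_ge0 => i _; rewrite mulr_ge0 ?expR_ge0.
have aA i : a i <= A.
  by rewrite /A (bigD1 i)//= lerDl; apply: sumr_ge0 => j _; exact: ltW.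
have yB i (t : R) : 0 <= t -> t <= T -> `|beta i t| <= B.
  move=> t0 tT; rewrite /flow_center normrM (ger0_norm (expR_ge0 _)).
  apply: (@le_trans _ _ (`|y i| * expR (2 * T))).
    by rewrite ler_wpM2l// ler_expR ler_wpM2l.
  rewrite /B (bigD1 i)//= lerDl; apply: sumr_ge0 => j _.
  by rewrite mulr_ge0 ?expR_ge0.
(* Bounds the exponent in each coordinate: 2 T for 2 t, A / 2 since ln alpha <= alpha <= A, and c
   B^2 for moving the center to the origin. *)
pose K1 := 2 * T + A / 2 + c * B ^+ 2.
pose K2 := 2 * A + 8 * A * (A + 1) * (B ^+ 2 + 1) + 4 * A * B * (1 + B).
have K20 : 0 <= K2 by rewrite /K2 !addr_ge0 ?mulr_ge0 ?addr_ge0 ?sqr_ge0.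
pose K := expR (n%:R * K1) * ((mu + n%:R * K2) * (1 + 4 / c)).
have c4 : 0 <= 4 / c by rewrite divr_ge0// ltW.
exists K, (c / 4); split; first exact:
    (mulr_ge0 (expR_ge0 _) (mulr_ge0 (addr_ge0 mu0 (mulr_ge0 (ler0n _ _) K20)) (addr_ge0 ler01 c4))).
  by rewrite divr_gt0.
move=> t x t0 tT; have S0 := sqnorm_ge0 x.
have al i : [/\ c <= alpha i t, alpha i t <= A & 0 < alpha i t].
  split; last exact: flow_rate_gt0.
    by apply: le_trans (hc i) _; exact: flow_rate_nonincreasing.
  apply: le_trans (aA i); rewrite -(flow_rate0 a i).
  exact: flow_rate_nonincreasing.
have xS i : x ord0 i ^+ 2 <= sqnorm x.
  by rewrite /sqnorm (bigD1 i)//= lerDl sumr_ge0// => j _; exact: sqr_ge0.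
have hF : F t x <= expR (n%:R * K1 - c / 2 * sqnorm x).
  rewrite /flow ler_expR (@le_trans _ _ (\sum_(i < n) (K1 - c / 2 * x ord0 i ^+ 2)))//.
    rewrite -[leRHS]add0r; apply: lerD; first by rewrite mulNr oppr_le0 mulr_ge0.
    apply: ler_sum => i _; have [h1 h2 h3] := al i; have hb := yB i t t0 tT.
    have hl : ln (alpha i t) <= A.
      apply: le_trans h2; have := le_ln1Dx (x := alpha i t - 1).
      by rewrite addrCA subrr addr0 => h; apply: (le_trans (h _)); lra.
    have hb2 : beta i t ^+ 2 <= B ^+ 2.
      by rewrite -(real_normK (num_real (beta i t))) ler_sqr ?nnegrE.
    have hq : c * (x ord0 i ^+ 2 / 2 - beta i t ^+ 2) <= alpha i t * (x ord0 i - beta i t) ^+ 2.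
      apply: (@le_trans _ _ (c * (x ord0 i - beta i t) ^+ 2)); last first.
        by rewrite ler_wpM2r ?sqr_ge0.
      rewrite ler_wpM2l ?(ltW c0)//.
      by have := sqr_ge0 (x ord0 i - 2 * beta i t); lra.
    have hc2 := ler_wpM2l (ltW c0) hb2.
    by rewrite /K1; move: hq hc2 hl tT; lra.
  rewrite sumrB sumr_const card_ord mulr_natl lerD2l -mulr_sumr.
  exact: lexx.
have hd : `|drift t x| <= (mu + n%:R * K2) * (1 + sqnorm x).
  rewrite /flow_drift; apply: (le_trans (ler_normD _ _)); rewrite normrN (ger0_norm mu0).
  rewrite mulrDl; apply: lerD; first by rewrite ler_peMr// lerDl.
  apply: (le_trans (ler_norm_sum _ _ _)).
  apply: (@le_trans _ _ (\sum_(i < n) (K2 * (1 + sqnorm x)))); last first.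
    by rewrite sumr_const card_ord -[n%:R * K2 * _]mulrA mulr_natl.
  apply: ler_sum => i _; have [h1 h2 h3] := al i; have hb := yB i t t0 tT.
  have h4 := xS i.
  exact: drift_term_bound.
have he : 1 + sqnorm x <= (1 + 4 / c) * expR (c / 4 * sqnorm x).
  have := expR_ge1Dx (c / 4 * sqnorm x).
  have c4' : 0 <= 1 + 4 / c by rewrite addr_ge0.
  move=> /(ler_wpM2l c4'); apply: le_trans.
  rewrite mulrDr mulr1 (_ : (1 + 4 / c) * _ = c / 4 * sqnorm x + sqnorm x); last first.
    by field; exact: lt0r_neq0.
  have h1 : 0 <= c / 4 * sqnorm x by rewrite mulr_ge0// divr_ge0// ltW.
  lra.
rewrite normrM (ger0_norm (expR_ge0 _)) -/(F t x).
apply: (le_trans (ler_pM (expR_ge0 _) (normr_ge0 _) hF hd)).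
have mK : 0 <= mu + n%:R * K2 by rewrite addr_ge0// mulr_ge0.
apply: (@le_trans _ _ (expR (n%:R * K1 - c / 2 * sqnorm x) * ((mu + n%:R * K2) * ((1 + 4 / c) * expR (c / 4 * sqnorm x))))).
  by rewrite ler_wpM2l ?expR_ge0// ler_wpM2l.
rewrite /K expRD (_ : expR (- (c / 2 * sqnorm x)) = expR (- (c / 4 * sqnorm x)) * expR (- (c / 4 * sqnorm x))); last first.
  by rewrite -expRD; congr expR; lra.
rewrite (expRN (c / 4 * sqnorm x)).
have := lt0r_neq0 (expR_gt0 (c / 4 * sqnorm x)).
move: (expR (c / 4 * _)) => e e0; rewrite le_eqVlt; apply/orP; left; apply/eqP.
by field; rewrite e0/= lt0r_neq0.
Qed.

End flow_generator.

(** * Decay of the damped flow *)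

Section flow_decay.
Context {R : realType} (n : nat).
Variables (b : R) (a y : 'I_n -> R).
Hypotheses (b0 : 0 < b) (a0 : forall i, 0 < a i).

(** In each coordinate the undamped squared norm is e^(4T) sqrt(alpha) up to a constant, and alpha
    <= a e^(-4T) leaves e^(2T). The undamped flow thus grows at most like e^(n T) in norm, which
    uses up the n of the damping n + b. *)
Lemma flow_energy (T : R) : 0 <= T ->
  (energy lebesgue_rV (fun x : 'rV[R]_n => (flow (n%:R + b) a y T x)%:C) <=
   (expR (- (2 * b * T)) * \prod_i Num.sqrt (a i * (pi / 2)))%:E)%E.
Proof.
move=> T0; have al i := flow_rate_gt0 a0 i T0.
have E : (fun x : 'rV[R]_n => (normc (flow (n%:R + b) a y T x)%:C ^+ 2)%:E) = (fun x =>
    (expR (- (2 * (n%:R + b) * T)) * \prod_i (expR (4 * T) * flow_rate a i T))%:E *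
    (gaussian (fun i => 2 * flow_rate a i T) ((flow_center y) ^~ T) x)%:E)%E.
  apply/funext => x; rewrite -EFinM; congr EFin.
  rewrite normc_real real_normK ?num_real// flowE exprMn.
  congr (_ * _).
    rewrite expr2 -expRD (_ : \prod_i _ = \prod_i expR (4 * T + ln (flow_rate a i T))); last first.
      by apply: eq_bigr => i _; rewrite expRD lnK ?posrE.
    rewrite -expR_sum -expRD; congr expR.
    have -> : \sum_(i < n) (4 * T + ln (flow_rate a i T)) =
       \sum_(i < n) (2 * T + ln (flow_rate a i T) / 2) + \sum_(i < n) (2 * T + ln (flow_rate a i T) / 2).
      by rewrite -big_split /=; apply: eq_bigr => i _; lra.
    by move: (\sum_(i < n) _) => s; ring.
  rewrite /gaussian expr2 -expRD; congr expR; rewrite -opprD; congr (- _).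
  by rewrite -big_split /=; apply: eq_bigr => i _; ring.
rewrite /energy E ge0_integralZl//; last first.
- by rewrite lee_fin mulr_ge0 ?expR_ge0 ?prodr_ge0// => i _; rewrite mulr_ge0 ?expR_ge0 ?ltW.
- by move=> x _; rewrite lee_fin expR_ge0.
- by apply/measurable_EFinP; apply: continuous_measurable_rV; exact: continuous_gaussian.
rewrite /gaussian integral_gauss_prod; last by move=> i; rewrite mulr_gt0.
rewrite -EFinM lee_fin.
set G := (X in X <= _).
have -> : G = expR (- (2 * (n%:R + b) * T)) *
    \prod_(i < n) (expR (4 * T) * flow_rate a i T * Num.sqrt (pi / (2 * flow_rate a i T))).
  by rewrite big_split/= mulrA.
clear G.
have hs (u v : R) : 0 <= u -> Num.sqrt (u ^+ 2 * v) = u * Num.sqrt v.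
  by move=> u0; rewrite sqrtrM ?sqr_ge0// sqrtr_sqr ger0_norm.
have h i : expR (4 * T) * flow_rate a i T * Num.sqrt (pi / (2 * flow_rate a i T)) <=
    expR (2 * T) * Num.sqrt (a i * (pi / 2)).
  have -> : expR (4 * T) * flow_rate a i T * Num.sqrt (pi / (2 * flow_rate a i T)) =
     expR (4 * T) * Num.sqrt (flow_rate a i T * (pi / 2)).
    have -> : flow_rate a i T * (pi / 2) = flow_rate a i T ^+ 2 * (pi / (2 * flow_rate a i T)).
      by field; rewrite lt0r_neq0.
    by rewrite hs ?(ltW (al i))// mulrA.
  have -> : expR (2 * T) * Num.sqrt (a i * (pi / 2)) =
      expR (4 * T) * Num.sqrt (a i * expR (- (4 * T)) * (pi / 2)).
    have -> : a i * expR (- (4 * T)) * (pi / 2) = expR (- (2 * T)) ^+ 2 * (a i * (pi / 2)).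
      rewrite (_ : - (4 * T) = - (2 * T) + - (2 * T)) ?expRD; last by lra.
      by ring.
    rewrite hs ?expR_ge0// (_ : expR (2 * T) = expR (4 * T) * expR (- (2 * T))); first by ring.
    by rewrite -expRD; congr expR; lra.
  rewrite ler_wpM2l ?expR_ge0// ler_wsqrtr// ler_wpM2r ?divr_ge0 ?pi_ge0//.
  exact: flow_rate_le.
apply: (@le_trans _ _ (expR (- (2 * (n%:R + b) * T)) * \prod_(i < n) (expR (2 * T) * Num.sqrt (a i * (pi / 2))))).
  rewrite ler_wpM2l ?expR_ge0// ler_prod// => i _; rewrite h andbT.
  exact: (mulr_ge0 (mulr_ge0 (expR_ge0 _) (ltW (al i))) (sqrtr_ge0 _)).
have -> : \prod_(i < n) (expR (2 * T) * Num.sqrt (a i * (pi / 2))) =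
    expR (n%:R * (2 * T)) * \prod_i Num.sqrt (a i * (pi / 2)).
  rewrite big_split /= prodr_const card_ord; congr (_ * _).
  by apply/esym; exact: expRM_natl.
rewrite (_ : expR (- (2 * b * T)) = expR (- (2 * (n%:R + b) * T)) * expR (n%:R * (2 * T))); last first.
  by rewrite -expRD; congr expR; ring.
by rewrite le_eqVlt; apply/orP; left; apply/eqP; ring.
Qed.

Lemma flow_decay (e : R) : 0 < e -> exists2 T : R, 0 < T &
  (L2norm lebesgue_rV (fun x : 'rV[R]_n => (flow (n%:R + b) a y T x)%:C) <= e%:E)%E.
Proof.
move=> e0; pose P := \prod_i Num.sqrt (a i * (pi / 2)).
have P0 : 0 <= P by apply: prodr_ge0 => i _; rewrite sqrtr_ge0.
have k0 : 0 < 2 * b * e ^+ 2 by rewrite !mulr_gt0 ?exprn_gt0.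
(* With e^s >= 1 + s at s = 2 b T, this T gives e^2 e^(2 b T) >= P, where the first e is the
   tolerance. *)
pose T := (P + 1) / (2 * b * e ^+ 2).
have T0 : 0 < T by rewrite divr_gt0// ltr_wpDl.
exists T => //; rewrite L2norm_leP ?(ltW e0)//.
apply: le_trans (flow_energy (ltW T0)) _; rewrite lee_fin -/P.
rewrite expRN mulrC ler_pdivrMr ?expR_gt0//.
have := expR_ge1Dx (2 * b * T) => /(ler_wpM2l (sqr_ge0 e)); apply: le_trans.
have -> : e ^+ 2 * (1 + 2 * b * T) = e ^+ 2 + (P + 1).
  by rewrite /T; field; rewrite lt0r_neq0//= lt0r_neq0.
by have := sqr_ge0 e; lra.
Qed.

End flow_decay.

(** * Approximate range of lambda - L_0 *)

Section shifted_range.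
Context {R : realType} (n : nat).
Variable lam : R[i].
Implicit Types (u v f g : 'rV[R]_n -> R[i]).

Definition shift_op u x := lam * u x - free_op u x.

Lemma cgpoly_shift_op u : cgpoly u -> cgpoly (shift_op u).
Proof.
move=> gu; rewrite (_ : shift_op u = fun x => lam * u x + (-1) * free_op u x).
  by apply: cgpolyD; apply: cgpolyZ => //; exact: cgpoly_free_op.
by apply/funext => x; rewrite mulN1r.
Qed.

Lemma shift_op_lin (c : R[i]) u v : cgpoly u -> cgpoly v ->
  shift_op (fun x => c * u x + v x) = (fun x => c * shift_op u x + shift_op v x).
Proof.
move=> gu gv; apply/funext => x; rewrite /shift_op free_opD ?free_opZ//.
  by ring.
exact: cgpolyZ.
Qed.

(** An explicit tolerance rather than membership in a closure: the descent along the flow has to add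
    up errors step by step. *)
Definition in_range f (e : R) := exists2 u, cgpoly u &
  (L2norm lebesgue_rV (fun x => shift_op u x - f x)%R <= e%:E)%E.

Lemma in_range_le f e e' : in_range f e -> e <= e' -> in_range f e'.
Proof. by move=> [u gu hu] ee; exists u => //; apply: le_trans hu _; rewrite lee_fin. Qed.

Lemma in_range_lin (c : R[i]) f v e : cmeasurable_fun setT f -> cgpoly v ->
  in_range f e -> in_range (fun x => c * f x + shift_op v x) (normc c * e).
Proof.
move=> mf gv [u gu hu]; exists (fun x => c * u x + v x).
  by apply: cgpolyD => //; exact: cgpolyZ.
rewrite (_ : (fun x => shift_op _ x - (_ + _)) = (fun x => c * (shift_op u x - f x))); last first.
  by apply/funext => x; rewrite shift_op_lin//=;
    move: (shift_op u x) (shift_op v x) => p q; ring.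
rewrite L2normZ; last by apply: cmeasurableB => //; exact/cgpoly_measurable/cgpoly_shift_op.
by rewrite EFinM lee_wpmul2l// lee_fin normc_nneg.
Qed.

Lemma in_range_near f g e e' : cmeasurable_fun setT f -> cmeasurable_fun setT g ->
  (L2norm lebesgue_rV (fun x => f x - g x)%R <= e'%:E)%E ->
  in_range f e -> in_range g (e + e').
Proof.
move=> mf mg fg [u gu hu]; exists u => //.
apply: (le_trans (L2norm_triangle lebesgue_rV _ mf mg)).
  exact/cgpoly_measurable/cgpoly_shift_op.
by rewrite EFinD leeD.
Qed.

Lemma cgpoly0 : cgpoly ((fun=> 0) : 'rV[R]_n -> R[i]).
Proof. by split; exact: gpoly0. Qed.

Lemma shift_op0 : shift_op (fun=> 0) = (fun=> 0).
Proof.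
have h : (fun x : 'rV[R]_n => 0 * (fun=> 0 : R[i]) x) = (fun=> 0).
  by apply/funext => x; rewrite mul0r.
have := free_opZ 0 cgpoly0; rewrite h => e.
by apply/funext => x; rewrite /shift_op e mulr0 mul0r subr0.
Qed.

Lemma in_rangeZ (c : R[i]) f e : cmeasurable_fun setT f -> in_range f e ->
  in_range (fun x => c * f x) (normc c * e).
Proof.
move=> mf hf; rewrite (_ : (fun x => _) = (fun x => c * f x + shift_op (fun=> 0) x)).
  by apply: in_range_lin => //; exact: cgpoly0.
by apply/funext => x; rewrite shift_op0 addr0.
Qed.

Lemma in_range0 e : 0 <= e -> in_range (fun=> 0) e.
Proof.
move=> e0; exists (fun=> 0); first exact: cgpoly0.
by rewrite shift_op0 (_ : (fun x => _) = fun=> 0) ?L2norm0 ?lee_fin//; apply/funext => x; rewrite subr0.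
Qed.

End shifted_range.

Lemma L2_gaussian_bound {R : realType} (n : nat) (C c : R) : 0 < c ->
  L2 lebesgue_rV (fun x : 'rV[R]_n => (C * expR (- (c * sqnorm x)))%:C).
Proof.
move=> c0; apply/L2_energyP; split.
  split => /=; last exact: measurable_cst.
  apply: measurable_funM => //; apply: measurableT_comp => //.
  apply: measurableT_comp => //; apply: measurable_funM => //.
  by apply: continuous_measurable_rV; exact: continuous_sqnorm.
rewrite /energy (eq_integral (fun x : 'rV[R]_n => ((C * expR (- (c * sqnorm x))) ^+ 2)%:E)).
  exact: gaussian_sq_integral.
by move=> x _; rewrite normc_real real_normK ?num_real.
Qed.

(** * Descent along the flow *)

Section flow_range.
Context {R : realType} (n : nat).
Variables (mu w T NT C c : R) (F G : R -> 'rV[R]_n -> R).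
Hypotheses (T0 : 0 < T) (c0 : 0 < c) (C0 : 0 <= C).
Hypothesis F_cgpoly : forall t, 0 <= t -> cgpoly (fun x => (F t x)%:C).
Hypothesis F_derive : forall (t : R) x, 0 <= t -> is_derive t 1 (F ^~ x) (G t x).
Hypothesis F_generator : forall t x,
  free_op (fun x => (F t x)%:C) x = (mu * F t x + G t x)%:C.

Local Notation lam := (mu +i* w).
Let K (x : 'rV[R]_n) := C * expR (- (c * sqnorm x)).

Hypothesis GK : forall (t : R) x, 0 <= t -> t <= T -> `|G t x| <= K x.
Hypotheses (NT0 : 0 <= NT)
  (FT : (L2norm lebesgue_rV (fun x => (F T x)%:C) <= NT%:E)%E).

Let N := fine (L2norm lebesgue_rV (fun x => (K x)%:C)).

Let N0 : 0 <= N.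
Proof. by rewrite fine_ge0// L2norm_ge0. Qed.

Let KN : L2norm lebesgue_rV (fun x => (K x)%:C) = N%:E.
Proof. by rewrite /N fineK//; apply: L2_ge0_fin; exact: L2_gaussian_bound. Qed.

Let K0 x : 0 <= K x.
Proof. by rewrite mulr_ge0// expR_ge0. Qed.

Let GE t x : ((G t x)%:C : R[i]) =
  free_op (fun x => (F t x)%:C) x - mu%:C * (F t x)%:C.
Proof. by rewrite F_generator; apply: complex_eq => /=; ring. Qed.

Let mF t : 0 <= t -> cmeasurable_fun setT (fun x : 'rV[R]_n => (F t x)%:C).
Proof. by move=> t0; apply: cgpoly_measurable; exact: F_cgpoly. Qed.

Let mG t : 0 <= t -> cmeasurable_fun setT (fun x : 'rV[R]_n => (G t x)%:C).
Proof.
move=> t0; under eq_fun do rewrite GE.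
have gF := F_cgpoly t0.
apply: cmeasurableB; first by apply: cgpoly_measurable; exact: cgpoly_free_op.
by apply: cmeasurableM; [exact: cmeasurable_cst|exact: mF].
Qed.

Let flow_increment s t x : 0 <= s -> s <= t -> t <= T ->
  `|F t x - F s x| <= (t - s) * K x.
Proof.
move=> s0 st tT.
have D r : r \in `[s, t] -> is_derive r 1 (F ^~ x) (G r x).
  by rewrite in_itv /= => /andP[sr _]; apply: F_derive; exact: le_trans s0 sr.
have Doo r : r \in `]s, t[ -> is_derive r 1 (F ^~ x) (G r x).
  by move=> rst; apply: D; exact: subset_itv_oo_cc.
have cF : {within `[s, t], continuous (F ^~ x)}.
  by apply: derivable_within_continuous => r /D[].
have [r rst e] := MVT_segment st Doo cF.
have := congr1 (fun z : R => `|z|) e.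
rewrite /= normrM (ger0_norm (x := t - s)) ?subr_ge0// mulrC => ->.
rewrite ler_wpM2l ?subr_ge0//.
move: rst; rewrite in_itv /= => /andP[sr rt].
by apply: GK; [exact: le_trans sr|exact: le_trans tT].
Qed.

Let flow_lipschitz s t : 0 <= s -> s <= t -> t <= T ->
  (L2norm lebesgue_rV (fun x : 'rV[R]_n => (F t x)%:C - (F s x)%:C)%R <=
   ((t - s) * N)%:E)%E.
Proof.
move=> s0 st tT; have t0 := le_trans s0 st.
have ts : 0 <= t - s by rewrite subr_ge0.
have mK : cmeasurable_fun setT (fun x => (K x)%:C) by have [] := L2_gaussian_bound n C c0.
apply: (@le_trans _ _ (L2norm lebesgue_rV (fun x : 'rV[R]_n => (t - s)%:C * (K x)%:C))).
  apply: L2norm_le; first by apply: cmeasurableB; exact: mF.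
    by apply: cmeasurableM => //; exact: cmeasurable_cst.
  move=> x; rewrite -rmorphB -rmorphM !normc_real.
  by rewrite (ger0_norm (mulr_ge0 ts (K0 x))); exact: flow_increment.
by rewrite L2normZ// KN normc_real ger0_norm// -EFinM.
Qed.

(** Taylor's formula of order one in L^2, backwards in time. Difference quotients converge pointwise
    and are below [K] by the mean value theorem, so dominated convergence applies; the steps min(s,
    h1) / (k + 1) keep s - h nonnegative. *)
Let flow_step s h1 e : 0 < s -> s <= T -> 0 < h1 -> 0 < e ->
  exists h, [/\ 0 < h, h <= s, h <= h1 &
    (L2norm lebesgue_rV (fun x : 'rV[R]_n =>
      ((F s x)%:C - h%:C * (G s x)%:C) - (F (s - h) x)%:C)%R <= (e * h)%:E)%E].
Proof.
move=> s0 sT h10 e0; pose m := Num.min s h1.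
have m0 : 0 < m by rewrite lt_min s0.
pose h k := m * k.+1%:R^-1.
have h0 k : 0 < h k by rewrite mulr_gt0// invr_gt0 ltr0n.
have hm k : h k <= m by rewrite ler_piMr ?(ltW m0)// invf_le1 ?ler1n// ltr0n.
have hs k : h k <= s by apply: le_trans (hm k) _; rewrite ge_min lexx.
have hh k : h k <= h1 by apply: le_trans (hm k) _; rewrite ge_min lexx orbT.
have sh k : 0 <= s - h k by rewrite subr_ge0.
pose f k x : R[i] := ((h k)^-1)%:C * ((F (s - h k) x)%:C - (F s x)%:C).
pose g x : R[i] := (- (G s x))%:C.
have mg : cmeasurable_fun setT g.
  rewrite /g; under eq_fun do rewrite rmorphN.
  by apply: cmeasurableN; exact: mG (ltW s0).
have mf k : cmeasurable_fun setT (f k).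
  apply: cmeasurableM; first exact: cmeasurable_cst.
  by apply: cmeasurableB; apply: mF => //; exact: ltW.
have hcv : - h k @[k --> \oo] --> (0 : R).
  suff : - h k @[k --> \oo] --> - (m * 0) by rewrite mulr0 oppr0.
  by apply: cvgN; apply: cvgM; [exact: cvg_cst|exact: cvg_harmonic].
have cv x : normc (f k x - g x) @[k --> \oo] --> (0 : R).
  have [dv dE] := F_derive x (ltW s0).
  have lim0 : (z^-1 *: (F (z *: 1 + s) x - F s x)) @[z --> 0^'] --> G s x by rewrite -dE; exact: dv.
  have hne k : - h k != 0 by rewrite oppr_eq0 lt0r_neq0.
  have /cvgr_dnbhsP/(_ (fun k => - h k) (conj hne hcv)) := lim0.
  move=> lim; have lim2 : ((- h k)^-1 *: (F (- h k *: 1 + s) x - F s x)) - G s x @[k --> \oo] --> (0 : R).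
    by rewrite -[X in _ --> X](subrr (G s x)); apply: cvgB => //; exact: cvg_cst.
  apply/cvgrPdist_lt => r r0; have /cvgrPdist_lt/(_ r r0) := lim2.
  apply: filterS => k; rewrite !sub0r !normrN (ger0_norm (normc_nneg _)).
  suff -> : normc (f k x - g x) =
      `|(- h k)^-1 *: (F (- h k *: 1 + s) x - F s x) - G s x| by [].
  rewrite /f /g -rmorphB -rmorphM -rmorphB normc_real opprK.
  rewrite -[_ *: 1]/(_ * _) mulr1 [s - h k]addrC invrN -[_ *: _]/(_ * _).
  by rewrite mulNr -opprD normrN.
have dom k x : normc (f k x - g x) <= normc ((2 * C * expR (- (c * sqnorm x)))%:C).
  rewrite /f /g -rmorphB -rmorphM -rmorphB !normc_real.
  rewrite (ger0_norm (x := 2 * C * _)) ?mulr_ge0 ?expR_ge0//.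
  apply: (le_trans (ler_normB _ _)); rewrite normrN.
  have h2 : `|(h k)^-1 * (F (s - h k) x - F s x)| <= K x.
    rewrite normrM ger0_norm ?invr_ge0 ?(ltW (h0 k))// mulrC ler_pdivrMr// mulrC distrC.
    rewrite -[X in X * K x](subKr s); apply: flow_increment => //.
    by rewrite gerBl ltW.
  by have := GK x (ltW s0) sT; move: h2; rewrite /K; lra.
have /cvge0P/(_ e e0)[|k0 /(_ k0 (leqnn _)) hk] := L2norm_dominated mf mg (L2_gaussian_bound n (2 * C) c0) cv dom.
  by move=> k; exact: L2norm_ge0.
exists (h k0); split => //.
rewrite (_ : (fun x => _) = (fun x => (- (h k0))%:C * (f k0 x - g x))); last first.
  apply/funext => x; rewrite /f /g.
  move: (F s x) (F _ x) (G s x) (lt0r_neq0 (h0 k0)) => p q r; move: (h k0) => z z0.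
  by apply: complex_eq => /=; field.
rewrite L2normZ; last exact: cmeasurableB.
rewrite normc_real normrN (gtr0_norm (h0 k0)) [(e * _)%R]mulrC (EFinM (h k0) e).
by apply: lee_wpmul2l => //; rewrite lee_fin ltW.
Qed.

(** Modulo the range of lambda - L_0, the Taylor polynomial F - h G is the multiple 1 - i h w of F:
    the frequency, absent from F, appears only there. *)
Let flow_shift s h x : 0 <= s -> ((F s x)%:C - h%:C * (G s x)%:C : R[i]) =
  (1 -i* (h * w)) * (F s x)%:C + shift_op lam (fun x => h%:C * (F s x)%:C) x.
Proof.
move=> s0; rewrite /shift_op GE (@free_opZ _ _ h%:C (fun x => (F s x)%:C)); last exact: F_cgpoly.
move: (free_op _ _) => z; apply: complex_eq; case: z => z1 z2 /=; ring.
Qed.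

(** At time T the flow is within NT of 0, a point of the range. [S] collects the times at which the
    error is at most e (T - s) + NT, up to an arbitrary slack r. The infimum of [S] lies in [S] by
    Lipschitz continuity in time, and a positive infimum would be lowered by one [flow_step]. The
    infimum replaces a subdivision of [0, T], for which a step size uniform in time would be
    needed. *)
Lemma flow_in_range e : 0 < e -> in_range lam (fun x => (F 0 x)%:C) (e * T + NT + e).
Proof.
move=> e0.
pose S := [set s | [/\ 0 <= s, s <= T & forall r, 0 < r ->
  in_range lam (fun x => (F s x)%:C) (e * (T - s) + NT + r)]].
have ST : S T.
  split; rewrite ?lexx ?(ltW T0)// => r r0; rewrite subrr mulr0 add0r.
  have mT := mF (ltW T0).
  apply: (@in_range_le _ _ _ _ (0 + NT)); last by rewrite add0r lerDl ltW.
  apply: (in_range_near (cmeasurable_cst _ 0) mT _ (in_range0 n lam (lexx 0))).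
  by rewrite L2norm_distC; under eq_fun do rewrite subr0.
have iS : has_inf S by split; [exists T|exists 0 => s []].
pose s0 := inf S.
have s00 : 0 <= s0 by apply: lb_le_inf; [exists T|move=> s []].
have s0T : s0 <= T by apply: ge_inf => //; exact: iS.2.
have Ss0 : forall r, 0 < r -> in_range lam (fun x => (F s0 x)%:C) (e * (T - s0) + NT + r).
  move=> r r0; have k0 : 0 < r / (2 * (N + 1)) by rewrite divr_gt0// mulr_gt0// ltr_wpDl.
  have [s [sn0 sT hs] slt] := inf_adherent k0 iS.
  have s0s : s0 <= s by apply: ge_inf => //; exact: iS.2.
  have r2 : 0 < r / 2 by rewrite divr_gt0.
  apply: (in_range_le (in_range_near (mF sn0) (mF s00) (flow_lipschitz s00 s0s sT) (hs _ r2))).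
  have : (s - s0) * N <= r / 2.
    apply: (@le_trans _ _ (r / (2 * (N + 1)) * N)).
      by rewrite ler_wpM2r// lerBlDr addrC ltW.
    rewrite mulrAC ler_pdivrMr ?mulr_gt0 ?ltr_wpDl// (_ : r / 2 * _ = r * (N + 1)); last by field.
    by rewrite ler_wpM2l ?(ltW r0)// lerDl.
  have : e * (T - s) <= e * (T - s0) by rewrite ler_wpM2l ?(ltW e0)// lerB.
  lra.
have [s0p|] := ltP 0 s0; last first.
  move=> s0le; have s0E : s0 = 0 by apply/eqP; rewrite eq_le s0le.
  by have := Ss0 e e0; rewrite s0E subr0.
exfalso; pose D := e * T + NT + 1.
have D0 : 0 < D by rewrite ltr_wpDl// addr_ge0// mulr_ge0// ltW.
have w1 : 0 < w ^+ 2 + 1 by rewrite ltr_wpDl// sqr_ge0.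
(* The factor |1 - i h w| <= 1 + h^2 w^2 acts on an error of at most D, so this limit on h makes the
   loss at most h e / 2. The other half of h e goes to the Taylor remainder, with w^2 + 1 keeping
   the divisor positive. *)
have h10 : 0 < e / (2 * (w ^+ 2 + 1) * D) by rewrite divr_gt0// !mulr_gt0.
have [h [h0 hs hh1 hF]] := flow_step s0p s0T h10 (divr_gt0 e0 (ltr0Sn R 1)).
have sh : 0 <= s0 - h by rewrite subr_ge0.
suff : S (s0 - h) by move=> /(ge_inf iS.2); rewrite -/s0; lra.
split => //; first by lra.
(* Capping the slack at 1 keeps the accumulated error below [D]. *)
move=> r r0; pose r' := Num.min r 1.
have r'0 : 0 < r' by rewrite lt_min r0 ltr01.
have r'1 : r' <= 1 by rewrite ge_min lexx orbT.
have r'r : r' <= r by rewrite ge_min lexx.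
have gF := F_cgpoly s00.
have gh : cgpoly (fun x : 'rV[R]_n => h%:C * (F s0 x)%:C) by exact: cgpolyZ.
have := in_range_lin (1 -i* (h * w)) (mF s00) gh (Ss0 r' r'0).
rewrite (_ : (fun x => _) = (fun x => (F s0 x)%:C - h%:C * (G s0 x)%:C)); last first.
  by apply/funext => x; rewrite -flow_shift.
move=> hr; have mfs : cmeasurable_fun setT (fun x : 'rV[R]_n => (F s0 x)%:C - h%:C * (G s0 x)%:C).
  apply: cmeasurableB; first exact: mF.
  by apply: cmeasurableM; [exact: cmeasurable_cst|exact: mG].
apply: (in_range_le (in_range_near mfs (mF sh) hF hr)).
have nc : normc (1 -i* (h * w)) <= 1 + h * (h * w ^+ 2).
  have p : 0 <= h * (h * w ^+ 2) by exact: (mulr_ge0 (ltW h0) (mulr_ge0 (ltW h0) (sqr_ge0 w))).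
  rewrite -(@ler_pXn2r _ 2) ?nnegrE ?normc_nneg ?addr_ge0// normc_sqr /= sqrrN.
  by move: p; rewrite exprMn; set q := h * (h * _); rewrite (_ : h ^+ 2 * w ^+ 2 = q) /q; [nra|ring].
have Dle : e * (T - s0) + NT + r' <= D.
  by have : 0 <= e * s0 by [rewrite mulr_ge0// ltW]; rewrite /D; lra.
have D'0 : 0 <= e * (T - s0) + NT + r'.
  by rewrite !addr_ge0 ?(ltW r'0)// mulr_ge0 ?(ltW e0)// subr_ge0.
have hw : h * w ^+ 2 * D <= e / 2.
  have : h * (2 * (w ^+ 2 + 1) * D) <= e by rewrite -ler_pdivlMr// !mulr_gt0.
  have := mulr_ge0 (ltW h0) (ltW D0).
  by lra.
have := ler_wpM2r D'0 nc.
have : h * (h * w ^+ 2 * (e * (T - s0) + NT + r')) <= h * (e / 2).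
  rewrite ler_wpM2l ?(ltW h0)//; apply: le_trans hw; rewrite ler_wpM2l//.
  exact: (mulr_ge0 (ltW h0) (sqr_ge0 w)).
lra.
Qed.

End flow_range.

Lemma flow0 {R : realType} (n : nat) (mu : R) (a y : 'I_n -> R) :
  exists2 k, 0 < k & forall x, flow mu a y 0 x = k * gaussian a y x.
Proof.
have e1 : (flow_rate a)^~ 0 = a by apply/funext => i; exact: flow_rate0.
have e2 : (flow_center y)^~ 0 = y.
  by apply/funext => i; rewrite /flow_center mulr0 expR0 mulr1.
exists (expR (- mu * 0 + \sum_i (2 * 0 + ln (flow_rate a i 0) / 2))).
  exact: expR_gt0.
by move=> x; rewrite flowE e1 e2.
Qed.

(** The flow starts at k times the Gaussian, so tolerance k e is shared in thirds between the norm
    at time T, the stepping error r T and the final slack r; dividing by k gives e. *)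
Lemma gaussian_in_range {R : realType} (n : nat) (b w : R) (a y : 'I_n -> R) (e : R) :
  0 < b -> (forall i, 0 < a i) -> 0 < e ->
  in_range ((n%:R + b) +i* w) (fun x => (gaussian a y x)%:C) e.
Proof.
move=> b0 a0 e0.
have [k k0 F0] := flow0 (n%:R + b) a y.
have ke : 0 < k * e / 3 by rewrite divr_gt0// mulr_gt0.
have [T T0 FT] := flow_decay y b0 a0 ke.
have mu0 : 0 <= n%:R + b by rewrite addr_ge0// ltW.
have [C [c [C0 c0 hC]]] := flow_speed_bound y mu0 a0 T0.
pose r := Num.min (k * e / 3) (k * e / 3 / T).
have r0 : 0 < r by rewrite lt_min ke divr_gt0.
have := flow_in_range w T0 c0 C0 (flow_cgpoly (n%:R + b) y a0)
  (fun t x => flow_derive (n%:R + b) y a0 x) (flow_generator (n%:R + b) a y) hC (ltW ke) FT r0.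
have r1 : r <= k * e / 3 by rewrite ge_min lexx.
have r2 : r * T <= k * e / 3 by rewrite -ler_pdivlMr// ge_min lexx orbT.
move=> /(@in_range_le _ _ _ _ _ (k * e))/(_ _)/(in_rangeZ (k^-1)%:C _) H.
rewrite (_ : (fun x => _) = (fun x => (k^-1)%:C * (flow (n%:R + b) a y 0 x)%:C)); last first.
  by apply/funext => x; rewrite -rmorphM F0 mulKf ?lt0r_neq0.
apply: (in_range_le (H _ _)).
- by apply: cgpoly_measurable; exact: flow_cgpoly.
- by lra.
- by rewrite normc_real gtr0_norm ?invr_gt0// mulKf ?lt0r_neq0.
Qed.

(** * Indicators of intervals as limits of Gaussian combinations *)

Section windows.
Context {R : realType}.
Implicit Types (t y rho : R) (m : nat).

Lemma bernoulli (z : R) k : 0 <= z -> z <= 1 -> 1 - k%:R * z <= (1 - z) ^+ k.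
Proof.
move=> z0 z1; elim: k => [|k ih]; first by rewrite mul0r subr0 expr0.
have z10 : 0 <= 1 - z by rewrite subr_ge0.
have k0 : 0 <= k%:R :> R by [].
rewrite exprSr; apply: le_trans (ler_wpM2r z10 ih); rewrite -natr1; nra.
Qed.

Lemma cvg_inv_nat (u : nat -> R) (l K : R) N :
  (forall k, (N <= k)%N -> `|u k - l| <= K / k.+1%:R) -> u k @[k --> \oo] --> l.
Proof.
move=> h; have hK : K * harmonic k @[k --> \oo] --> (K * 0 : R).
  by apply: cvgM; [exact: cvg_cst|exact: cvg_harmonic].
rewrite mulr0 in hK; apply/cvgrPdist_le => e e0.
move/cvgrPdist_le : hK => /(_ e e0) hK.
near=> k; rewrite distrC; apply: (@le_trans _ _ (K / k.+1%:R)).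
  by apply: h; near: k; exact: nbhs_infty_ge.
apply: (le_trans (ler_norm _)); rewrite -normrN -sub0r.
by near: k.
Unshelve. all: by end_near. Qed.

(* The exponent k is tuned so that k e^(-m (t - y)^2) tends to +oo for
   |t - y| < rho and to 0 for |t - y| > rho: windows tend to indicators. *)
Definition window rho y m t : R :=
  1 - (1 - expR (- (m.+1%:R * (t - y) ^+ 2))) ^+
      Num.truncn (expR (m.+1%:R * rho ^+ 2) / m.+1%:R).

(** Outside the interval Bernoulli's inequality bounds the window by k z; inside, the bound exceeds
    1. It does not depend on m and is Gaussian in t, so products over coordinates have an L^2
    majorant. *)
Lemma window_itv rho y m t :
  0 <= window rho y m t <= expR (rho ^+ 2 - (t - y) ^+ 2).
Proof.
rewrite /window; set z := expR (- _); set k := Num.truncn _; set s := rho ^+ 2 - _.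
have z0 : 0 <= z := expR_ge0 _.
have z1 : z <= 1 by rewrite -expR0 ler_expR oppr_le0 mulr_ge0// sqr_ge0.
have z10 : 0 <= 1 - z by rewrite subr_ge0.
have zk : 0 <= (1 - z) ^+ k by rewrite exprn_ge0.
apply/andP; split; first by rewrite subr_ge0 exprn_ile1// gerBl.
have [s0|s0] := leP 0 s.
  by apply: (@le_trans _ _ 1); [rewrite gerBl|rewrite -expR0 ler_expR].
have hk : k%:R <= expR (m.+1%:R * rho ^+ 2) / m.+1%:R.
  by rewrite truncn_le// divr_ge0// expR_ge0.
have := bernoulli k z0 z1.
have : k%:R * z <= expR (m.+1%:R * s).
  apply: (le_trans (ler_wpM2r z0 hk)); rewrite mulrAC /z -expRD.
  rewrite (_ : m.+1%:R * rho ^+ 2 + _ = m.+1%:R * s) /s; last by ring.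
  by rewrite ler_pdivrMr// ler_peMr ?expR_ge0// ler1n.
have : expR (m.+1%:R * s) <= expR s.
  by rewrite ler_expR ler_neMl// ?ler1n// ltW.
lra.
Qed.

(** The division by m + 1 in the power k gives k z <= 1/(m+1) even at |t - y| = rho, so the limit is
    the indicator of the open interval. Inside, (1 - z)^k <= e^(-k z) and k z grows at least
    linearly in m. *)
Lemma window_cvg rho y t :
  window rho y m t @[m --> \oo] --> (((t - y) ^+ 2 < rho ^+ 2)%R%:R : R).
Proof.
have [st|ts] := ltP; last first.
  apply: (@cvg_inv_nat _ _ 1 0) => m _; rewrite subr0.
  have /andP[w0 _] := window_itv rho y m t; rewrite ger0_norm//.
  rewrite /window; set z := expR (- _); set k := Num.truncn _.
  have z0 : 0 <= z := expR_ge0 _.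
  have z1 : z <= 1 by rewrite -expR0 ler_expR oppr_le0 mulr_ge0// sqr_ge0.
  have hk : k%:R <= expR (m.+1%:R * rho ^+ 2) / m.+1%:R.
    by rewrite truncn_le// divr_ge0// expR_ge0.
  have := bernoulli k z0 z1.
  have : k%:R * z <= 1 / m.+1%:R.
    apply: (le_trans (ler_wpM2r z0 hk)); rewrite mulrAC /z -expRD.
    rewrite ler_pM2r ?invr_gt0// -expR0 ler_expR -mulrN -mulrDr.
    by rewrite mulr_ge0_le0// subr_le0.
  move: (k%:R * z) ((1 - z) ^+ k) (1 / m.+1%:R) => p q r; lra.
pose s := rho ^+ 2 - (t - y) ^+ 2; have s0 : 0 < s by rewrite subr_gt0.
apply: (@cvg_inv_nat _ _ (4 / s ^+ 2) 0) => m _.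
rewrite /window; set z := expR (- _); set k := Num.truncn _.
have z0 : 0 <= z := expR_ge0 _.
have z1 : z <= 1 by rewrite -expR0 ler_expR oppr_le0 mulr_ge0// sqr_ge0.
have z10 : 0 <= 1 - z by rewrite subr_ge0.
rewrite (_ : 1 - _ - true%:R = - (1 - z) ^+ k); last by rewrite mulr1n; ring.
rewrite normrN ger0_norm ?exprn_ge0//.
have hk : expR (m.+1%:R * rho ^+ 2) / m.+1%:R - 1 <= k%:R.
  have e0 : 0 <= expR (m.+1%:R * rho ^+ 2) / m.+1%:R by rewrite divr_ge0// expR_ge0.
  by have /andP[_] := truncn_itv e0; rewrite -/k -[k.+1%:R]natr1 lerBlDr => /ltW.
pose M : R := m.+1%:R; have M0 : 0 < M by rewrite ltr0n.
(* Here e^(M s) >= (M s / 2)^2 beats the division by M; the - 1 is lost when k is truncated to an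
   integer. *)
have kz : M * s ^+ 2 / 4 - 1 <= k%:R * z.
  apply: le_trans (ler_wpM2r z0 hk); rewrite mulrBl mul1r.
  apply: lerB => //.
  rewrite [X in _ <= X]mulrAC /z -expRD -/M (_ : M * rho ^+ 2 + _ = M * s / 2 + M * s / 2); last first.
    by rewrite /s; field.
  rewrite ler_pdivlMr// expRD.
  have q0 : 0 <= M * s / 2 by rewrite divr_ge0// mulr_ge0// ltW.
  have qe : M * s / 2 <= expR (M * s / 2) by have := expR_ge1Dx (M * s / 2); lra.
  rewrite (_ : M * s ^+ 2 / 4 * M = (M * s / 2) * (M * s / 2)); last by field.
  exact: ler_pM.
have ms : 0 < M * s ^+ 2 by rewrite mulr_gt0// exprn_gt0.
apply: (@le_trans _ _ (expR (- (k%:R * z)))).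
  rewrite -mulrN expRM_natl lerXn2r ?nnegrE ?expR_ge0//.
  by have := expR_ge1Dx (- z).
apply: (@le_trans _ _ (expR (- (M * s ^+ 2 / 4 - 1)))).
  by rewrite ler_expR lerN2.
rewrite expRN (_ : 4 / s ^+ 2 / m.+1%:R = (M * s ^+ 2 / 4)^-1); last first.
  by rewrite -/M; field; rewrite !lt0r_neq0.
rewrite lef_pV2 ?posrE ?expR_gt0 ?divr_gt0//.
by have := expR_ge1Dx (M * s ^+ 2 / 4 - 1); lra.
Qed.

(** The center is common to all terms, so that a product of two terms is again a Gaussian with that
    center and the powers in [window] expand inside the class. *)
Inductive gauss_comb y : (R -> R) -> Prop :=
| gauss_comb1 a : 0 < a -> gauss_comb y (fun t => expR (- (a * (t - y) ^+ 2)))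
| gauss_combD f g : gauss_comb y f -> gauss_comb y g -> gauss_comb y (fun t => f t + g t)
| gauss_combZ c f : gauss_comb y f -> gauss_comb y (fun t => c * f t).

Lemma gauss_combM y f b : 0 < b -> gauss_comb y f ->
  gauss_comb y (fun t => f t * expR (- (b * (t - y) ^+ 2))).
Proof.
move=> b0; elim=> {f} [a a0|f g _ ihf _ ihg|c f _ ih].
- rewrite (_ : (fun t => _) = (fun t => expR (- ((a + b) * (t - y) ^+ 2)))).
    by apply: gauss_comb1; rewrite addr_gt0.
  by apply/funext => t; rewrite -expRD; congr expR; ring.
- rewrite (_ : (fun t => _) = (fun t => f t * expR (- (b * (t - y) ^+ 2)) + g t * expR (- (b * (t - y) ^+ 2)))).
    exact: gauss_combD.
  by apply/funext => t; rewrite mulrDl.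
- rewrite (_ : (fun t => _) = (fun t => c * (f t * expR (- (b * (t - y) ^+ 2))))).
    exact: gauss_combZ.
  by apply/funext => t; rewrite mulrA.
Qed.

Lemma gauss_comb_window rho y m : gauss_comb y (window rho y m).
Proof.
rewrite /window; move: (Num.truncn _) => k; elim: k => [|k ih].
  rewrite (_ : (fun t => _) = (fun t => 0 * expR (- (1 * (t - y) ^+ 2)))).
    by apply: gauss_combZ; exact: gauss_comb1.
  by apply/funext => t; rewrite expr0 subrr mul0r.
have m0 : 0 < m.+1%:R :> R by [].
pose z t := expR (- (m.+1%:R * (t - y) ^+ 2)).
rewrite (_ : (fun t => _) = (fun t => (1 - (1 - z t) ^+ k + z t) + (-1) * ((1 - (1 - z t) ^+ k) * z t))).
  apply: gauss_combD; first by apply: gauss_combD => //; exact: gauss_comb1.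
  by apply: gauss_combZ; exact: gauss_combM.
by apply/funext => t; rewrite exprSr /z; ring.
Qed.

(** Counts the integers from 1 to K strictly below v. Rounding a function in this way writes it as a
    sum of indicators of its superlevel sets. *)
Fixpoint layer_count (K : nat) (v : R) : R :=
  if K is k.+1 then layer_count k v + (K%:R < v)%R%:R else 0.

Lemma layer_countE K v : layer_count K v = \sum_(k < K) (k.+1%:R < v)%R%:R.
Proof. by elim: K => [|K ih]; rewrite ?big_ord0//= big_ord_recr/= ih. Qed.

Lemma layer_count_full K v : K%:R < v -> layer_count K v = K%:R.
Proof.
elim: K => [//|K ih] /= h; rewrite h ih ?natr1//.
by apply: le_lt_trans h; rewrite ler_nat.
Qed.

Lemma layer_count_itv K v : 0 <= v ->
  0 <= layer_count K v <= v /\ (v <= K%:R -> v - 1 <= layer_count K v).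
Proof.
move=> v0; elim: K => [|K [/andP[l0 lv] ih]] /=; first by rewrite lexx v0; split=> // ?; lra.
have [h|h] := ltP K.+1%:R v.
  have h' : K%:R < v by apply: le_lt_trans h; rewrite ler_nat.
  rewrite layer_count_full// -[1%R]/(1:R) natr1 (ltW h) ler0n; split => //; lra.
rewrite addr0 l0 lv; split=> // _.
have [/ih//|h'] := leP v K%:R.
by rewrite layer_count_full//; move: h; rewrite -natr1; lra.
Qed.

End windows.

(** * Density of Gaussians in L^2 *)

Section gaussian_density.
Context {R : realType} (n : nat).
(** Density is phrased as: a linear class closed in L^2 that contains the Gaussians is everything.
    It will be applied to the functions that lie within every positive distance of the range of
    lambda - L_0. *)
Variable P : ('rV[R]_n -> R[i]) -> Prop.
Hypothesis P_L2 : forall f, P f -> L2 lebesgue_rV f.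
Hypothesis PD : forall f g, P f -> P g -> P (fun x => f x + g x).
Hypothesis PZ : forall c f, P f -> P (fun x => c * f x).
Hypothesis P_lim : forall (f_ : nat -> _) f, (forall k, P (f_ k)) ->
  L2 lebesgue_rV f ->
  L2norm lebesgue_rV (fun x => f_ k x - f x) @[k --> \oo] --> 0%E -> P f.
Hypothesis P_gaussian : forall a y, (forall i, 0 < a i) ->
  P (fun x => (gaussian a y x)%:C).

Let Q (g : 'rV[R]_n -> R) := P (fun x => (g x)%:C).

Let Q_ext f g : Q f -> f =1 g -> Q g.
Proof. by move=> Qf /funext <-. Qed.

Let QD f g : Q f -> Q g -> Q (fun x => f x + g x).
Proof.
move=> Qf Qg; rewrite /Q (_ : (fun x => _) = fun x => (f x)%:C + (g x)%:C).
  exact: PD.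
by apply/funext => x; rewrite rmorphD.
Qed.

Let QZ c f : Q f -> Q (fun x => c * f x).
Proof.
move=> Qf; rewrite /Q (_ : (fun x => _) = fun x => c%:C * (f x)%:C).
  exact: PZ.
by apply/funext => x; rewrite rmorphM.
Qed.

Let Q_gaussian a y : (forall i, 0 < a i) -> Q (gaussian a y).
Proof. exact: P_gaussian. Qed.

Let Q0 : Q (fun=> 0).
Proof.
apply: (@Q_ext (fun x => 0 * gaussian (fun=> 1) (fun=> 0) x)).
  by apply: QZ; exact: Q_gaussian.
by move=> x; rewrite mul0r.
Qed.

Let QB f g : Q f -> Q g -> Q (fun x => f x - g x).
Proof.
move=> Qf Qg; apply: (Q_ext (QD Qf (QZ (-1) Qg))) => x.
by rewrite mulN1r.
Qed.

Let Q_sum (I : Type) (r : seq I) (f : I -> 'rV[R]_n -> R) :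
  (forall i, Q (f i)) -> Q (fun x => \sum_(i <- r) f i x).
Proof.
move=> Qf; elim: r => [|i r ih].
  by apply: (Q_ext Q0) => x; rewrite big_nil.
by apply: (Q_ext (QD (Qf i) ih)) => x; rewrite big_cons.
Qed.

Let Q_measurable f : Q f -> measurable_fun setT f.
Proof. by move=> /P_L2[[]]. Qed.

(** The pointwise limit inherits the majorant g, so the differences are dominated by 2 g. *)
Let Q_dominated (f_ : nat -> 'rV[R]_n -> R) f g : (forall k, Q (f_ k)) ->
  L2 lebesgue_rV (fun x => (g x)%:C) -> (forall x, f_ k x @[k --> \oo] --> f x) ->
  (forall k x, `|f_ k x| <= g x) -> Q f.
Proof.
move=> Qf Lg cv dom.
have mf : measurable_fun setT f.
  by apply: (@measurable_fun_cvg _ _ _ _ f_) => [k|x _]; [exact: Q_measurable|exact: cv].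
have fg x : `|f x| <= g x.
  apply/ler_addgt0Pr => e e0.
  have /cvgrPdist_le/(_ e e0)[k _ /(_ k (leqnn k)) hk] := cv x.
  have := ler_normD (f x - f_ k x) (f_ k x); rewrite subrK => /le_trans; apply.
  by rewrite addrC lerD.
have g0 x : 0 <= g x := le_trans (normr_ge0 _) (fg x).
have mfC : cmeasurable_fun setT (fun x => (f x)%:C) by split => //=; exact: measurable_cst.
have Lf : L2 lebesgue_rV (fun x => (f x)%:C).
  by apply: (L2_le mfC Lg) => x; rewrite !normc_real (ger0_norm (g0 x)).
apply: (P_lim Qf Lf).
apply: (@L2norm_dominated _ _ _ _ _ _ (fun x => 2%:C * (g x)%:C)) => //.
- by move=> k; have [] := P_L2 (Qf k).
- exact: L2Z.
- move=> x; apply/cvgrPdist_le => e e0; have /cvgrPdist_le/(_ e e0) := cv x.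
  apply: filterS => k hk; rewrite sub0r normrN (ger0_norm (normc_nneg _)).
  by rewrite -rmorphB normc_real distrC.
- move=> k x; rewrite -rmorphB -rmorphM !normc_real.
  rewrite (ger0_norm (mulr_ge0 _ (g0 x)))//.
  by apply: (le_trans (ler_normB _ _)); have := dom k x; have := fg x; lra.
Qed.

(** A product of sums is expanded one coordinate at a time: factors of index below s are arbitrary
    combinations, the others single Gaussians. Factor number s is taken apart by induction on
    [gauss_comb]; when all factors are single, their product is a Gaussian. *)
Let Q_prod_aux (y : 'I_n -> R) (s : nat) (phi : 'I_n -> R -> R) :
  (forall i : 'I_n, (i < s)%N -> gauss_comb (y i) (phi i)) ->
  (forall i : 'I_n, (s <= i)%N -> exists2 a, 0 < a & phi i = fun t => expR (- (a * (t - y i) ^+ 2))) ->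
  Q (fun x => \prod_i phi i (x ord0 i)).
Proof.
elim: s phi => [|s ih] phi hc hg.
  have /choice[a ha] : forall i : 'I_n, exists a, 0 < a /\ phi i = fun t => expR (- (a * (t - y i) ^+ 2)).
    by move=> i; have [a a0 e] := hg i (leq0n _); exists a.
  apply: (@Q_ext (gaussian a y)); first by apply: Q_gaussian => i; case: (ha i).
  move=> x; rewrite /gaussian -sumrN expR_sum; apply: eq_bigr => i _.
  by case: (ha i) => _ ->.
have [sn|ns] := ltnP s n; last first.
  apply: ih => i hi; first by apply: hc; exact: leqW.
  by have := leq_trans (ltn_ord i) (leq_trans ns hi); rewrite ltnn.
pose i0 := Ordinal sn.
suff H f : gauss_comb (y i0) f ->
    Q (fun x => f (x ord0 i0) * \prod_(i < n | i != i0) phi i (x ord0 i)).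
  apply: (Q_ext (H _ (hc i0 (ltnSn _)))) => x.
  by rewrite [RHS](bigD1 i0).
elim=> {f} [a a0|f g _ ihf _ ihg|c f _ ihf].
- pose phi' i := if i == i0 then (fun t => expR (- (a * (t - y i0) ^+ 2))) else phi i.
  apply: (@Q_ext (fun x => \prod_i phi' i (x ord0 i))); last first.
    move=> x; rewrite (bigD1 i0)//= /phi' eqxx; congr (_ * _).
    by apply: eq_bigr => i /negbTE ->.
  apply: ih => i hi; rewrite /phi'; case: eqVneq => [ei|ne].
  + by move: hi; rewrite ei ltnn.
  + by apply: hc; exact: leqW.
  + by exists a => //; rewrite ei.
  + apply: hg; rewrite ltn_neqAle hi andbT; apply/eqP => e.
    by move/eqP: ne; apply; apply/val_inj.
- by apply: (Q_ext (QD ihf ihg)) => x; rewrite mulrDl.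
- by apply: (Q_ext (QZ c ihf)) => x; rewrite mulrA.
Qed.

Let Q_prod (y : 'I_n -> R) (phi : 'I_n -> R -> R) :
  (forall i, gauss_comb (y i) (phi i)) -> Q (fun x => \prod_i phi i (x ord0 i)).
Proof.
move=> hc; apply: (@Q_prod_aux y n) => [i _|i]; first exact: hc.
by rewrite leqNgt ltn_ord.
Qed.

Let Q_centered_box (y rho : 'I_n -> R) :
  Q (fun x => \prod_i (((x ord0 i - y i) ^+ 2 < rho i ^+ 2)%R%:R : R)).
Proof.
apply: (@Q_dominated (fun m x => \prod_i window (rho i) (y i) m (x ord0 i)) _
  (fun x => expR (\sum_i rho i ^+ 2) * gaussian (fun=> 1) y x)).
- move=> m; apply: (@Q_prod y (fun i => window (rho i) (y i) m)) => i.
  exact: gauss_comb_window.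
- by apply: P_L2; apply: QZ; exact: Q_gaussian.
- move=> x; apply: cvg_big => [|i _]; first exact: mul_continuous.
  exact: window_cvg.
- move=> m x; rewrite ger0_norm; last first.
    by apply: prodr_ge0 => i _; have /andP[] := window_itv (rho i) (y i) m (x ord0 i).
  rewrite /gaussian -expRD -sumrB expR_sum; apply: ler_prod => i _.
  by rewrite mul1r window_itv.
Qed.

Definition open_box (l r : 'I_n -> R) : set 'rV[R]_n :=
  [set x | forall i, l i < x ord0 i < r i].

Let Q_box l r : Q (\1_(open_box l r) : _ -> R).
Proof.
(* The maximum with 0 gives a degenerate box half-side 0, and the strict inequality then makes it
   empty. *)
apply: (Q_ext (Q_centered_box (fun i => (l i + r i) / 2) (fun i => Num.max 0 (r i - l i) / 2))).
move=> x; rewrite indicE.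
have E i : ((x ord0 i - (l i + r i) / 2) ^+ 2 < (Num.max 0 (r i - l i) / 2) ^+ 2) =
    (l i < x ord0 i < r i).
  move: (l i) (r i) (x ord0 i) => p q t; case: (leP 0 (q - p)) => h.
    by apply/idP/idP => [h1|/andP[h1 h2]]; [apply/andP; split|]; nra.
  rewrite mul0r expr0n /= ltNge sqr_ge0 /=; apply/esym/negbTE.
  by apply/negP => /andP[h1 h2]; lra.
under eq_bigr do rewrite E.
rewrite (_ : (x \in open_box l r) = [forall i, l i < x ord0 i < r i]); last first.
  by apply/idP/forallP => [/set_mem h|h]; [exact: h|exact/mem_set].
case: (boolP [forall i, _]) => [/forallP h|]; first by rewrite big1// => i _; rewrite h.
by rewrite negb_forall => /existsP[i /negbTE hi]; rewrite (bigD1 i)//= hi mul0r.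
Qed.

Let boxes : set (set 'rV[R]_n) := [set B | exists l r, B = open_box l r].

Let box_setI : setI_closed boxes.
Proof.
move=> _ _ [l [r ->]] [l' [r' ->]].
exists (fun i => Num.max (l i) (l' i)), (fun i => Num.min (r i) (r' i)).
apply/seteqP; split => [x [h h'] i|x h].
  have /andP[h1 h2] := h i; have /andP[h3 h4] := h' i.
  by rewrite gt_max lt_min h1 h2 h3 h4.
by split => i; have := h i; rewrite gt_max lt_min => /andP[/andP[h1 h2] /andP[h3 h4]];
  rewrite ?h1 ?h2 ?h3 ?h4.
Qed.

Let cube (N : nat) := open_box (fun=> - N%:R) (fun=> N%:R).

Let cube_mem (x : 'rV[R]_n) N : \sum_i `|x ord0 i| < N%:R -> cube N x.
Proof.
move=> h i; rewrite -ltr_norml; apply: le_lt_trans h.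
by rewrite (bigD1 i)//= lerDl sumr_ge0.
Qed.

(** A half-space a < x_i is the union over N of the boxes cut at N above and, in the other
    coordinates, at -N below. *)
Let box_generates A : measurable A -> <<s boxes >> A.
Proof.
pose T := g_sigma_algebraType boxes.
have mT : measurable_fun [set: T] (fun x : T => (x : 'rV[R]_n)).
  apply: measurable_fun_rV => i mD.
  apply: (measurability _ (RGenOInfty.measurableE R)) => //.
  move=> _ [_ [a ->] <-]; rewrite setTI.
  rewrite (_ : _ @^-1` _ = \bigcup_N (open_box (fun j => if j == i then a else - N%:R) (fun=> N%:R) : set T)).
    apply: bigcup_measurable => N _; apply: sub_sigma_algebra.
    by exists (fun j => if j == i then a else - N%:R), (fun=> N%:R).
  apply/seteqP; split => x /=.
    rewrite in_itv /= andbT => ax.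
    exists (Num.truncn (\sum_j `|x ord0 j|)).+1 => // j.
    have /cube_mem/(_ j)/andP[h1 h2] : \sum_j `|x ord0 j| < (Num.truncn (\sum_j `|x ord0 j|)).+1%:R.
      by rewrite truncnS_gt.
    by rewrite h2 andbT; case: eqP => [->|].
  by move=> [N _ /(_ i)]; rewrite eqxx in_itv /= andbT => /andP[].
by move=> mA; have := mT measurableT A mA; rewrite setTI.
Qed.

(** Dynkin's argument with open boxes as the intersection-stable family. The fixed cube keeps all
    indicators in L^2 and serves as majorant for increasing unions. *)
Let Q_measurable_set A N : measurable A -> Q (\1_(A `&` cube N) : _ -> R).
Proof.
move=> /box_generates; apply: (@lambda_system_subset _ _ box_setI setT
  [set B | Q (\1_(B `&` cube N) : _ -> R)]) => //; last first.
  have cb : boxes (cube N) by exists (fun=> - N%:R), (fun=> N%:R).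
  by move=> B Bb /=; have [l [r ->]] := box_setI Bb cb; exact: Q_box.
split => //=.
- by rewrite setTI; exact: Q_box.
- move=> A1 A2 A21 /= h1 h2; apply: (Q_ext (QB h1 h2)) => x.
  have e B : \1_(B `&` cube N) x = (x \in B)%:R * \1_(cube N) x :> R.
    by rewrite indicI /= indicE.
  rewrite !e in_setD -mulrBl; congr (_ * _).
  case: (boolP (x \in A2)) => [xA2|_]; last by rewrite andbT subr0.
  have -> : x \in A1 by apply/mem_set/A21/set_mem.
  by rewrite subrr.
- move=> F ndF /= h; apply: (@Q_dominated (fun k => \1_(F k `&` cube N)) _ (\1_(cube N) : _ -> R)) => //.
  + exact/P_L2/Q_box.
  + move=> x; have e B : \1_(B `&` cube N) x = (x \in B)%:R * \1_(cube N) x :> R.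
      by rewrite indicI /= indicE.
    rewrite e (_ : (fun k => _) = (fun k => (x \in F k)%:R * \1_(cube N) x)); last first.
      by apply/funext => k; rewrite e.
    case: (boolP (x \in _)) => [|xF].
      rewrite inE => -[k _ Fk]; apply: (@cvg_inv_nat _ _ _ 0 k) => j kj.
      have -> : x \in F j by apply/mem_set; move: Fk; exact/subsetPset/ndF.
      by rewrite subrr normr0 mul0r.
    apply: (@cvg_inv_nat _ _ _ 0 0) => j _.
    have -> : (x \in F j) = false.
      by apply/negbTE/negP => /set_mem Fj; move/negP: xF; apply; apply/mem_set; exists j.
    by rewrite subrr normr0 mul0r.
  + move=> k x; rewrite indicI /= ger0_norm ?mulr_ge0// ?indicE//.
    by rewrite ler_piMl// lern1 leq_b1.
Qed.

(** The approximations round g down in steps of 1/(m+1) up to height m+1, hence (m+1)^2 layers, and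
    cut to a cube; they stay below g, which is the L^2 majorant. *)
Let Q_nonneg (g : 'rV[R]_n -> R) : measurable_fun setT g -> (forall x, 0 <= g x) ->
  L2 lebesgue_rV (fun x => (g x)%:C) -> Q g.
Proof.
move=> mg g0 Lg.
pose f m x := m.+1%:R^-1 * (layer_count (m.+1 ^ 2) (m.+1%:R * g x) * (\1_(cube m) x : R)).
have fle m x : 0 <= f m x <= g x.
  have vg : 0 <= m.+1%:R * g x by rewrite mulr_ge0.
  have [/andP[l0 lv] _] := layer_count_itv (m.+1 ^ 2) vg.
  have i0 : 0 <= (\1_(cube m) x : R) by rewrite indicE.
  have i1 : (\1_(cube m) x : R) <= 1 by rewrite indicE lern1 leq_b1.
  have M0 : 0 < m.+1%:R :> R by [].
  rewrite /f; move: (layer_count _ _) l0 lv => L l0 lv; move: (\1_(cube m) x : R) i0 i1 => c i0 i1.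
  apply/andP; split; first by rewrite mulr_ge0 ?mulr_ge0// invr_ge0 ltW.
  by rewrite ler_pdivrMl//; apply: le_trans lv; rewrite ler_piMr.
apply: (@Q_dominated f _ g) => //.
- move=> m; apply: QZ.
  have mA (k : nat) : measurable [set x | k%:R < m.+1%:R * g x].
    rewrite (_ : [set x | _] = (fun x => m.+1%:R * g x) @^-1` `]k%:R, +oo[).
      rewrite -[X in measurable X]setTI; apply: measurable_funM => //.
    by apply/seteqP; split => x; rewrite /= in_itv/= andbT.
  apply: (@Q_ext (fun x => \sum_(k < (m.+1 ^ 2)%N) (\1_([set x | k.+1%:R < m.+1%:R * g x] `&` cube m) x : R))).
    by apply: Q_sum => k; exact: Q_measurable_set.
  move=> x; rewrite layer_countE mulr_suml; apply: eq_bigr => k _.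
  by rewrite indicI /= indicE; congr (_%:R * _); rewrite mem_setE.
- move=> x; apply: (@cvg_inv_nat _ _ _ 1 (Num.truncn (\sum_j `|x ord0 j| + g x)).+1) => m hm.
  have s0 : 0 <= \sum_j `|x ord0 j| by rewrite sumr_ge0.
  have : \sum_j `|x ord0 j| + g x < (Num.truncn (\sum_j `|x ord0 j| + g x)).+1%:R.
    by rewrite truncnS_gt.
  move: hm; rewrite -(ler_nat R) => hm hlt.
  have xc : cube m x by apply: cube_mem; have := g0 x; lra.
  have M0 : 0 < m.+1%:R :> R by [].
  have gm : g x <= m.+1%:R by rewrite -natr1; lra.
  have vg : 0 <= m.+1%:R * g x by rewrite mulr_ge0.
  have [/andP[l0 lv] /(_ _) l1] := layer_count_itv (m.+1 ^ 2) vg.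
  have {}l1 := l1 _; rewrite /f indicE mem_set// mulr1.
  have hl : m.+1%:R * g x - 1 <= layer_count (m.+1 ^ 2) (m.+1%:R * g x).
    by apply: l1; rewrite natrX expr2 ler_pM2l.
  rewrite -(ler_pM2l M0) -{1}(ger0_norm (ltW M0)) -normrM mulrBr mulrA divff ?lt0r_neq0// !mul1r.
  by rewrite divff ?lt0r_neq0// ler_norml; apply/andP; split; lra.
- by move=> m x; have /andP[h1 h2] := fle m x; rewrite ger0_norm.
Qed.

Lemma gaussians_dense f : L2 lebesgue_rV f -> P f.
Proof.
have real_case (g : 'rV[R]_n -> R) : L2 lebesgue_rV (fun x => (g x)%:C) -> Q g.
  move=> Lg; have [[mg _] _] := Lg; rewrite /= in mg.
  have mp : measurable_fun setT (fun x => Num.max (g x) 0) by exact: measurable_maxr.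
  have mn : measurable_fun setT (fun x => Num.max (- g x) 0).
    by apply: measurable_maxr => //; exact: measurableT_comp.
  have cm (h : 'rV[R]_n -> R) : measurable_fun setT h -> cmeasurable_fun setT (fun x => (h x)%:C).
    by move=> mh; split => //=; exact: measurable_cst.
  apply: (@Q_ext (fun x => Num.max (g x) 0 - Num.max (- g x) 0)); last first.
    by move=> x; case: (leP (g x) 0); case: (leP (- g x) 0); lra.
  apply: QB; apply: Q_nonneg => //; try by move=> x; rewrite le_max lexx orbT.
  + apply: (L2_le (cm _ mp) Lg) => x; rewrite !normc_real.
    by case: (leP (g x) 0); rewrite ?normr0.
  + apply: (L2_le (cm _ mn) Lg) => x; rewrite !normc_real -(normrN (g x)).
    by case: (leP (- g x) 0); rewrite ?normr0.
move=> Lf; have [[mR mI] _] := Lf.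
have LR : L2 lebesgue_rV (fun x => (complex.Re (f x))%:C).
  have cRe : cmeasurable_fun setT (fun x => (complex.Re (f x))%:C).
    by split => //=; exact: measurable_cst.
  by apply: (L2_le cRe Lf) => x; rewrite normc_real; exact: normc_Re_le.
have LI : L2 lebesgue_rV (fun x => (complex.Im (f x))%:C).
  have cIm : cmeasurable_fun setT (fun x => (complex.Im (f x))%:C).
    by split => //=; exact: measurable_cst.
  by apply: (L2_le cIm Lf) => x; rewrite normc_real; exact: normc_Im_le.
rewrite (_ : f = fun x => (complex.Re (f x))%:C + 'i * (complex.Im (f x))%:C).
  by apply: PD; [exact: real_case|apply: PZ; exact: real_case].
by apply/funext => x; rewrite -complexE.
Qed.

End gaussian_density.

(** * Integrals of nonnegative functions *)

Section nonnegative_integrals.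
Local Open Scope ereal_scope.
Context d (T : measurableType d) (R : realType).
Variable mu : {measure set T -> \bar R}.

(* No measurability is required here: the integral of a nonnegative function is
   a supremum over the simple functions below it. *)
Lemma ge0_integral_mono (f g : T -> \bar R) : (forall x, 0 <= f x) ->
  (forall x, f x <= g x) -> \int[mu]_x f x <= \int[mu]_x g x.
Proof.
move=> f0 fg; have g0 x : 0 <= g x := le_trans (f0 x) (fg x).
rewrite !ge0_integralTE//; apply: le_ereal_sup => _ [h hf <-]; exists h => //= x.
exact: le_trans (hf x) (fg x).
Qed.

(** The complement of D is null for the restricted measure, and both measures agree on subsets of
    D. *)
Lemma integral_mrestr (D : set T) (mD : measurable D) (f : T -> \bar R) :
  measurable_fun setT f -> (forall x, 0 <= f x) ->
  \int[mrestr mu mD]_x f x = \int[mu]_x ((\1_D x)%:E * f x).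
Proof.
move=> mf f0; rewrite [LHS](@ge0_negligible_integral _ _ _ _ setT (~` D))//; last 2 first.
- exact: measurableC.
- by rewrite /= /mrestr setICl measure0.
rewrite setDE setCK setTI (@eq_measure_integral _ _ _ _ mu)/=; last first.
  by move=> A mA AD; rewrite /mrestr setIidl.
rewrite integral_mkcond; apply: eq_integral => x _.
by rewrite epatch_indic muleC.
Qed.

End nonnegative_integrals.

(** * Dilations, directions and power integrals *)

Section scaling.
Local Open Scope ereal_scope.
Context {R : realType}.

(** By uniqueness of Lebesgue measure: c times its image under t -> c t has the right value on
    half-open intervals. *)
Lemma integral_scale1 (c : R) (h : measurableTypeR R -> \bar R) : (0 < c)%R ->
  measurable_fun setT h -> (forall t, 0 <= h t) ->
  \int[lebesgue_measure]_t h t = c%:E * \int[lebesgue_measure]_t h (c * t)%R.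
Proof.
move=> c0 mh h0.
have mc : measurable_fun [set: measurableTypeR R] (fun t : measurableTypeR R => (c * t)%R : measurableTypeR R).
  exact: measurable_funM.
pose nu : {measure set (measurableTypeR R) -> \bar R} :=
  measure_function_pushforward__canonical__measure_function_Measure lebesgue_measure mc.
pose k : {nonneg R} := NngNum (ltW c0).
have E : forall A : set (measurableTypeR R), measurable A -> lebesgue_measure A = mscale k nu A.
  apply: (@lebesgue_measure_unique _ (mscale k nu)) => _ [[a b] _ <-] /=.
  rewrite /mscale /= /pushforward (_ : _ @^-1` _ = `](a / c)%R, (b / c)%R]%classic); last first.
    apply/seteqP; split => t; rewrite /= !in_itv /= ltr_pdivrMr// ler_pdivlMr//.
      by rewrite mulrC.
    by rewrite mulrC.
  rewrite !lebesgue_measure_itv /= !lte_fin ltr_pM2r ?invr_gt0//.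
  case: ifPn => _; last by rewrite mule0.
  rewrite -!EFinD -EFinM; congr EFin.
  by field; rewrite lt0r_neq0.
rewrite (@eq_measure_integral _ _ _ _ (mscale k nu)); last by move=> A mA _; exact: E.
rewrite ge0_integral_mscale//= [X in _ * X](ge0_integral_pushforward mc lebesgue_measure)//.
Qed.

Lemma rV_cons_scale n (c t : R) (y : 'rV[R]_n) :
  rV_cons ((c * t)%R, (c *: y)%R) = (c *: rV_cons (t, y))%R.
Proof.
apply/rowP => i; rewrite /rV_cons !mxE /=.
by case: unliftP => [j _|_] //=; rewrite mxE.
Qed.

Lemma measurable_rV_scale n (c : R) : measurable_fun setT (fun x : 'rV[R]_n => (c *: x)%R).
Proof.
apply: measurable_fun_rV => i; under eq_fun do rewrite mxE.
by apply: measurable_funM => //; exact: measurable_rV_coord.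
Qed.

Lemma integral_scale n (c : R) (F : 'rV[R]_n -> \bar R) : (0 < c)%R ->
  measurable_fun setT F -> (forall x, 0 <= F x) ->
  \int[lebesgue_rV]_x F x = (c ^+ n)%:E * \int[lebesgue_rV]_x F (c *: x)%R.
Proof.
move=> c0; elim: n F => [|n ih] F mF F0.
  by rewrite expr0 mul1e; apply: eq_integral => x _; rewrite [x]thinmx0 scaler0.
have mFc : measurable_fun setT (fun x : 'rV[R]_n.+1 => F (c *: x)%R).
  by apply: measurableT_comp => //; exact: measurable_rV_scale.
have mG : measurable_fun setT (F \o @rV_cons R n).
  exact: (measurableT_comp mF (@measurable_rV_cons R n)).
have mGt t : measurable_fun setT (fun y => F (rV_cons (t, y))).
  exact: (measurableT_comp mG (@pair1_measurable _ _ _ _ t)).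
rewrite ge0_integral_rV_cons// [in RHS]ge0_integral_rV_cons//.
rewrite (@integral_scale1 c)//; last 2 first.
- by apply: (@measurable_fun_fubini_tonelli_F _ _ _ _ R lebesgue_rV (F \o @rV_cons R n)) => // z; exact: F0.
- by move=> t; exact: integral_ge0.
rewrite exprS EFinM -muleA; congr (_ * _).
have mGc : measurable_fun setT ((fun x : 'rV[R]_n.+1 => F (c *: x)%R) \o @rV_cons R n).
  exact: (measurableT_comp mFc (@measurable_rV_cons R n)).
rewrite -ge0_integralZl//; last 3 first.
- by apply: (@measurable_fun_fubini_tonelli_F _ _ _ _ R lebesgue_rV ((fun x : 'rV[R]_n.+1 => F (c *: x)%R) \o @rV_cons R n)) => // z; exact: F0.
- by move=> t _; exact: integral_ge0.
- by rewrite lee_fin exprn_ge0// ltW.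
apply: eq_integral => t _; rewrite ih//.
by congr (_ * _); apply: eq_integral => y _; rewrite rV_cons_scale.
Qed.

Lemma enorm_ge0 n (x : 'rV[R]_n) : (0 <= enorm x)%R.
Proof. exact: sqrtr_ge0. Qed.

Lemma enormZ n (c : R) (x : 'rV[R]_n) : (0 <= c)%R -> enorm (c *: x)%R = (c * enorm x)%R.
Proof.
move=> c0; rewrite /enorm; have -> : (\sum_i (c *: x) ord0 i ^+ 2 = c ^+ 2 * \sum_i x ord0 i ^+ 2)%R.
  by rewrite mulr_sumr; apply: eq_bigr => i _; rewrite mxE exprMn.
by rewrite sqrtrM ?sqr_ge0// sqrtr_sqr ger0_norm.
Qed.

Lemma enorm_eq0 n (x : 'rV[R]_n) : (enorm x == 0)%R = (x == 0)%R.
Proof.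
apply/eqP/eqP => [e|->]; last first.
  by rewrite /enorm big1 ?sqrtr0// => i _; rewrite mxE expr0n.
apply/rowP => i; rewrite mxE; apply/eqP; rewrite -sqrf_eq0.
have : (sqnorm x == 0)%R by rewrite -enorm_sqr e expr0n.
by rewrite psumr_eq0 => [/allP/(_ i (mem_index_enum i))|j _]; last exact: sqr_ge0.
Qed.

Lemma enorm_gt0 n (x : 'rV[R]_n) : (0 < enorm x)%R = (x != 0)%R.
Proof. by rewrite lt_neqAle enorm_ge0 andbT eq_sym enorm_eq0. Qed.

Lemma enorm_direction n (x : 'rV[R]_n) : (x != 0)%R -> enorm (direction x) = 1%R.
Proof.
rewrite -enorm_gt0 => x0; rewrite /direction enormZ ?invr_ge0 ?ltW//.
by rewrite mulVf// lt0r_neq0.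
Qed.

Lemma directionZ n (c : R) (x : 'rV[R]_n) : (0 < c)%R -> direction (c *: x)%R = direction x.
Proof.
move=> c0; rewrite /direction enormZ ?ltW// scalerA invfM mulrAC mulVf ?mul1r//.
by rewrite lt0r_neq0.
Qed.

Lemma direction_idem n (x : 'rV[R]_n) : direction (direction x) = direction x.
Proof.
have [->|x0] := eqVneq x 0%R; first by rewrite /direction !scaler0.
by rewrite {1}/direction enorm_direction// invr1 scale1r.
Qed.

Lemma enorm_scale_direction n (x : 'rV[R]_n) : (enorm x *: direction x = x)%R.
Proof.
have [->|x0] := eqVneq x 0%R; first by rewrite /direction !scaler0.
by rewrite /direction scalerA divff ?scale1r// enorm_eq0.
Qed.

Lemma measurable_set0_rV n : measurable [set 0%R : 'rV[R]_n].
Proof.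
rewrite (_ : [set 0%R] = @enorm R n @^-1` [set 0%R]).
  by rewrite -[X in measurable X]setTI; exact: measurable_enorm.
apply/seteqP; split => x /=; first by move=> ->; apply/eqP; rewrite enorm_eq0.
by move=> /eqP; rewrite enorm_eq0 => /eqP.
Qed.

(** Only the slice t = 0 meets the origin, and a point is null on the line. In dimension 0 the
    measure is a Dirac mass, hence the successor. *)
Lemma lebesgue_rV_set0 n : lebesgue_rV [set 0%R : 'rV[R]_n.+1] = 0.
Proof.
have m0 := @measurable_set0_rV n.+1.
pose F (x : 'rV[R]_n.+1) := (\1_[set 0%R : 'rV[R]_n.+1] x)%:E : \bar R.
have mF : measurable_fun setT F by exact/measurable_EFinP/measurable_indic.
have F0 x : 0 <= F x by rewrite lee_fin.
have mG : measurable_fun setT (F \o @rV_cons R n).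
  exact: (measurableT_comp mF (@measurable_rV_cons R n)).
rewrite -[X in lebesgue_rV X](setIT [set 0%R]) -integral_indic// ge0_integral_rV_cons//.
rewrite (@ge0_negligible_integral _ _ _ _ setT ([set 0%R] : set (measurableTypeR R)))//; last 3 first.
- by apply: (@measurable_fun_fubini_tonelli_F _ _ _ _ R lebesgue_rV (F \o @rV_cons R n)) => // z; exact: F0.
- by move=> t _; apply: integral_ge0.
- exact: lebesgue_measure_set1.
apply: integral0_eq => t [_ /= /eqP t0]; apply: integral0_eq => y _.
rewrite indicE memNset//= => e; move/eqP: t0; apply.
have := congr1 (fun z : 'rV[R]_n.+1 => z ord0 ord0) e.
by rewrite !mxE unlift_none.
Qed.

Lemma line_deriveX (f : R -> R) (t a : R) k : is_derive t 1%R f a ->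
  is_derive t 1%R (fun s => f s ^+ k.+1)%R (k.+1%:R * f t ^+ k * a)%R.
Proof.
move=> hf; elim: k => [|k ih].
  rewrite (_ : (fun s => _) = f); last by apply/funext => s; rewrite expr1.
  by rewrite expr0 mulr1 mul1r.
rewrite (_ : (fun s => _) = (fun s => f s * f s ^+ k.+1)%R); last first.
  by apply/funext => s; rewrite exprS.
apply: (is_derive_eq (line_deriveM hf ih)).
by rewrite -[k.+2%:R]natr1 exprS; ring.
Qed.

Lemma line_deriveV (t : R) : (0 < t)%R -> is_derive t 1%R (fun s : R => s^-1)%R (- t ^- 2)%R.
Proof.
move=> t0; apply: (is_derive_eq (@is_deriveV _ id t _ _ (lt0r_neq0 t0) (is_derive_id t 1%R))).
by rewrite -[_ *: _]/(_ * _)%R mulr1.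
Qed.

Lemma integral_tail n (a : R) : (0 < a)%R ->
  \int[lebesgue_measure]_(t in `[a, +oo[) (n.+1%:R * t^-1 ^+ n.+2)%:E = (a^-1 ^+ n.+1)%:E.
Proof.
move=> a0.
have dp k (t : R) : (0 < t)%R -> is_derive t 1%R (fun s : R => s^-1 ^+ k.+1)%R
    (k.+1%:R * t^-1 ^+ k * - t ^- 2)%R.
  by move=> t0; exact: line_deriveX (line_deriveV t0).
have dF (t : R) : (0 < t)%R -> is_derive t 1%R (fun s : R => -1 * s^-1 ^+ n.+1)%R (n.+1%:R * t^-1 ^+ n.+2)%R.
  move=> t0; apply: (is_derive_eq (line_deriveZ (-1)%R (dp n t t0))).
  by rewrite (exprS _ n.+1) (exprS _ n) -[(t ^- 2)%R]exprVn expr2; ring.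
have cont (f : R -> R) (t df : R) : is_derive t 1%R f df -> f x @[x --> t] --> f t.
  by move=> [h _]; apply: differentiable_continuous; exact/derivable1_diffP.
rewrite (@ge0_continuous_FTC2y _ _ (fun s : R => -1 * s^-1 ^+ n.+1)%R _ 0%R).
- by rewrite sub0e -EFinN mulN1r opprK.
- move=> x ax; rewrite mulr_ge0// exprn_ge0// invr_ge0.
  exact: le_trans (ltW a0) ax.
- apply: derivable_within_continuous => x; rewrite in_itv /= andbT => ax.
  by have [] := line_deriveZ n.+1%:R (dp n.+1 x (lt_le_trans a0 ax)).
- apply/cvgrPdist_le => e e0; near=> t.
  have t1 : (1 <= t)%R by near: t; exact: nbhs_pinfty_ge.
  have te : (e^-1 <= t)%R by near: t; apply: nbhs_pinfty_ge; exact: num_real.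
  have t0 : (0 < t)%R by exact: lt_le_trans t1.
  rewrite sub0r mulN1r opprK ger0_norm ?exprn_ge0 ?invr_ge0 ?(ltW t0)//.
  apply: (@le_trans _ _ (t^-1)%R); last by rewrite -[leRHS]invrK lef_pV2 ?posrE ?invr_gt0.
  by rewrite exprS ler_piMr ?invr_ge0 ?(ltW t0)// exprn_ile1 ?invr_ge0 ?(ltW t0)// invf_le1.
- by move=> x ax; have [] := dF x (lt_trans a0 ax).
- by apply: cvg_at_right_filter; exact: cont (dF a a0).
- move=> x; rewrite in_itv /= andbT => ax.
  by rewrite derive1E; have [_ ->] := dF x (lt_trans a0 ax).
Unshelve. all: by end_near. Qed.

End scaling.

(** * Surface measure and polar coordinates *)

Section surface_integral.
Local Open Scope ereal_scope.

Lemma integral_surface {R : realType} (n : nat) (phi : 'rV[R]_n -> \bar R) : measurable_fun setT phi ->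
  (forall x, 0 <= phi x) -> \int[surface_measure]_x phi x =
  n%:R%:E * \int[lebesgue_rV]_x ((\1_(@unit_ball R n) x)%:E * phi (direction x)).
Proof.
move=> mp p0.
pose nu : {measure set 'rV[R]_n -> \bar R} :=
  measure_function_pushforward__canonical__measure_function_Measure
    (mrestr lebesgue_rV (@measurable_unit_ball R n)) (@measurable_direction R n).
pose k : {nonneg R} := NngNum (ler0n R n).
transitivity (\int[mscale k nu]_x phi x).
  by apply: eq_measure_integral => A mA _.
transitivity (k%:num%:E * \int[nu]_x phi x); first exact: ge0_integral_mscale.
congr (_ * _).
transitivity (\int[mrestr lebesgue_rV (@measurable_unit_ball R n)]_x phi (direction x)).
  have := @ge0_integral_pushforward _ _ _ _ R _ (@measurable_direction R n)
    (mrestr lebesgue_rV (@measurable_unit_ball R n)) setT phi measurableT mp (fun x _ => p0 x).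
  by rewrite preimage_setT.
rewrite integral_mrestr//.
by apply: measurableT_comp => //; exact: measurable_direction.
Qed.

End surface_integral.

Section polar_coordinates.
Local Open Scope ereal_scope.
Context {R : realType} (n : nat).
Local Notation N := n.+2.
Local Notation X := 'rV[R]_N.
Local Notation line := (measurableTypeR R).

(** The weights r^(n+1) and t^-(n+3), both extended by 0 to the negative half-line so that every
    integral runs over the whole line; [powR] sends 0 to 0 for the exponent -1. *)
Let w (r : R) : R := (Num.max r 0 ^+ n.+1)%R.
Let v (t : R) : R := ((Num.max t 0 `^ (-1)) ^+ n.+3)%R.

Let w0 r : (0 <= w r)%R.
Proof. by rewrite exprn_ge0// le_max lexx orbT. Qed.

Let v0 t : (0 <= v t)%R.
Proof. by rewrite exprn_ge0// powR_ge0. Qed.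

Let mw : measurable_fun setT (fun p : line * X => w p.1).
Proof. by apply: measurable_funX; exact: measurable_maxr. Qed.

Let mv : measurable_fun setT (fun p : line * X => v p.1).
Proof.
apply: measurable_funX; apply: (measurableT_comp (f := fun y : R => (y `^ (-1))%R)).
  exact: measurable_powR.
exact: measurable_maxr.
Qed.

Let men : measurable_fun setT (fun p : line * X => enorm p.2).
Proof. by apply: measurableT_comp => //; exact: measurable_enorm. Qed.

Let mball : measurable_fun setT (fun p : line * X => \1_(@unit_ball R N) p.2 : R).
Proof.
have mi : measurable_fun setT (\1_(@unit_ball R N) : X -> R).
  by apply: measurable_indic; exact: measurable_unit_ball.
exact: (measurableT_comp mi (@measurable_snd _ _ _ _)).
Qed.

Let mscale_rV (x : line * X -> X) : measurable_fun setT x ->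
  measurable_fun setT (fun p : line * X => (p.1 *: x p)%R).
Proof.
move=> mx; apply: measurable_fun_rV => i; under eq_fun do rewrite mxE.
apply: measurable_funM => //.
exact: (measurableT_comp (measurable_rV_coord i) mx).
Qed.

Lemma eq_integral_nonzero (f g : X -> \bar R) : measurable_fun setT f ->
  measurable_fun setT g -> (forall x, 0 <= f x) -> (forall x, 0 <= g x) ->
  (forall x, x != 0%R -> f x = g x) ->
  \int[lebesgue_rV]_x f x = \int[lebesgue_rV]_x g x.
Proof.
move=> mf mg f0 g0 fg.
have m0 := @measurable_set0_rV R N.
rewrite (@ge0_negligible_integral _ _ _ _ setT [set 0%R : X] f)//; last first.
  exact: lebesgue_rV_set0.
rewrite [RHS](@ge0_negligible_integral _ _ _ _ setT [set 0%R : X] g)//; last first.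
  exact: lebesgue_rV_set0.
by apply: eq_integral => x; rewrite inE => -[_ /eqP x0]; exact: fg.
Qed.

Let mtail (a : R) : measurable_fun setT (fun t : line => (v t * (a <= t)%R%:R)%:E : \bar R).
Proof.
apply/measurable_EFinP; apply: measurable_funM.
  apply: measurable_funX; apply: (measurableT_comp (f := fun y : R => (y `^ (-1))%R)).
    exact: measurable_powR.
  exact: measurable_maxr.
rewrite (_ : (fun x => _) = \1_(`[a, +oo[%classic : set line)); last first.
  by apply/funext => t; rewrite indicE mem_setE in_itv /= andbT.
exact: measurable_indic.
Qed.

Let tail_integral (a : R) : (0 < a)%R ->
  N%:R%:E * \int[lebesgue_measure]_(t in [set: line]) (v t * (a <= t)%R%:R)%:E = (a ^- N)%:E.
Proof.
move=> a0; rewrite -ge0_integralZl//; last by move=> t _; rewrite lee_fin mulr_ge0.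
rewrite -exprVn -(integral_tail n.+1 a0) [RHS]integral_mkcond; apply: eq_integral => t _.
rewrite patchE mem_setE in_itv /= andbT; case: ifPn => [at_|ta].
  have t0 : (0 < t)%R := lt_le_trans a0 at_.
  by rewrite mulr1 /v (max_l (ltW t0)) powR_inv1 ?ltW// -EFinM.
by rewrite mulr0 mule0.
Qed.

(** The left side averages F(r y / |y|) over y in the unit ball. Substituting r = |y| t at fixed y
    turns [K1] into [K2], with F(t y) and a factor |y|^N; substituting y = x / t at fixed t turns
    [K2] into [K3], with F(x), |x|^N and t^-(N+1) on t >= |x|. The integral in t then equals |x|^-N
    / N and cancels the remaining factors. Only dilations and Tonelli's theorem are involved. *)
Lemma polar_integral (F : X -> \bar R) : measurable_fun setT F -> (forall x, 0 <= F x) ->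
  \int[lebesgue_measure]_(r in [set: line]) ((Num.max r 0 ^+ n.+1)%:E *
    (N%:R%:E * \int[lebesgue_rV]_y ((\1_(@unit_ball R N) y)%:E * F (r *: direction y)%R))) =
  \int[lebesgue_rV]_x F x.
Proof.
move=> mF F0.
pose K1 (p : line * X) := (w p.1 * \1_(@unit_ball R N) p.2)%:E * F (p.1 *: direction p.2)%R.
pose K2 (p : line * X) := (w p.1 * (enorm p.2 ^+ N * \1_(@unit_ball R N) p.2))%:E * F (p.1 *: p.2)%R.
pose K3 (p : line * X) := (v p.1 * (enorm p.2 <= p.1)%R%:R)%:E * ((enorm p.2 ^+ N)%:E * F p.2).
have b0 y : (0 <= \1_(@unit_ball R N) y :> R)%R by rewrite indicE.
have e0 (y : X) k : (0 <= enorm y ^+ k)%R by rewrite exprn_ge0// enorm_ge0.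
have K10 p : 0 <= K1 p by apply: mule_ge0 => //; rewrite lee_fin; exact: mulr_ge0.
have K20 p : 0 <= K2 p by apply: mule_ge0 => //; rewrite lee_fin; exact: (mulr_ge0 (w0 _) (mulr_ge0 (e0 _ _) (b0 _))).
have K30 p : 0 <= K3 p by apply: mule_ge0; [rewrite lee_fin; exact: (mulr_ge0 (v0 _) (ler0n _ _))|apply: mule_ge0 => //; rewrite lee_fin; exact: e0].
have mdir : measurable_fun setT (fun p : line * X => direction p.2).
  by apply: measurableT_comp => //; exact: measurable_direction.
have mK1 : measurable_fun setT K1.
  apply: emeasurable_funM; first by apply/measurable_EFinP; exact: measurable_funM.
  by apply: measurableT_comp => //; exact: mscale_rV.
have mK2 : measurable_fun setT K2.
  apply: emeasurable_funM.
    apply/measurable_EFinP; apply: measurable_funM => //.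
    by apply: measurable_funM => //; exact: measurable_funX.
  by apply: measurableT_comp => //; exact: mscale_rV.
have mK3 : measurable_fun setT K3.
  apply: emeasurable_funM.
    apply/measurable_EFinP; apply: measurable_funM => //.
    rewrite (_ : (fun p => _) = \1_((fun p : line * X => enorm p.2 - p.1)%R @^-1` `]-oo, 0%R])); last first.
      apply/funext => p; rewrite indicE; congr (_%:R); congr nat_of_bool.
      by apply/idP/idP => [h|/set_mem]; [apply/mem_set|]; rewrite /= in_itv /= subr_le0.
    apply: measurable_indic; rewrite -[X in measurable X]setTI.
    by apply: measurable_funB.
  apply: emeasurable_funM; last exact: measurableT_comp.
  by apply/measurable_EFinP; exact: measurable_funX.
have m1 (K : line * X -> \bar R) : measurable_fun setT K -> forall y, measurable_fun setT (fun r : line => K (r, y) : \bar R).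
  by move=> mK y; exact: (measurableT_comp mK (@pair2_measurable _ _ _ _ y)).
have m2 (K : line * X -> \bar R) : measurable_fun setT K -> forall r, measurable_fun setT (fun y : X => K (r, y) : \bar R).
  by move=> mK r; exact: (measurableT_comp mK (@pair1_measurable _ _ _ _ r)).
have mG (K : line * X -> \bar R) : measurable_fun setT K -> (forall p, 0 <= K p) ->
    measurable_fun setT (fun y : X => \int[lebesgue_measure]_(r in [set: line]) K (r, y)).
  by move=> mK K0; exact: (measurable_fun_fubini_tonelli_G (m1 := lebesgue_measure) K mK K0).
have mH (K : line * X -> \bar R) : measurable_fun setT K -> (forall p, 0 <= K p) ->
    measurable_fun setT (fun r : line => \int[lebesgue_rV]_(y in [set: X]) K (r, y)).
  by move=> mK K0; exact: (measurable_fun_fubini_tonelli_F (m2 := lebesgue_rV) K mK K0).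
have N0 : 0 <= N%:R%:E :> \bar R by rewrite lee_fin.
have mi : measurable_fun setT (\1_(@unit_ball R N) : X -> R).
  by apply: measurable_indic; exact: measurable_unit_ball.
transitivity (N%:R%:E * \int[lebesgue_measure]_(r in [set: line]) \int[lebesgue_rV]_(y in [set: X]) K1 (r, y)).
  rewrite -ge0_integralZl//; last 2 first.
  - exact: mH.
  - by move=> r _; apply: integral_ge0.
  apply: eq_integral => r _; rewrite muleCA; congr (_ * _).
  rewrite -ge0_integralZl//; last 3 first.
  - apply: emeasurable_funM; first exact/measurable_EFinP.
    exact: (measurableT_comp mF (measurableT_comp (@measurable_rV_scale R N r) (@measurable_direction R N))).
  - by move=> y _; rewrite mule_ge0.
  - by rewrite lee_fin; exact: w0.
  by apply: eq_integral => y _; rewrite muleA -EFinM.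
rewrite (fubini_tonelli (m1 := lebesgue_measure) (m2 := lebesgue_rV) K1 mK1 K10).
transitivity (N%:R%:E * \int[lebesgue_rV]_(y in [set: X]) \int[lebesgue_measure]_(r in [set: line]) K2 (r, y)).
  apply: (congr1 (fun z => N%:R%:E * z)).
  apply: (@eq_integral_nonzero (fun y => \int[lebesgue_measure]_(r in [set: line]) K1 (r, y))
    (fun y => \int[lebesgue_measure]_(r in [set: line]) K2 (r, y))).
  - exact: mG.
  - exact: mG.
  - by move=> y; apply: integral_ge0.
  - by move=> y; apply: integral_ge0.
  move=> y; rewrite -enorm_gt0 => y0.
  rewrite (@integral_scale1 _ (enorm y))//; last exact: m1.
  have y0' := ltW y0.
  rewrite -ge0_integralZl//; last first.
    exact: (measurableT_comp (m1 _ mK1 y) (@measurable_funM _ _ _ _ _ _ (measurable_cst (enorm y)) (@measurable_id _ line setT))).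
  apply: eq_integral => t _; rewrite /K1 /K2 /=.
  have -> : ((enorm y * t) *: direction y = t *: y)%R.
    by rewrite mulrC -scalerA enorm_scale_direction.
  have -> : (w (enorm y * t) = enorm y ^+ n.+1 * w t)%R.
    by rewrite /w -exprMn maxr_pMr// mulr0.
  by rewrite muleA -EFinM; congr (_%:E * _); rewrite (exprS _ n.+1); ring.
rewrite -(fubini_tonelli (m1 := lebesgue_measure) (m2 := lebesgue_rV) K2 mK2 K20).
transitivity (N%:R%:E * \int[lebesgue_measure]_(t in [set: line]) \int[lebesgue_rV]_(x in [set: X]) K3 (t, x)).
  congr (_ * _); apply: eq_integral => t _.
  have [t0|t0] := leP t 0%R.
    have z0 : (w t = 0)%R by rewrite /w (max_r t0) expr0n.
    have z1 : (v t = 0)%R by rewrite /v (max_r t0) powR0 ?expr0n// oppr_eq0 oner_eq0.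
    rewrite !integral0_eq// => y _; first by rewrite /K3 /= z1 mul0r mul0e.
    by rewrite /K2 /= z0 mul0r mul0e.
  rewrite [RHS](@integral_scale _ _ t)//; last exact: m2.
  rewrite -ge0_integralZl//; last 2 first.
  - exact: (measurableT_comp (m2 _ mK3 t) (measurable_rV_scale t)).
  - by rewrite lee_fin exprn_ge0// ltW.
  apply: eq_integral => y _; rewrite /K2 /K3 /= !muleA -!EFinM; congr (_%:E * _).
  have -> : (\1_(@unit_ball R N) y = (enorm y <= 1)%R%:R :> R)%R.
    by rewrite indicE; congr (_%:R); congr nat_of_bool; apply/idP/idP => [/set_mem|/mem_set].
  have h1 : (t^-1 ^+ N * t ^+ N = 1)%R by rewrite -exprMn mulVf ?expr1n// lt0r_neq0.
  have h2 : (t^-1 * t = 1)%R by rewrite mulVf// lt0r_neq0.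
  rewrite (enormZ _ (ltW t0)) /w /v (max_l (ltW t0)) (powR_inv1 (ltW t0)) ger_pMr// exprMn.
  rewrite (exprS _ n.+2); move: (enorm y ^+ N)%R (_ <= 1)%R%:R => p q.
  transitivity ((t^-1 * t) * (t^-1 ^+ N * t ^+ N) * (t ^+ n.+1 * (p * q)))%R.
    by rewrite h1 h2 !mul1r.
  by rewrite {2}(exprS t n.+1); ring.
rewrite (fubini_tonelli (m1 := lebesgue_measure) (m2 := lebesgue_rV) K3 mK3 K30).
rewrite -ge0_integralZl//; last 2 first.
- exact: mG.
- by move=> y _; apply: integral_ge0.
apply: eq_integral_nonzero => //.
- by apply: emeasurable_funM => //; exact: mG.
- by move=> y; rewrite mule_ge0//; apply: integral_ge0.
move=> x; rewrite -enorm_gt0 => x0.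
transitivity (N%:R%:E * \int[lebesgue_measure]_(t in [set: line])
  ((v t * (enorm x <= t)%R%:R)%:E * ((enorm x ^+ N)%:E * F x))) => //.
rewrite ge0_integralZr//.
- rewrite muleA tail_integral// muleA -EFinM mulVf ?mul1e//.
  by rewrite expf_neq0// lt0r_neq0.
- by move=> t _; rewrite lee_fin mulr_ge0.
- by rewrite mule_ge0// lee_fin; exact: e0.
Qed.

End polar_coordinates.

(** * The lift Q and the projection P do not increase norms *)

Section sphere_projections.
Context {R : realType}.

Lemma conjc_ReIm (z : R[i]) : complex.Re z^* = complex.Re z /\ complex.Im z^* = - complex.Im z.
Proof. by case: z. Qed.

(** Let z be the integral. Then |z|^2 is the integral of Re (conj(z) u conj(Y)), and pointwise this
    is at most |u|^2 / 2 + |z|^2 |Y|^2 / 2. As Y has energy at most 1, half of |z|^2 is absorbed on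
    the left. *)
Lemma cintegral_cauchy_schwarz d (T : measurableType d) (mu : {measure set T -> \bar R})
    (u Y : T -> R[i]) : cmeasurable_fun setT u -> cmeasurable_fun setT Y ->
  (energy mu Y <= 1)%E ->
  ((normc (cintegral mu (fun x => u x * (Y x)^*)) ^+ 2)%:E <= energy mu u)%E.
Proof.
move=> mu_ mY EY1; have [uoo|] := ltP (energy mu u) +oo%E; last by rewrite leye_eq => /eqP ->; exact: leey.
set z := cintegral _ _; set a := complex.Re z; set b := complex.Im z.
pose p x := normc (u x) ^+ 2; pose q x := normc (Y x) ^+ 2.
have [m1 m2] := mu_; have [m3 m4] := mY.
have ip : mu.-integrable setT (EFin \o p).
  apply/integrableP; split; first exact/measurable_EFinP/measurable_normc_sqr.
  by under eq_integral do rewrite /= ger0_norm ?sqr_ge0//.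
have iq : mu.-integrable setT (EFin \o q).
  apply/integrableP; split; first exact/measurable_EFinP/measurable_normc_sqr.
  under eq_integral do rewrite /= ger0_norm ?sqr_ge0//.
  by apply: le_lt_trans EY1 _; rewrite ltry.
pose w1 x := complex.Re (u x) * complex.Re (Y x) + complex.Im (u x) * complex.Im (Y x).
pose w2 x := complex.Im (u x) * complex.Re (Y x) - complex.Re (u x) * complex.Im (Y x).
have aE : a = Rintegral mu setT w1.
  rewrite /a /z /cintegral /=; apply: eq_Rintegral => x _.
  by rewrite ReM; have [-> ->] := conjc_ReIm (Y x); rewrite mulrN opprK.
have bE : b = Rintegral mu setT w2.
  rewrite /b /z /cintegral /=; apply: eq_Rintegral => x _.
  by rewrite ImM; have [-> ->] := conjc_ReIm (Y x); rewrite mulrN addrC.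
have ipq : mu.-integrable setT (EFin \o (fun x => p x + q x)).
  by have := integrableD measurableT ip iq; apply: eq_integrable.
have i1 : mu.-integrable setT (EFin \o w1).
  apply: (le_integrable measurableT _ _ ipq).
    by apply/measurable_EFinP; apply: measurable_funD; exact: measurable_funM.
  move=> x _ /=; rewrite lee_fin [leRHS]ger0_norm ?addr_ge0 ?sqr_ge0//.
  rewrite /p /q !normc_sqr /w1; move: (complex.Re _) (complex.Im _) (complex.Re _) (complex.Im _) => r1 r2 r3 r4.
  rewrite ler_norml; have := sqr_ge0 (r1 - r3); have := sqr_ge0 (r1 + r3).
  have := sqr_ge0 (r2 - r4); have := sqr_ge0 (r2 + r4).
  have := sqr_ge0 r1; have := sqr_ge0 r2; have := sqr_ge0 r3; have := sqr_ge0 r4.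
  by move=> *; apply/andP; split; lra.
have i2 : mu.-integrable setT (EFin \o w2).
  apply: (le_integrable measurableT _ _ ipq).
    by apply/measurable_EFinP; apply: measurable_funB; exact: measurable_funM.
  move=> x _ /=; rewrite lee_fin [leRHS]ger0_norm ?addr_ge0 ?sqr_ge0//.
  rewrite /p /q !normc_sqr /w2; move: (complex.Im _) (complex.Re _) (complex.Re _) (complex.Im _) => r1 r2 r3 r4.
  rewrite ler_norml; have := sqr_ge0 (r1 - r2); have := sqr_ge0 (r1 + r2).
  have := sqr_ge0 (r3 - r4); have := sqr_ge0 (r3 + r4).
  have := sqr_ge0 r1; have := sqr_ge0 r2; have := sqr_ge0 r3; have := sqr_ge0 r4.
  by move=> *; apply/andP; split; nra.
have ia1 : mu.-integrable setT (EFin \o (fun x => a * w1 x)).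
  by have := integrableZl measurableT a i1; apply: eq_integrable.
have ib2 : mu.-integrable setT (EFin \o (fun x => b * w2 x)).
  by have := integrableZl measurableT b i2; apply: eq_integrable.
have ip2 : mu.-integrable setT (EFin \o (fun x => 2^-1 * p x)).
  by have := integrableZl measurableT 2^-1 ip; apply: eq_integrable.
have iq2 : mu.-integrable setT (EFin \o (fun x => (a ^+ 2 + b ^+ 2) / 2 * q x)).
  by have := integrableZl measurableT ((a ^+ 2 + b ^+ 2) / 2) iq; apply: eq_integrable.
have i3 : mu.-integrable setT (EFin \o (fun x => a * w1 x + b * w2 x)).
  by have := integrableD measurableT ia1 ib2; apply: eq_integrable.
have i4 : mu.-integrable setT (EFin \o (fun x => 2^-1 * p x + (a ^+ 2 + b ^+ 2) / 2 * q x)).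
  by have := integrableD measurableT ip2 iq2; apply: eq_integrable.
have := le_Rintegral measurableT i3 i4; rewrite !RintegralD// !RintegralZl// -aE -bE => H.
pose EU := Rintegral mu setT p; pose EY := Rintegral mu setT q.
have EUE : energy mu u = EU%:E by rewrite /EU /Rintegral fineK// ge0_fin_numE ?energy_ge0.
have EYE : energy mu Y = EY%:E.
  by rewrite /EY /Rintegral fineK// ge0_fin_numE ?energy_ge0//; apply: le_lt_trans EY1 _; rewrite ltry.
rewrite EUE lee_fin normc_sqr -/a -/b.
move: EY1; rewrite EYE lee_fin => EY1.
have {}H : a * a + b * b <= 2^-1 * EU + (a ^+ 2 + b ^+ 2) / 2 * EY.
  apply: H => x _; rewrite /w1 /w2 /p /q !normc_sqr.
  move: (complex.Re (u x)) (complex.Im (u x)) (complex.Re (Y x)) (complex.Im (Y x)) => u1 u2 y1 y2.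
  have := sqr_ge0 (u1 - (a * y1 - b * y2)); have := sqr_ge0 (u2 - (a * y2 + b * y1)).
  by move=> h1 h2; lra.
have k0 : 0 <= a ^+ 2 + b ^+ 2 by rewrite addr_ge0 ?sqr_ge0.
have := ler_wpM2l k0 EY1; lra.
Qed.

Section dimension.
Variable n : nat.
Local Notation N := n.+2.
Local Notation X := 'rV[R]_N.
Implicit Types (Y f : X -> R[i]) (g : R -> R[i]).
Local Open Scope ereal_scope.

Let radial_energy g := \int[lebesgue_measure]_(r in `[0%R, +oo[)
  ((normc (g r) ^+ 2)%R * r ^+ n.+1)%:E.

Lemma radial_energyE g : radial_energy g =
  \int[lebesgue_measure]_(r in [set: measurableTypeR R])
    ((if (0 <= r)%R then normc (g r) ^+ 2 else 0) * Num.max r 0 ^+ n.+1)%:E.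
Proof.
rewrite /radial_energy integral_mkcond; apply: eq_integral => r _.
by rewrite patchE mem_setE in_itv /= andbT; case: leP => [r0|r0] //; rewrite mul0r.
Qed.

Lemma radial_normP g (e : R) : (0 <= e)%R ->
  (radial_norm N g <= e%:E) = (radial_energy g <= (e ^+ 2)%:E).
Proof.
move=> e0; rewrite poweR_half_le//; apply: integral_ge0 => r.
by rewrite /= in_itv /= andbT => r0; rewrite lee_fin mulr_ge0 ?sqr_ge0 ?exprn_ge0.
Qed.

Lemma lift_Q_measurable Y g : cmeasurable_fun setT Y ->
  cmeasurable_fun (`[0%R, +oo[ : set R) g -> cmeasurable_fun setT (lift_Q Y g : X -> R[i]).
Proof.
move=> [mR mI] [gR gI].
have mi : measurable (`[0%R, +oo[%classic : set R) by [].
have H (h : R -> R) : measurable_fun (`[0%R, +oo[ : set R) h ->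
    measurable_fun setT (fun x : X => h (enorm x)).
  move=> mh; rewrite (_ : (fun _ => _) = (h \_ `[0%R, +oo[) \o @enorm R N).
    exact: (measurableT_comp ((measurable_restrictT h mi).1 mh) (@measurable_enorm R N)).
  by apply/funext => x /=; rewrite patchE mem_setE in_itv /= andbT enorm_ge0.
have D (h : X -> R) : measurable_fun setT h -> measurable_fun setT (fun x : X => h (direction x)).
  by move=> mh; exact: (measurableT_comp mh (@measurable_direction R N)).
by apply: cmeasurableM; split => /=; [exact: (H _ gR)|exact: (H _ gI)|exact: (D _ mR)|exact: (D _ mI)].
Qed.

Lemma lift_Q_energy Y g : cmeasurable_fun setT Y ->
  cmeasurable_fun (`[0%R, +oo[ : set R) g -> energy surface_measure Y = 1 ->
  energy lebesgue_rV (lift_Q Y g : X -> R[i]) = radial_energy g.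
Proof.
move=> mY mg EY; have mQ := lift_Q_measurable mY mg.
have mYd : cmeasurable_fun setT (fun y : X => Y (direction y)).
  by split; [exact: (measurableT_comp mY.1 (@measurable_direction R N))|exact: (measurableT_comp mY.2 (@measurable_direction R N))].
have mb : measurable_fun setT (\1_(@unit_ball R N) : X -> R).
  by apply: measurable_indic; exact: measurable_unit_ball.
rewrite /energy -polar_integral//; last 2 first.
- exact/measurable_EFinP/measurable_normc_sqr.
- by move=> x; rewrite lee_fin sqr_ge0.
rewrite radial_energyE; apply: eq_integral => r _.
have [r0|r0] := leP r 0%R.
  by rewrite expr0n /= mul0e mulr0.
rewrite (ltW r0) mulrC EFinM; congr (_ * _).
pose k := (normc (g r) ^+ 2)%R.
transitivity (N%:R%:E * \int[lebesgue_rV]_y (k%:E *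
    ((\1_(@unit_ball R N) y)%:E * (normc (Y (direction y)) ^+ 2)%:E))).
  congr (_ * _); apply: eq_integral_nonzero.
  - apply: emeasurable_funM; first exact/measurable_EFinP.
    apply/measurable_EFinP/measurable_normc_sqr.
    have ms := measurableT_comp (@measurable_rV_scale R N r) (@measurable_direction R N).
    by split; [exact: (measurableT_comp mQ.1 ms)|exact: (measurableT_comp mQ.2 ms)].
  - apply: emeasurable_funM => //; apply: emeasurable_funM; first exact/measurable_EFinP.
    exact/measurable_EFinP/measurable_normc_sqr.
  - by move=> y; rewrite mule_ge0// lee_fin ?sqr_ge0// indicE.
  - by move=> y; rewrite !mule_ge0// lee_fin ?sqr_ge0// indicE.
  move=> y y0; rewrite muleCA; congr (_ * _).
  rewrite -EFinM /lift_Q enormZ ?(ltW r0)// enorm_direction// mulr1 directionZ// direction_idem.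
  by rewrite ComplexField.Normc.normcM exprMn.
rewrite ge0_integralZl//; last 3 first.
- apply: emeasurable_funM; first exact/measurable_EFinP.
  exact/measurable_EFinP/measurable_normc_sqr.
- by move=> y _; rewrite mule_ge0// lee_fin ?sqr_ge0// indicE.
- by rewrite lee_fin sqr_ge0.
rewrite muleCA -(@integral_surface _ _ (fun y => (normc (Y y) ^+ 2)%:E)).
- by rewrite -/(energy surface_measure Y) EY mule1.
- exact/measurable_EFinP/measurable_normc_sqr.
- by move=> y; rewrite lee_fin sqr_ge0.
Qed.

(** Cauchy-Schwarz on the sphere for each r, then polar coordinates. Comparing the radial integrals
    by [ge0_integral_mono] avoids proving that [proj_P Y f] is measurable in r. *)
Lemma proj_P_energy Y f : cmeasurable_fun setT Y -> cmeasurable_fun setT f ->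
  energy surface_measure Y = 1 ->
  radial_energy (proj_P Y f) <= energy lebesgue_rV f.
Proof.
move=> mY mf EY; rewrite radial_energyE /energy -polar_integral//; last 2 first.
- exact/measurable_EFinP/measurable_normc_sqr.
- by move=> x; rewrite lee_fin sqr_ge0.
apply: ge0_integral_mono => r.
  by rewrite lee_fin mulr_ge0 ?exprn_ge0 ?le_max ?lexx ?orbT//; case: ifP => // _; rewrite sqr_ge0.
have mfr : cmeasurable_fun setT (fun y : X => f (r *: y)%R).
  by split; [exact: (measurableT_comp mf.1 (@measurable_rV_scale R N r))|exact: (measurableT_comp mf.2 (@measurable_rV_scale R N r))].
rewrite -(@integral_surface _ _ (fun y => (normc (f (r *: y)%R) ^+ 2)%:E)); last 2 first.
- exact/measurable_EFinP/measurable_normc_sqr.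
- by move=> y; rewrite lee_fin sqr_ge0.
rewrite mulrC EFinM; apply: lee_wpmul2l.
  by rewrite lee_fin exprn_ge0// le_max lexx orbT.
case: ifP => _; last by apply: integral_ge0 => y _; rewrite lee_fin sqr_ge0.
by apply: cintegral_cauchy_schwarz => //; rewrite EY.
Qed.

Lemma radial_norm_proj_P Y f (e : R) : (0 <= e)%R -> cmeasurable_fun setT Y ->
  cmeasurable_fun setT f -> energy surface_measure Y = 1 ->
  L2norm lebesgue_rV f <= e%:E -> radial_norm N (proj_P Y f) <= e%:E.
Proof.
move=> e0 mY mf EY; rewrite L2norm_leP// radial_normP//.
by apply: le_trans; exact: proj_P_energy.
Qed.

Lemma lift_Q_le Y g (e : R) : (0 <= e)%R -> cmeasurable_fun setT Y -> L2rad N g ->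
  energy surface_measure Y = 1 -> radial_norm N g <= e%:E ->
  L2 lebesgue_rV (lift_Q Y g : X -> R[i]) /\ L2norm lebesgue_rV (lift_Q Y g : X -> R[i]) <= e%:E.
Proof.
move=> e0 mY [mg _] EY; rewrite radial_normP// -(lift_Q_energy mY mg EY) => he.
rewrite L2norm_leP//; split => //; apply/L2_energyP; split; first exact: lift_Q_measurable.
by apply: le_lt_trans he _; rewrite ltry.
Qed.

Lemma orthonormal_energy (I : eqType) (Omega : set I) (Y : I -> X -> R[i]) i :
  orthonormal_basis Omega Y -> Omega i -> energy surface_measure (Y i) = 1.
Proof.
move=> [LY oY _] Oi; have := oY i i Oi Oi; rewrite eqxx => /(congr1 (@complex.Re R)).
rewrite /cintegral /= /Rintegral => h.
have /L2_energyP[mY Yoo] := LY i Oi.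
rewrite -[LHS]fineK; last by rewrite ge0_fin_numE// energy_ge0.
congr EFin; rewrite -[RHS]h /energy; congr fine; apply: eq_integral => x _.
by rewrite ReM; have [-> ->] := conjc_ReIm (Y i x); rewrite normc_sqr mulrN opprK -!expr2.
Qed.

End dimension.
End sphere_projections.

(** * Measurability of the potential *)

Lemma halfline_continuous {R : realType} (h l : R -> R) :
  (forall r, 0 <= r -> (h s - h r) / (s - r) @[s --> within [set s | 0 <= s] r^'] --> l r) ->
  continuous (fun s : R => h (Num.max s 0)).
Proof.
move=> H r0; set r := Num.max r0 0.
have rge0 : 0 <= r by rewrite le_max lexx orbT.
(* Near r the difference quotients are within 1 of their limit, which gives |h t - h r| <= (|l r| +
   1) |t - r|. The retraction max(s, 0) is 1-Lipschitz and carries this over to the whole line. *)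
have /cvgrPdist_le/(_ 1 ltr01) := H r rge0.
move=> /nbhs_ballP[d d0 hd]; pose k := `|l r| + 1.
have k0 : 0 < k by rewrite ltr_wpDl.
apply/cvgrPdist_le => e e0; apply/nbhs_ballP; exists (Num.min d (e / k)).
  by rewrite /= lt_min d0 divr_gt0.
move=> s; rewrite /ball /= lt_min => /andP[sd se]; rewrite -/r.
set t := Num.max s 0; have t0 : 0 <= t by rewrite le_max lexx orbT.
have rt : `|r - t| <= `|r0 - s|.
  rewrite ler_norml /r /t; have := ler_norm (r0 - s); have := ler_norm (s - r0).
  have := normr_ge0 (r0 - s); rewrite (distrC s r0).
  by case: (leP r0 0); case: (leP s 0) => h1 h2 h3 h4 h5; apply/andP; split; lra.
have [->|tr] := eqVneq t r; first by rewrite subrr normr0 ltW.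
have {}hd := hd t _ tr t0; have {hd} := hd (le_lt_trans rt sd).
move=> hq; have tr0 : t - r != 0 by rewrite subr_eq0.
have : `|(h t - h r) / (t - r)| <= k.
  rewrite -[X in `|X|](subrK (l r)) addrC; apply: (le_trans (ler_normD _ _)).
  by rewrite /k lerD2l distrC.
rewrite normrM normfV ler_pdivrMr ?normr_gt0// distrC (distrC t) => hk.
apply: (le_trans hk); rewrite mulrC -ler_pdivlMr//.
exact/ltW/(le_lt_trans rt se).
Qed.

(** Differentiability on the half-line gives continuity there, and extending by the value at 0 makes
    V continuous on the line, hence Borel. *)
Lemma potential_measurable {R : realType} (n : nat) (V : R -> R[i]) :
  admissible_potential V -> cmeasurable_fun setT (fun x : 'rV[R]_n => V (enorm x)).
Proof.
move=> [C _ [_ [V' hV']]].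
have H (h : R -> R) : continuous (fun s : R => h (Num.max s 0)) ->
    measurable_fun setT (fun x : 'rV[R]_n => h (enorm x)).
  move=> /continuous_measurable_fun mh.
  rewrite (_ : (fun _ => _) = (fun s : R => h (Num.max s 0)) \o @enorm R n).
    by apply: measurableT_comp => //; exact: measurable_enorm.
  by apply/funext => x /=; rewrite max_l// enorm_ge0.
split.
- apply: (H (fun r => complex.Re (V r))).
  apply: (@halfline_continuous _ (fun r => complex.Re (V r)) (fun r => complex.Re (V' r))) => r r0.
  by have [[]] := hV' r r0.
- apply: (H (fun r => complex.Im (V r))).
  apply: (@halfline_continuous _ (fun r => complex.Im (V r)) (fun r => complex.Im (V' r))) => r r0.
  by have [[]] := hV' r r0.
Qed.

(** * The norm of L^2 as a real number *)

Section L2_distances.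
Context d (T : measurableType d) (R : realType) (mu : {measure set T -> \bar R}).
Implicit Types f g : T -> R[i].

(** On L^2 [fine] loses nothing, and estimates with real numbers chain by linear arithmetic. *)
Definition L2dist f : R := fine (L2norm mu f).

Lemma L2distE f : L2 mu f -> L2norm mu f = (L2dist f)%:E.
Proof. by move=> /L2_ge0_fin h; rewrite /L2dist fineK. Qed.

Lemma L2dist_ge0 f : 0 <= L2dist f.
Proof. by rewrite fine_ge0// L2norm_ge0. Qed.

Lemma L2dist_leP f e : L2 mu f -> (L2norm mu f <= e%:E)%E = (L2dist f <= e).
Proof. by move=> Lf; rewrite L2distE// lee_fin. Qed.

Lemma L2distD f g : L2 mu f -> L2 mu g ->
  L2dist (fun x => f x + g x) <= L2dist f + L2dist g.
Proof.
move=> Lf Lg; rewrite -lee_fin EFinD -!L2distE//; last exact: L2D.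
by apply: L2norm_normD; [case: Lf|case: Lg].
Qed.

Lemma L2distC f g : L2dist (fun x => f x - g x) = L2dist (fun x => g x - f x).
Proof. by rewrite /L2dist L2norm_distC. Qed.

Lemma L2distB f g : L2 mu f -> L2 mu g ->
  L2dist (fun x => f x - g x) <= L2dist f + L2dist g.
Proof.
move=> Lf Lg; rewrite -lee_fin EFinD -!L2distE//; last exact: L2B.
by apply: L2norm_normB; [case: Lf|case: Lg].
Qed.

Lemma L2dist_trans f g : L2 mu f -> L2 mu g ->
  L2dist f <= L2dist (fun x => f x - g x) + L2dist g.
Proof.
move=> Lf Lg; have := L2distD (L2B Lf Lg) Lg.
by rewrite (_ : (fun x => _ + _) = f)//; apply/funext => x; rewrite subrK.
Qed.

Lemma L2distZ c f : L2 mu f -> L2dist (fun x => c * f x) = normc c * L2dist f.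
Proof.
move=> Lf; apply: EFin_inj; rewrite EFinM -!L2distE//; last exact: L2Z.
by rewrite L2normZ//; case: Lf.
Qed.

Lemma L2dist_cvg0 (f_ : nat -> T -> R[i]) : (forall k, L2 mu (f_ k)) ->
  (L2norm mu (f_ k) @[k --> \oo] --> 0%E <->
   forall e, 0 < e -> exists K, forall k, (K <= k)%N -> L2dist (f_ k) <= e).
Proof.
move=> Lf; rewrite (cvge0P (fun k => L2norm_ge0 _ _)).
by split => h e e0; have [K hK] := h e e0; exists K => k /hK; rewrite L2dist_leP.
Qed.

End L2_distances.

(** * Resolvent set and resolvent bound for the full operator *)

Section resolvent_bound.
Context {R : realType} (n : nat).
Variables (b C w : R) (V : R -> R[i]).
Hypotheses (b0 : 0 < b) (C0 : 0 <= C).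
Hypothesis mV : cmeasurable_fun setT (fun x : 'rV[R]_n => V (enorm x)).
Hypothesis VC : forall r, 0 <= r -> normc (V r) <= C * japanese r ^- 2.
Hypothesis hw : resolvent_threshold b C <= w.
Implicit Types (u v f g : 'rV[R]_n -> R[i]).

Local Notation lam := ((n%:R + b) +i* w).
Local Notation nrm := (L2dist lebesgue_rV).
Let S u (x : 'rV[R]_n) : R[i] := lam * u x - diff_op V u x.

Let L2V u : L2 lebesgue_rV u -> L2 lebesgue_rV (fun x => V (enorm x) * u x).
Proof.
move=> Lu; apply: (L2_le _ (L2Z C%:C Lu)).
  by apply: cmeasurableM => //; case: Lu.
move=> x; rewrite !ComplexField.Normc.normcM ler_wpM2r ?normc_nneg//.
rewrite normc_real ger0_norm//; apply: (le_trans (VC (enorm_ge0 x))).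
rewrite japanese_bound ler_pdivrMr ?ltr_pwDl ?sqnorm_ge0//.
by rewrite ler_peMr// lerDl sqnorm_ge0.
Qed.

Let S_shift u x : S u x = shift_op lam u x - V (enorm x) * u x.
Proof. by rewrite /S diff_opE /shift_op opprD addrA. Qed.

Lemma cgpoly_diff_dom u : cgpoly u -> diff_dom V u.
Proof.
move=> gu; split; [exact: cgpoly_sobolev|exact: cgpoly_smooth|].
rewrite (_ : diff_op V u = fun x => free_op u x + V (enorm x) * u x); last by apply/funext.
by apply: L2D; [exact/cgpoly_L2/cgpoly_free_op|exact/L2V/cgpoly_L2].
Qed.

(** Here |(lambda - L_0) u| <= |S u| + |V u| and the last term is at most half of the left side, so
    |(lambda - L_0) u| <= 2 |S u|. This is the origin of the factor 2 in the final constant 2 /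
    b. *)
Lemma diff_dom_bound u : diff_dom V u ->
  [/\ L2 lebesgue_rV u, L2 lebesgue_rV (S u), b * nrm u <= 2 * nrm (S u) &
      2 * nrm (fun x => V (enorm x) * u x) <= nrm (shift_op lam u)].
Proof.
move=> [[Lu _] su Ld]; have LS : L2 lebesgue_rV (S u) := L2B (L2Z lam Lu) Ld.
have Ls : L2 lebesgue_rV (shift_op lam u).
  rewrite (_ : shift_op lam u = fun x => S u x + V (enorm x) * u x).
    by apply: L2D => //; exact: L2V.
  by apply/funext => x; rewrite S_shift subrK.
have [h1 h2] := a_priori b0 C0 mV VC hw su Lu Ls.
have {}h1 : b * nrm u <= nrm (shift_op lam u).
  by rewrite -lee_fin EFinM -!L2distE.
have {}h2 : 2 * nrm (fun x => V (enorm x) * u x) <= nrm (shift_op lam u).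
  by rewrite -lee_fin EFinM -!L2distE//; exact: L2V.
split => //; have := L2distD LS (L2V Lu).
rewrite (_ : (fun x => S u x + _) = shift_op lam u); first by lra.
by apply/funext => x; rewrite S_shift subrK.
Qed.

Let S_lin u v x : cgpoly u -> cgpoly v -> S (fun x => u x + v x) x = S u x + S v x.
Proof.
move=> gu gv; rewrite !S_shift; have := shift_op_lin lam 1 gu gv.
rewrite (_ : (fun x => 1 * u x + v x) = (fun x => u x + v x)); last first.
  by apply/funext => y; rewrite mul1r.
by move=> -> /=; rewrite mul1r mulrDr opprD addrACA.
Qed.

Let S0 x : S (fun=> 0) x = 0.
Proof. by rewrite S_shift shift_op0 mulr0 subr0. Qed.

Let SN u x : cgpoly u -> S (fun x => -1 * u x) x = - S u x.
Proof.
move=> gu; rewrite !S_shift; have := shift_op_lin lam (-1) gu (@cgpoly0 R n).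
rewrite (_ : (fun x => -1 * u x + 0) = (fun x => -1 * u x)); last first.
  by apply/funext => y; rewrite addr0.
move=> -> /=; rewrite shift_op0.
by move: (shift_op lam u x) (V (enorm x)) (u x) => p q r; ring.
Qed.

(** The range of lambda - L_0 on Gaussian polynomials is dense because its closure contains every
    Gaussian. *)
Let free_dense f e : L2 lebesgue_rV f -> 0 < e -> in_range lam f e.
Proof.
move=> Lf e0.
suff [_ H] : L2 lebesgue_rV f /\ forall e, 0 < e -> in_range lam f e by exact: H.
move: f Lf; apply: gaussians_dense => {e e0}.
- by move=> f [].
- move=> f g [Lf hf] [Lg hg]; split=> [|e e0]; first exact: L2D.
  have e2 : 0 < e / 2 by rewrite divr_gt0.
  have [u gu hu] := hf _ e2; have [v gv hv] := hg _ e2.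
  exists (fun x => 1 * u x + v x); first by apply: cgpolyD => //; exact: cgpolyZ.
  have Lu := cgpoly_L2 (cgpoly_shift_op lam gu); have Lv := cgpoly_L2 (cgpoly_shift_op lam gv).
  have hfu := L2B Lu Lf; have hgv := L2B Lv Lg.
  rewrite shift_op_lin// (_ : (fun x => _) = (fun x => (shift_op lam u x - f x) + (shift_op lam v x - g x))); last first.
    by apply/funext => x; rewrite mul1r opprD addrACA.
  move: hu hv; rewrite !L2dist_leP//; last exact: L2D.
  by have := L2distD hfu hgv; lra.
- move=> c f [Lf hf]; split=> [|e e0]; first exact: L2Z.
  have c0 : 0 < normc c + 1 by rewrite ltr_wpDl// normc_nneg.
  have := in_rangeZ c Lf.1 (hf _ (divr_gt0 e0 c0)); move=> /in_range_le; apply.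
  rewrite mulrA ler_pdivrMr// mulrDr mulr1 mulrC lerDl; exact: ltW.
- move=> f_ f hf_ Lf cv; split=> // e e0; have e2 : 0 < e / 2 by rewrite divr_gt0.
  have LB k : L2 lebesgue_rV (fun x => f_ k x - f x) by apply: L2B => //; exact: (hf_ k).1.
  have [K /(_ K (leqnn K)) hK] := (L2dist_cvg0 LB).1 cv _ e2.
  have := in_range_near (hf_ K).1.1 Lf.1 _ ((hf_ K).2 _ e2).
  move=> /(_ (e / 2)); rewrite L2dist_leP// => /(_ hK)/in_range_le; apply; lra.
- move=> a y a0; split=> [|e e0]; last exact: gaussian_in_range.
  by apply: cgpoly_L2; split => /=; [exact: gpoly_gaussian|exact: gpoly0].
Qed.

(** Solve the free equation up to |f| / 8. Then |V u| <= (1/2) (9/8) |f|, and the residual is at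
    most (1/8 + 9/16) |f| = (11/16) |f|, below 3/4. *)
Let S_approx_step f : L2 lebesgue_rV f ->
  exists2 u, cgpoly u & nrm (fun x => S u x - f x) <= 3 / 4 * nrm f.
Proof.
move=> Lf; have := L2dist_ge0 lebesgue_rV f; rewrite le_eqVlt => /orP[/eqP f0|f0].
  (* For |f| = 0 the tolerance |f| / 8 would not be positive; u = 0 does. *)
  exists (fun=> 0); first exact: cgpoly0.
  rewrite -f0 mulr0 (_ : (fun x => S (fun=> 0) x - f x) = (fun x => 0 * f x - f x)); last first.
    by apply/funext => x; rewrite S0 mul0r.
  by apply: (le_trans (L2distB (L2Z 0 Lf) Lf)); rewrite L2distZ// -f0 mulr0 addr0.
have e0 : 0 < nrm f / 8 by rewrite divr_gt0.
have [u gu hu] := free_dense Lf e0; exists u => //.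
have [Lu LS _ h2] := diff_dom_bound (cgpoly_diff_dom gu).
have Ls := cgpoly_L2 (cgpoly_shift_op lam gu).
move: hu; rewrite L2dist_leP => [hu|]; last exact: L2B.
have h3 := L2dist_trans Ls Lf.
have h4 := L2distB (L2B Ls Lf) (L2V Lu).
rewrite (_ : (fun x => S u x - f x) = (fun x => shift_op lam u x - f x - V (enorm x) * u x)).
  by lra.
by apply/funext => x; rewrite S_shift addrAC.
Qed.

(** The previous step is applied again to the residual f - S u, and the corrections are summed:
    after k rounds the residual is at most (3/4)^k |f|. *)
Let S_approx f (e : R) : L2 lebesgue_rV f -> 0 < e ->
  exists2 u, cgpoly u & nrm (fun x => S u x - f x) <= e.
Proof.
move=> Lf e0.
have H k : exists2 u, cgpoly u & nrm (fun x => S u x - f x) <= (3 / 4) ^+ k * nrm f.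
  elim: k => [|k [u gu hu]].
    exists (fun=> 0); first exact: cgpoly0.
    rewrite expr0 mul1r (_ : (fun x => S (fun=> 0) x - f x) = (fun x => 0 * f x - f x)); last first.
      by apply/funext => x; rewrite S0 mul0r.
    apply: (le_trans (L2distB (L2Z 0 Lf) Lf)); rewrite L2distZ//.
    by rewrite ComplexField.Normc.normc0 mul0r add0r.
  have [_ LS _ _] := diff_dom_bound (cgpoly_diff_dom gu).
  have Lr := L2B Lf LS; have [v gv hv] := S_approx_step Lr.
  exists (fun x => u x + v x); first exact: cgpolyD.
  rewrite (_ : (fun x => S (fun x => u x + v x) x - f x) = (fun x => S v x - (f x - S u x))); last first.
    apply/funext => x; rewrite S_lin//.
    by move: (S u x) (S v x) (f x) => p q r; ring.
  apply: (le_trans hv); rewrite exprS -(mulrA (3 / 4)).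
  by apply: ler_wpM2l; [rewrite divr_ge0|rewrite L2distC].
have /cvgrPdist_le/(_ e e0)[K _ /(_ K (leqnn K))] : geometric (nrm f) (3 / 4 : R) @ \oo --> (0 : R).
  by apply: cvg_geometric; rewrite ger0_norm//; lra.
rewrite /= sub0r normrN ger0_norm ?mulr_ge0 ?exprn_ge0 ?L2dist_ge0// => hK.
by have [u gu hu] := H K; exists u => //; rewrite (le_trans hu)// mulrC.
Qed.

(** The bound of [diff_dom_bound] passes to the limit in the graph. With u_k and L u_k within e / M
    of u and g, the total error is at most (b + 2 (|lambda| + 1)) e / M, whence [M]. *)
Lemma op_L_bound u g : op_L V u g ->
  b * nrm u <= 2 * nrm (fun x => lam * u x - g x).
Proof.
move=> [Lu Lg [u_ [Du cu cg]]].
have DB k := diff_dom_bound (Du k).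
have Luk k : L2 lebesgue_rV (u_ k) by case: (DB k).
have LSk k : L2 lebesgue_rV (S (u_ k)) by case: (DB k).
have LD k : L2 lebesgue_rV (diff_op V (u_ k)) by case: (Du k).
have LB1 k : L2 lebesgue_rV (fun x => u_ k x - u x) by exact: L2B.
have LB2 k : L2 lebesgue_rV (fun x => diff_op V (u_ k) x - g x) by exact: L2B.
have Lr : L2 lebesgue_rV (fun x => lam * u x - g x) by apply: L2B => //; exact: L2Z.
pose M := b + 2 * (normc lam + 1).
have M0 : 0 < M by rewrite ltr_pwDl// mulr_ge0// addr_ge0// normc_nneg.
apply/ler_addgt0Pr => e e0; have eM : 0 < e / M by rewrite divr_gt0.
have [K1 h1] := (L2dist_cvg0 LB1).1 cu _ eM.
have [K2 h2] := (L2dist_cvg0 LB2).1 cg _ eM.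
have := h1 (maxn K1 K2) (leq_maxl _ _); have := h2 (maxn K1 K2) (leq_maxr _ _).
move: (maxn K1 K2) => k hk2 hk1.
have [_ _ hb _] := DB k.
have t1 := L2dist_trans Lu (Luk k); rewrite L2distC in t1.
have t2 := L2dist_trans (LSk k) Lr.
have t3 := L2distB (L2Z lam (LB1 k)) (LB2 k).
rewrite (_ : (fun x => S (u_ k) x - (lam * u x - g x)) =
    (fun x => lam * (u_ k x - u x) - (diff_op V (u_ k) x - g x))) in t2; last first.
  apply/funext => x; rewrite /S mulrBr.
  by move: (lam * u_ k x) (lam * u x) (diff_op V (u_ k) x) (g x) => p q r s; ring.
rewrite L2distZ// in t3.
have l0 := normc_nneg lam.
have t4 := ler_wpM2l l0 hk1; have t5 := ler_wpM2l (ltW b0) hk1.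
have t6 := ler_wpM2l (ltW b0) t1.
have eE : M * (e / M) = e by rewrite mulrC divfK// lt0r_neq0.
move: eE; rewrite /M; move: (e / M) hk1 hk2 t4 t5 => q; lra.
Qed.

(** Approximate solutions with residuals 4^-k differ by at most (2 / b) (4^-k + 4^-(k+1)) by the a
    priori bound, so they converge fast enough for [L2_complete]. Their images under the operator
    converge to lambda u - f, so the limit lies in the closed graph. *)
Lemma op_L_surjective f : L2 lebesgue_rV f -> exists u, resolvent_eq (op_L V) lam f u.
Proof.
move=> Lf; have p4 k : 0 < (4^-1 : R) ^+ k by rewrite exprn_gt0.
have /choice[u_ hu] k : exists u, cgpoly u /\ nrm (fun x => S u x - f x) <= 4^-1 ^+ k.
  by have [u gu h] := S_approx Lf (p4 k); exists u.
have gu k : cgpoly (u_ k) := (hu k).1.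
have DB k := diff_dom_bound (cgpoly_diff_dom (gu k)).
have Lu k : L2 lebesgue_rV (u_ k) by case: (DB k).
have LS k : L2 lebesgue_rV (S (u_ k)) by case: (DB k).
have M0 : 0 <= 4 / b by rewrite divr_ge0// ltW.
have step k : (L2norm lebesgue_rV (fun x => u_ k.+1 x - u_ k x)%R <= (4 / b * 4^-1 ^+ k)%:E)%E.
  rewrite L2dist_leP; last exact: L2B.
  have gN : cgpoly (fun x => -1 * u_ k x) by exact: cgpolyZ.
  have [_ _ hb _] := diff_dom_bound (cgpoly_diff_dom (cgpolyD (gu k.+1) gN)).
  rewrite (_ : S (fun x => u_ k.+1 x + -1 * u_ k x) =
     (fun x => (S (u_ k.+1) x - f x) - (S (u_ k) x - f x))) in hb; last first.
    apply/funext => x; rewrite S_lin// SN//.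
    by move: (S (u_ k.+1) x) (S (u_ k) x) (f x) => p q r; ring.
  rewrite (_ : (fun x => u_ k.+1 x + -1 * u_ k x) = (fun x => u_ k.+1 x - u_ k x)) in hb; last first.
    by apply/funext => x; rewrite mulN1r.
  have := L2distB (L2B (LS k.+1) Lf) (L2B (LS k) Lf).
  have := (hu k).2; have := (hu k.+1).2; rewrite exprS => h1 h2 h3.
  have q0 := ltW (p4 k).
  rewrite mulrAC ler_pdivlMr// mulrC; apply: (le_trans hb); lra.
have [u Lu' cu] := L2_complete M0 Lu step.
exists u; exists (fun x => lam * u x - f x); last first.
  by apply: filterS (filterT); move=> x _ _ /=; rewrite subKr.
split => //; first by apply: L2B => //; exact: L2Z.
exists u_; split => //; first by move=> k; exact: cgpoly_diff_dom.
have LD k : L2 lebesgue_rV (diff_op V (u_ k)) by case: (cgpoly_diff_dom (gu k)).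
have LB1 k : L2 lebesgue_rV (fun x => u_ k x - u x) by exact: L2B.
have LB2 k : L2 lebesgue_rV (fun x => diff_op V (u_ k) x - (lam * u x - f x)).
  by apply: L2B => //; apply: L2B => //; exact: L2Z.
apply/(L2dist_cvg0 LB2) => e e0.
have l0 : 0 < normc lam + 1 by rewrite ltr_wpDl// normc_nneg.
have eM : 0 < e / 2 / (normc lam + 1) by rewrite !divr_gt0.
have e2 : 0 < e / 2 by rewrite divr_gt0.
have [K1 h1] := (L2dist_cvg0 LB1).1 cu _ eM.
have /cvgrPdist_le/(_ _ e2)[K2 _ h2] : geometric 1 (4^-1 : R) @ \oo --> (0 : R).
  by apply: cvg_geometric; rewrite ger0_norm//; lra.
exists (maxn K1 K2) => k; rewrite geq_max => /andP[k1 k2].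
have := h2 k k2; rewrite /= sub0r normrN mul1r ger0_norm ?(ltW (p4 k))// => {}h2.
have := h1 k k1; rewrite ler_pdivlMr// => {}h1.
rewrite (_ : (fun x => diff_op V (u_ k) x - _) =
   (fun x => lam * (u_ k x - u x) - (S (u_ k) x - f x))); last first.
  apply/funext => x; rewrite /S mulrBr.
  by move: (lam * u_ k x) (lam * u x) (diff_op V (u_ k) x) (f x) => p q r s; ring.
apply: (le_trans (L2distB (L2Z lam (LB1 k)) (L2B (LS k) Lf))); rewrite L2distZ//.
have := L2dist_ge0 lebesgue_rV (fun x => u_ k x - u x); have := (hu k).2; lra.
Qed.

(** The resolvent equation holds almost everywhere only, which is enough to exchange lambda u - g
    for f under the norm in [op_L_bound]. *)
Lemma resolvent_eq_bound f u : L2 lebesgue_rV f -> resolvent_eq (op_L V) lam f u ->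
  L2 lebesgue_rV u /\ nrm u <= 2 / b * nrm f.
Proof.
move=> Lf [g Gug e]; have := op_L_bound Gug; have [Lu Lg _] := Gug.
have Lr : L2 lebesgue_rV (fun x => lam * u x - g x) by apply: L2B => //; exact: L2Z.
rewrite {2}/L2dist (L2norm_ae_eq Lr.1 Lf.1 e) -/(nrm f) => h.
by split=> //; rewrite mulrAC ler_pdivlMr// mulrC.
Qed.

Lemma resolvent_set_op_L : resolvent_set (op_L (n := n) V) lam.
Proof.
split; first exact: op_L_surjective.
- move=> u hu; have L0 : L2 lebesgue_rV ((fun=> 0) : 'rV[R]_n -> R[i]) by exact: L20.
  have [Lu hle] := resolvent_eq_bound L0 hu.
  have n0 : nrm ((fun=> 0) : 'rV[R]_n -> R[i]) = 0 by rewrite /L2dist L2norm0.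
  apply: (L2norm_eq0 Lu.1); rewrite L2distE//; congr EFin.
  by apply/eqP; rewrite eq_le L2dist_ge0 andbT; move: hle; rewrite n0 mulr0.
- exists (2 / b) => f u Lf hu; have [Lu hle] := resolvent_eq_bound Lf hu.
  by rewrite !L2distE// -EFinM lee_fin.
Qed.

Lemma resolvent_bound f : L2 lebesgue_rV f ->
  L2 lebesgue_rV (resolvent (op_L V) lam f) /\
  nrm (resolvent (op_L V) lam f) <= 2 / b * nrm f.
Proof.
move=> Lf; apply: resolvent_eq_bound => //.
by have [u hu] := op_L_surjective Lf; exact: (xgetI (fun=> 0) hu).
Qed.

End resolvent_bound.

Theorem theorem2p6 (R : realType) (d : nat) (hd : (2 <= d)%N)
    (V : R -> R[i]) (hV : admissible_potential V)
    (Omega : set (nat * int)) (Y : nat * int -> 'rV[R]_d -> R[i])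
    (hY : harmonic_basis Omega Y)
    (b : R) (hb : 0 < b) :
  exists2 C : R, 0 < C &
    exists omega0 : R, forall omega : R, omega0 <= omega ->
      resolvent_set (op_L (n := d) V) ((d%:R + b) +i* omega) /\
      forall (l : nat) (m : int), Omega (l, m) ->
        (radial_opnorm d
           (reduced_resolvent V (Y (l, m)) ((d%:R + b) +i* omega)%R) <= C%:E)%E.
Proof.
have mV := potential_measurable d hV.
have [C C0 [VC _]] := hV.
exists (2 / b); first by rewrite divr_gt0.
exists (resolvent_threshold b C) => omega hw.
split; first exact: (resolvent_set_op_L hb (ltW C0) mV VC hw).
move=> l m Om; have [oY _ _] := hY.
(* The polar coordinate lemmas are stated in dimension d + 2; the assumption on the dimension
   removes the other two cases. *)
case: d => [|[|d]] // in hd Y hY mV hw oY *.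
have EY := orthonormal_energy oY Om.
have mY : cmeasurable_fun setT (Y (l, m)) by have [LY _ _] := oY; case: (LY _ Om).
have b2 : 0 <= 2 / b by rewrite divr_ge0// ltW.
apply: ub_ereal_sup => _ [g [Lg g1] <-]; rewrite /reduced_resolvent.
have [Lf f1] := lift_Q_le ler01 mY Lg EY g1.
have [Lu hu] := resolvent_bound hb (ltW C0) mV VC hw Lf.
apply: radial_norm_proj_P => //; first by case: Lu.
rewrite L2dist_leP//; apply: (le_trans hu).
by rewrite L2dist_leP// in f1; rewrite ler_piMr.
Qed.
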